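(* Let $\phi$ be an analytic self-map of $\mathbb{D}$ belonging to the disk algebra $A(\mathbb{D})$, such that $\phi(\overline{\mathbb{D}}) \cap \partial\mathbb{D} = \{\xi_1,\ldots,\xi_p\}$ ($p \geq 1$, the $\xi_j$ distinct). Assume that $\phi$ is globally-regular, with associated modulus of continuity $\omega$ (concave and satisfying $\lim_{h\to 0^+} \omega(h)/h = \infty$). Then there are constants $\kappa, \sigma, K > 0$, depending only on $\phi$, such that, setting for every integer $N \geq 1$ $$d_N = \bigg[ \sigma \log \frac{\kappa\, 2^{-N}}{\omega^{-1}(\kappa\, 2^{-N})} \bigg] + 1,$$ where $[\ \ ]$ is the integer part, and, for every integer $q \geq 1$, letting $N_q$ be the largest integer $N \geq 1$ such that $p\, N d_N < q$ (and $N_q = 1$ if no such $N$ exists), one has for every $q \geq 1$: $$a_q(C_\phi) \leq K \sqrt{\frac{\omega^{-1}(\kappa\, 2^{-N_q})}{\kappa\, 2^{-N_q}}}\,.$$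
   Context: $\mathbb{D}$ is the open unit disk, $\mathbb{T} = \partial\mathbb{D}$ the unit circle, and $A(\mathbb{D})$ is the space of functions continuous on $\overline{\mathbb{D}}$ and analytic in $\mathbb{D}$. For an analytic $\phi : \mathbb{D} \to \mathbb{D}$ (a symbol), $C_\phi : H^2 \to H^2$, $C_\phi(f) = f\circ\phi$, is the composition operator on the Hardy space $H^2$ of the disk (always bounded). The approximation numbers of a bounded operator $T$ are $a_n(T) = \inf\{\|T - R\| : \mathrm{rank}\,(R) < n\}$, $n = 1,2,\ldots$ A modulus of continuity is a continuous function $\omega : [0,A] \to \mathbb{R}^+$ (for some $A>0$) which is increasing, sub-additive and vanishes at $0$. Throughout, moduli of continuity are assumed concave on $[0,A]$, so that $x \mapsto \omega^{-1}(x)/x$ is non-decreasing, where $\omega^{-1}$ is the inverse function of $\omega$, defined on $[0,\omega(A)]$ (the constant $\kappa$ is understood to be such that $\omega^{-1}(\kappa 2^{-N})$ is defined for all $N\ge 1$). It is also assumed that $\lim_{h\to 0^+}\omega(h)/h = \infty$. Global regularity: let $\phi \in A(\mathbb{D})$ be a symbol with $\phi(\overline{\mathbb{D}})\cap\partial\mathbb{D} = \{\xi_1,\ldots,\xi_p\}$. Write $\gamma(t) = \phi(e^{it})$ and $E_{\xi_j} = \{t : \gamma(t) = \xi_j\}$, where $t$ ranges over the circle $\mathbb{R}/2\pi\mathbb{Z}$ (identified with $\mathbb{T}$) and $|t-s|$ denotes the distance modulo $2\pi$. Then $\phi$ is globally-regular if there exist a modulus of continuity $\omega$ and numbers $r_1,\ldots,r_p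 > 0$ (in the range where $\omega$ is defined) such that $\mathbb{T} = \bigcup_{j=1}^p \big(E_{\xi_j} + [-r_j, r_j]\big)$, and constants $C, c > 0$ such that for $j = 1,\ldots,p$, every $t_j \in E_{\xi_j}$ and every $t$ with $|t - t_j| \leq r_j$: (1') $|\gamma(t) - \gamma(t_j)| \leq C\,(1 - |\gamma(t)|)$; (2') $c\,\omega(|t - t_j|) \leq |\gamma(t) - \gamma(t_j)|$. The data $\omega, r_j, C, c$ are regarded as fixed along with $\phi$. *)

(* Defs.v *)
From Stdlib Require Import Reals ZArith.
From Coquelicot Require Import Coquelicot.
Open Scope R_scope.

(** A function on the disk is represented by a total function [C -> C], of which only
    the values on the relevant (open or closed) disk are ever used. *)

Definition in_disk (z : C) : Prop := Cmod z < 1.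
Definition in_cdisk (z : C) : Prop := Cmod z <= 1.

Definition eq_disk (f g : C -> C) : Prop := forall z, in_disk z -> f z = g z.

(** [ex_derive] is taken over the field [C]: this is complex differentiability. *)
Definition analytic_disk (f : C -> C) : Prop :=
  forall z : C, in_disk z -> ex_derive (K := C_AbsRing) (V := C_NormedModule) f z.

Definition disk_algebra (f : C -> C) : Prop :=
  continuous_on in_cdisk f /\ analytic_disk f.

Definition symbol (phi : C -> C) : Prop :=
  analytic_disk phi /\ (forall z, in_disk z -> in_disk (phi z)).

(** [polar r t] is $r e^{it}$. *)
Definition polar (r t : R) : C := (r * cos t, r * sin t).

(** * The Hardy space *)

Definition mean2 (f : C -> C) (r : R) : R :=
  sqrt (/ (2 * PI) * RInt (fun t => (Cmod (f (polar r t))) ^ 2) 0 (2 * PI)).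

(** For analytic [f] the value is [p_infty] exactly when [f] is not in the Hardy space. *)
Definition h2norm (f : C -> C) : Rbar :=
  Lub_Rbar (fun x => exists r, 0 <= r < 1 /\ x = mean2 f r).

Definition H2 (f : C -> C) : Prop := analytic_disk f /\ is_finite (h2norm f).

(** * Operators and approximation numbers *)

Definition op : Type := (C -> C) -> (C -> C).

Definition comp_op (phi : C -> C) : op := fun f z => f (phi z).

Definition op_minus (T S : op) : op := fun f z => (T f z - S f z)%C.

Definition opnorm (T : op) : Rbar :=
  Rbar_lub (fun x => exists f, H2 f /\ Rbar_le (h2norm f) (Finite 1) /\ x = h2norm (T f)).

(** Elements of $H^2$ are functions up to [eq_disk], which [bop_ext] and [bop_lin] take
    into account. *)
Record bounded_op (T : op) : Prop := {
  bop_maps : forall f, H2 f -> H2 (T f);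
  bop_ext : forall f g, H2 f -> H2 g -> eq_disk f g -> eq_disk (T f) (T g);
  bop_lin : forall (a : C) f g, H2 f -> H2 g ->
    eq_disk (T (fun z => (a * f z + g z)%C)) (fun z => (a * T f z + T g z)%C);
  bop_bounded : is_finite (opnorm T)
}.

(** The range is spanned by [m < n] functions [g 1, ..., g m]; the sum is empty if
    [m = 0]. *)
Definition rank_lt (T : op) (n : nat) : Prop :=
  exists (m : nat) (g : nat -> C -> C), (m < n)%nat /\
    (forall i, (1 <= i <= m)%nat -> H2 (g i)) /\
    forall f, H2 f -> exists c : nat -> C,
      eq_disk (T f) (fun z => sum_n_m (G := C_AbelianMonoid) (fun i => (c i * g i z)%C) 1 m).

Definition approx_number (n : nat) (T : op) : Rbar :=
  Rbar_glb (fun x => exists S : op,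
    bounded_op S /\ rank_lt S n /\ x = opnorm (op_minus T S)).

(** * Moduli of continuity *)

(** Increasing is strict: the modulus is required to have an inverse function. *)
Record modulus (w : R -> R) (A : R) : Prop := {
  mod_pos : 0 < A;
  mod_cont : continuous_on (fun x => 0 <= x <= A) w;
  mod_incr : forall x y, 0 <= x -> x < y -> y <= A -> w x < w y;
  mod_subadd : forall x y, 0 <= x -> 0 <= y -> x + y <= A -> w (x + y) <= w x + w y;
  mod_zero : w 0 = 0
}.

Definition concave_upto (w : R -> R) (A : R) : Prop :=
  forall x y s, 0 <= x <= A -> 0 <= y <= A -> 0 <= s <= 1 ->
    s * w x + (1 - s) * w y <= w (s * x + (1 - s) * y).

(** [winv], on $[0, \omega(A)]$, is the inverse of $\omega : [0,A] \to [0,\omega(A)]$. *)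
Definition inverse_upto (w : R -> R) (A : R) (winv : R -> R) : Prop :=
  (forall x, 0 <= x <= A -> winv (w x) = x) /\
  (forall y, 0 <= y <= w A -> 0 <= winv y <= A /\ w (winv y) = y).

(** * Global regularity *)

(** Points of $\mathbb R/2\pi\mathbb Z$ are given by real representatives. *)
Definition circ_dist (s t : R) : R :=
  real (Glb_Rbar (fun x => exists k : Z, x = Rabs (s - t + 2 * PI * IZR k))).

Definition bdry (phi : C -> C) (t : R) : C := phi (polar 1 t).

Definition contact_set (phi : C -> C) (p : nat) (xi : nat -> C) : Prop :=
  (forall i j, (1 <= i <= p)%nat -> (1 <= j <= p)%nat -> xi i = xi j -> i = j) /\
  (forall w : C, ((exists z, in_cdisk z /\ phi z = w) /\ Cmod w = 1) <->
     (exists j, (1 <= j <= p)%nat /\ w = xi j)).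

Record globally_regular (phi : C -> C) (p : nat) (xi : nat -> C)
    (w : R -> R) (A : R) (r : nat -> R) (C0 c0 : R) : Prop := {
  gr_radius : forall j, (1 <= j <= p)%nat -> 0 < r j <= A;
  gr_consts : 0 < C0 /\ 0 < c0;
  gr_cover : forall t : R, exists (j : nat) (tj : R),
    (1 <= j <= p)%nat /\ bdry phi tj = xi j /\ circ_dist t tj <= r j;
  gr_nontangential : forall (j : nat) (tj t : R),
    (1 <= j <= p)%nat -> bdry phi tj = xi j -> circ_dist t tj <= r j ->
    Cmod (bdry phi t - bdry phi tj)%C <= C0 * (1 - Cmod (bdry phi t));
  gr_lower : forall (j : nat) (tj t : R),
    (1 <= j <= p)%nat -> bdry phi tj = xi j -> circ_dist t tj <= r j ->
    c0 * w (circ_dist t tj) <= Cmod (bdry phi t - bdry phi tj)%C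
}.

(** * The integers $d_N$ and $N_q$ *)

(** Stdlib's [Int_part] is the floor function. *)
Definition d_of (winv : R -> R) (sigma kappa : R) (N : nat) : Z :=
  (Int_part (sigma * ln ((kappa / 2 ^ N) / winv (kappa / 2 ^ N)))%R + 1)%Z.

Definition is_Nq (p : nat) (d : nat -> Z) (q N : nat) : Prop :=
  let ok M := (1 <= M)%nat /\ (Z.of_nat p * Z.of_nat M * d M < Z.of_nat q)%Z in
  (ok N /\ forall M, ok M -> (M <= N)%nat) \/ ((forall M, ~ ok M) /\ N = 1%nat).

(* Main.v *)
Require Import Defs.
From Stdlib Require Import Reals ZArith Lra Lia.
From Stdlib Require Import Classical ClassicalEpsilon FunctionalExtensionality.
From Coquelicot Require Import Coquelicot.
Open Scope R_scope.

(** The approximants are $f \mapsto C_\phi P f$, where $P$ is the orthogonal projection of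
    $H^2$ on the orthogonal complement of $B H^2$ and $B$ is the Blaschke product with zeros
    $(1-\lambda 2^{-k})\xi_j$, $1 \le k \le N$, $1 \le j \le p$, each of multiplicity $d_N$.
    Their rank is at most $p N d_N$, and $f - Pf = B g$ with $\|g\| \le \|f\|$, so everything rests
    on bounding the norm of $(B g)\circ\phi$.

    Three estimates do this. First, a point $\gamma(t)$ at a distance $s$ from a contact
    parameter, with $\omega(s) \ge \kappa 2^{-N}$, lies in a Stolz angle at some $\xi_j$ and is
    therefore at a bounded hyperbolic distance from one of the zeros; the multiplicity makes
    $|B|^2$ at most $\varepsilon_N = \omega^{-1}(\kappa 2^{-N})/(\kappa 2^{-N})$ there
    ([bprod_small]). Secondly, $|\gamma(t)| \le 1 - c_1\omega(s)$, and the concavity of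
    $\omega$ turns this into the linear bound $1 - c_1 s/\varepsilon_N$ when
    $\omega(s) \le \kappa 2^{-N}$, and into $1 - b_2 s$ in general. Thirdly, if $g$ has
    coefficients $g_k$, then
    $\int_0^1 (\sum |g_k| x^{k+1})^2 dx \le 4 \sum |g_k|^2$, which follows from Hardy's inequality
    ([RInt_rpoly_sq]). A linear change of variable now bounds the integral of
    $|Bg|^2\circ\gamma$ around each contact point by a multiple of
    $\varepsilon_N \|g\|^2$: near the point because the slope is $c_1/\varepsilon_N$, away from
    it because of $B$ ([boundary_estimate]). There are finitely many contact points, because
    the two regularity conditions separate them ([finite_cover]).

    Analyticity is complex differentiability at each point, and the Hardy norm is a supremum
    of means over circles inside the disk, so two bridges are needed. Goursat's theorem on
    rectangles in the coordinates $\log z$ shows that circle averages of an analytic function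
    do not depend on the radius, which yields Cauchy's formula and the Taylor series
    ([taylor_series]); Bessel's inequality then identifies elements of $H^2$ with
    square-summable sequences. On sequences, division by one Blaschke factor is an explicit
    contraction ([divide_l2b], [divide_identity]), and $P$ is obtained by iterating it
    ([tm_expansion]). In the other direction, quadratic means of a function of the disk algebra
    increase up to the boundary mean ([ravg_sq_boundary]). *)


(** * Continuity of complex-valued functions, and averages over the circle *)

Definition Rd (x y : R) : R := Rabs (y - x).
Definition Cd (x y : C) : R := Cmod (y - x).
Definition R2d (p q : R * R) : R := Rmax (Rd (fst p) (fst q)) (Rd (snd p) (snd q)).

(** Continuity at a point. The distance [d] of the source is a parameter, so that one set of
    rules serves functions of a real variable, of a complex variable and of two real
    variables. *)
Definition cat {T : Type} (d : T -> T -> R) (f : T -> C) (x : T) : Prop :=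
  forall eps, 0 < eps -> exists del, 0 < del /\ forall y, d x y < del -> Cmod (f y - f x) < eps.

Lemma cat_const {T} (d : T -> T -> R) c x : cat d (fun _ => c) x.
Proof.
  intros eps He. exists 1. split; [lra|]. intros y _.
  replace (c - c)%C with (RtoC 0) by ring. rewrite Cmod_0. exact He.
Qed.

Lemma cat_plus {T} (d : T -> T -> R) f g x :
  cat d f x -> cat d g x -> cat d (fun y => f y + g y)%C x.
Proof.
  intros Hf Hg eps He.
  destruct (Hf (eps / 2) ltac:(lra)) as [d1 [Hd1 H1]].
  destruct (Hg (eps / 2) ltac:(lra)) as [d2 [Hd2 H2]].
  exists (Rmin d1 d2). split; [apply Rmin_pos; auto|]. intros y Hy.
  assert (A1 := H1 y (Rlt_le_trans _ _ _ Hy (Rmin_l _ _))).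
  assert (A2 := H2 y (Rlt_le_trans _ _ _ Hy (Rmin_r _ _))).
  replace (f y + g y - (f x + g x))%C with ((f y - f x) + (g y - g x))%C by ring.
  eapply Rle_lt_trans; [apply Cmod_triangle|]. lra.
Qed.

Lemma cat_mult {T} (d : T -> T -> R) f g x :
  cat d f x -> cat d g x -> cat d (fun y => f y * g y)%C x.
Proof.
  intros Hf Hg eps He.
  set (A := Cmod (f x)). set (B := Cmod (g x)).
  assert (HA : 0 <= A) by apply Cmod_ge_0. assert (HB : 0 <= B) by apply Cmod_ge_0.
  set (e := Rmin 1 (eps / (2 + A + B))).
  assert (He0 : 0 < eps / (2 + A + B)) by (apply Rdiv_lt_0_compat; lra).
  assert (He' : 0 < e) by (apply Rmin_pos; lra).
  assert (e1 : e <= 1) by apply Rmin_l.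
  assert (e2 : e * (2 + A + B) <= eps).
  { apply Rle_trans with (eps / (2 + A + B) * (2 + A + B)).
    - apply Rmult_le_compat_r; [lra|apply Rmin_r].
    - right. field. lra. }
  destruct (Hf e He') as [d1 [Hd1 H1]].
  destruct (Hg e He') as [d2 [Hd2 H2]].
  exists (Rmin d1 d2). split; [apply Rmin_pos; auto|]. intros y Hy.
  assert (A1 := H1 y (Rlt_le_trans _ _ _ Hy (Rmin_l _ _))).
  assert (A2 := H2 y (Rlt_le_trans _ _ _ Hy (Rmin_r _ _))).
  replace (f y * g y - f x * g x)%C
    with (((f y - f x) * (g y - g x) + (f y - f x) * g x) + f x * (g y - g x))%C by ring.
  eapply Rle_lt_trans; [apply Cmod_triangle|].
  eapply Rle_lt_trans; [apply Rplus_le_compat_r, Cmod_triangle|].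
  rewrite !Cmod_mult. fold A B.
  assert (P1 := Cmod_ge_0 (f y - f x)). assert (P2 := Cmod_ge_0 (g y - g x)).
  nra.
Qed.

Lemma cat_comp {T} (d : T -> T -> R) (f : C -> C) (g : T -> C) x :
  cat d g x -> cat Cd f (g x) -> cat d (fun y => f (g y)) x.
Proof.
  intros Hg Hf eps He. destruct (Hf eps He) as [d1 [Hd1 H1]].
  destruct (Hg d1 Hd1) as [d2 [Hd2 H2]]. exists d2. split; auto.
  intros y Hy. apply (H1 (g y)). apply H2, Hy.
Qed.

Lemma cat_id z : cat Cd (fun y => y) z.
Proof. intros eps He. exists eps. split; auto. Qed.

Lemma cat_opp {T} (d : T -> T -> R) f x : cat d f x -> cat d (fun y => - f y)%C x.
Proof.
  intros Hf eps He. destruct (Hf eps He) as [e [He1 H]]. exists e. split; auto.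
  intros y Hy. replace (- f y - - f x)%C with (- (f y - f x))%C by ring.
  rewrite Cmod_opp. auto.
Qed.

Lemma cat_minus {T} (d : T -> T -> R) f g x :
  cat d f x -> cat d g x -> cat d (fun y => f y - g y)%C x.
Proof. intros. apply (cat_plus d f (fun y => - g y)%C); auto using cat_opp. Qed.

Lemma cat_conj {T} (d : T -> T -> R) f x : cat d f x -> cat d (fun y => Cconj (f y)) x.
Proof.
  intros Hf eps He. destruct (Hf eps He) as [e [He1 H]]. exists e. split; auto.
  intros y Hy. rewrite <- Cminus_conj, Cmod_conj. auto.
Qed.

Lemma Cmod_minus_sym (a b : C) : Cmod (a - b) = Cmod (b - a).
Proof. rewrite <- Cmod_opp. f_equal. ring. Qed.

Lemma Cmod_triangle_inv (a b : C) : Rabs (Cmod a - Cmod b) <= Cmod (a - b).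
Proof.
  assert (A1 := Cmod_triangle (a - b) b). assert (A2 := Cmod_triangle (b - a) a).
  replace (a - b + b)%C with a in A1 by ring. replace (b - a + a)%C with b in A2 by ring.
  rewrite (Cmod_minus_sym b a) in A2. apply Rabs_le. lra.
Qed.

Lemma cat_inv {T} (d : T -> T -> R) f x :
  cat d f x -> f x <> 0 -> cat d (fun y => / f y)%C x.
Proof.
  intros Hf H0 eps He. set (A := Cmod (f x)).
  assert (HA : 0 < A) by (apply Cmod_gt_0; auto).
  set (e := Rmin (A / 2) (eps * A * A / 2)).
  assert (He' : 0 < e) by (apply Rmin_pos; [lra|]; apply Rdiv_lt_0_compat; [|lra];
    repeat apply Rmult_lt_0_compat; lra).
  destruct (Hf e He') as [d1 [Hd1 H1]]. exists d1. split; auto.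
  intros y Hy. specialize (H1 y Hy).
  assert (B1 : e <= A / 2) by apply Rmin_l.
  assert (B2 : e <= eps * A * A / 2) by apply Rmin_r.
  assert (B3 : A / 2 < Cmod (f y)).
  { assert (T1 := Cmod_triangle_inv (f y) (f x)). fold A in T1. apply Rabs_le_between in T1. lra. }
  assert (Hy0 : f y <> 0) by (apply Cmod_gt_0; lra).
  replace (/ f y - / f x)%C with (- (f y - f x) / (f y * f x))%C by (field; auto).
  rewrite Cmod_div by (apply Cmult_neq_0; auto). rewrite Cmod_opp, Cmod_mult. fold A.
  apply Rmult_lt_reg_r with (Cmod (f y) * A); [nra|].
  unfold Rdiv. rewrite Rmult_assoc, Rinv_l by nra.
  apply Rlt_le_trans with (eps * A * A / 2); [lra|]. 
  assert (eps * A * (A / 2) <= eps * A * Cmod (f y)) by (apply Rmult_le_compat_l; [nra|lra]).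
  nra.
Qed.

Lemma cat_pow {T} (d : T -> T -> R) f x n : cat d f x -> cat d (fun y => f y ^ n)%C x.
Proof.
  intros Hf. induction n as [|n IH]; simpl; [apply cat_const|apply cat_mult; auto].
Qed.

Lemma cat_ext {T} (d : T -> T -> R) f g x :
  (forall y, f y = g y) -> cat d f x -> cat d g x.
Proof.
  intros E H eps He. destruct (H eps He) as [e [H1 H2]]. exists e. split; auto.
  intros y Hy. rewrite <- !E. auto.
Qed.

(** ** Finite sums *)

Fixpoint csum (f : nat -> C) (n : nat) : C :=
  match n with O => RtoC 0 | S k => (csum f k + f k)%C end.

Fixpoint rsum (f : nat -> R) (n : nat) : R :=
  match n with O => 0 | S k => rsum f k + f k end.

Lemma csum_ext f g n : (forall k, (k < n)%nat -> f k = g k) -> csum f n = csum g n.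
Proof.
  induction n as [|n IH]; intros H; simpl; auto. rewrite IH, H; auto.
Qed.

Lemma rsum_ext f g n : (forall k, (k < n)%nat -> f k = g k) -> rsum f n = rsum g n.
Proof.
  induction n as [|n IH]; intros H; simpl; auto. rewrite IH, H; auto.
Qed.

Lemma rsum_le f g n : (forall k, (k < n)%nat -> f k <= g k) -> rsum f n <= rsum g n.
Proof.
  induction n as [|n IH]; intros H; simpl; [lra|]. apply Rplus_le_compat; auto.
Qed.

Lemma rsum_nonneg f n : (forall k, 0 <= f k) -> 0 <= rsum f n.
Proof. intros H; induction n; simpl; [lra|]. specialize (H n). lra. Qed.

Lemma rsum_mono f n m : (forall k, 0 <= f k) -> (n <= m)%nat -> rsum f n <= rsum f m.
Proof.
  intros H Hnm; induction Hnm as [|m Hnm IH]; [lra|]. simpl. specialize (H m). lra.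
Qed.

Lemma rsum_scal c f n : rsum (fun k => c * f k) n = c * rsum f n.
Proof. induction n as [|n IH]; simpl; [ring|]. rewrite IH. ring. Qed.

Lemma rsum_plus f g n : rsum (fun k => f k + g k) n = rsum f n + rsum g n.
Proof. induction n as [|n IH]; simpl; [ring|]. rewrite IH. ring. Qed.

Lemma rsum_term_le f n k : (forall i, 0 <= f i) -> (k < n)%nat -> f k <= rsum f n.
Proof.
  intros H Hk. apply Rle_trans with (rsum f (S k)); [|apply rsum_mono; auto].
  simpl. assert (A := rsum_nonneg f k H). lra.
Qed.

Lemma rsum_shift f n m : rsum f (n + m) = rsum f n + rsum (fun k => f (n + k)%nat) m.
Proof.
  induction m as [|m IH]; [rewrite Nat.add_0_r; simpl; ring|].
  rewrite Nat.add_succ_r. simpl. rewrite IH. ring.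
Qed.

Lemma csum_scal c f n : csum (fun k => c * f k)%C n = (c * csum f n)%C.
Proof. induction n as [|n IH]; simpl; [ring|]. rewrite IH. ring. Qed.

Lemma csum_plus f g n : csum (fun k => f k + g k)%C n = (csum f n + csum g n)%C.
Proof. induction n as [|n IH]; simpl; [ring|]. rewrite IH. ring. Qed.

Lemma csum_shift f n m :
  csum f (n + m) = (csum f n + csum (fun k => f (n + k)%nat) m)%C.
Proof.
  induction m as [|m IH]; [rewrite Nat.add_0_r; simpl; ring|].
  rewrite Nat.add_succ_r. simpl. rewrite IH. ring.
Qed.

Lemma Cmod_csum f n : Cmod (csum f n) <= rsum (fun k => Cmod (f k)) n.
Proof.
  induction n as [|n IH]; simpl; [rewrite Cmod_0; lra|].
  eapply Rle_trans; [apply Cmod_triangle|]. lra.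
Qed.

Lemma cat_csum {T} (d : T -> T -> R) (f : nat -> T -> C) x n :
  (forall k, cat d (f k) x) -> cat d (fun y => csum (fun k => f k y) n) x.
Proof.
  intros H; induction n; simpl; [apply cat_const|apply cat_plus; auto].
Qed.

Lemma rsum_geom x n : x <> 1 -> rsum (fun k => x ^ k) n = (1 - x ^ n) / (1 - x).
Proof.
  intros Hx. induction n as [|n IH]; simpl; [field; lra|]. rewrite IH. field. lra.
Qed.

Lemma rsum_geom_le x n : 0 <= x < 1 -> rsum (fun k => x ^ k) n <= / (1 - x).
Proof.
  intros Hx. rewrite rsum_geom by lra. assert (0 <= x ^ n) by (apply pow_le; lra).
  unfold Rdiv. rewrite <- (Rmult_1_l (/ (1 - x))) at 2. apply Rmult_le_compat_r; [|lra].
  left. apply Rinv_0_lt_compat. lra.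
Qed.

(** ** Integrals of complex-valued functions *)

Lemma cat_continuous_C h t : cat Rd h t -> continuous (U := C_UniformSpace) h t.
Proof.
  intros H P [eps HP]. 
  destruct (H eps (cond_pos eps)) as [del [Hd H1]].
  exists (mkposreal del Hd). intros s Hs. apply HP.
  apply C_NormedModule_mixin_compat1. apply H1. exact Hs.
Qed.

Lemma cat_continuous_R (h : R -> R) t :
  cat Rd (fun s => RtoC (h s)) t -> continuous h t.
Proof.
  intros H P [eps HP].
  destruct (H eps (cond_pos eps)) as [del [Hd H1]].
  exists (mkposreal del Hd). intros s Hs. apply HP.
  specialize (H1 s Hs). rewrite <- RtoC_minus, Cmod_R in H1. exact H1.
Qed.

Lemma continuous_cat_R (h : R -> R) t :
  continuous h t -> cat Rd (fun s => RtoC (h s)) t.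
Proof.
  intros H eps He.
  destruct (H (fun y => Rabs (y - h t) < eps)) as [del Hd].
  { exists (mkposreal eps He). intros y Hy. exact Hy. }
  exists del. split; [apply cond_pos|]. intros s Hs.
  rewrite <- RtoC_minus, Cmod_R. apply Hd. exact Hs.
Qed.

Lemma cat_Cmod {T} (d : T -> T -> R) f x :
  cat d f x -> cat d (fun y => RtoC (Cmod (f y))) x.
Proof.
  intros Hf eps He. destruct (Hf eps He) as [e [He1 H]]. exists e. split; auto.
  intros y Hy. rewrite <- RtoC_minus, Cmod_R.
  eapply Rle_lt_trans; [apply Cmod_triangle_inv|]. auto.
Qed.

Lemma cat_Cmod2 {T} (d : T -> T -> R) f x :
  cat d f x -> cat d (fun y => RtoC (Cmod (f y) ^ 2)) x.
Proof.
  intros Hf. apply cat_ext with (fun y => (RtoC (Cmod (f y)) * RtoC (Cmod (f y)))%C).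
  - intros y. rewrite <- RtoC_mult. f_equal. ring.
  - apply cat_mult; apply cat_Cmod; auto.
Qed.

Definition CInt (h : R -> C) (a b : R) : C := RInt (V := C_R_CompleteNormedModule) h a b.

Lemma ex_CInt h a b : (forall t, Rmin a b <= t <= Rmax a b -> cat Rd h t) ->
  ex_RInt (V := C_R_CompleteNormedModule) h a b.
Proof. intros H. apply ex_RInt_continuous. intros t Ht. apply cat_continuous_C. auto. Qed.

Lemma norm_C_R (x : C) : @norm R_AbsRing C_R_NormedModule x = Cmod x.
Proof.
  change (sqrt (Rabs (fst x) ^ 2 + Rabs (snd x) ^ 2) = Cmod x).
  unfold Cmod. rewrite !pow2_abs. reflexivity.
Qed.

Lemma CInt_bound h a b M : a <= b -> (forall t, a <= t <= b -> cat Rd h t) ->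
  (forall t, a <= t <= b -> Cmod (h t) <= M) -> Cmod (CInt h a b) <= (b - a) * M.
Proof.
  intros Hab Hc HM.
  assert (H := norm_RInt_le_const (V := C_R_CompleteNormedModule) h a b (CInt h a b) M Hab).
  rewrite <- norm_C_R. apply H; [intros t Ht; rewrite norm_C_R; auto|]. apply (RInt_correct (V := C_R_CompleteNormedModule)), ex_CInt.
  rewrite Rmin_left, Rmax_right by auto. auto.
Qed.

Lemma CInt_ext h g a b : (forall t, Rmin a b < t < Rmax a b -> h t = g t) ->
  CInt h a b = CInt g a b.
Proof. intros H. apply (RInt_ext (V := C_R_CompleteNormedModule)). auto. Qed.

Lemma CInt_plus h g a b : a <= b ->
  (forall t, a <= t <= b -> cat Rd h t) -> (forall t, a <= t <= b -> cat Rd g t) ->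
  CInt (fun t => h t + g t)%C a b = (CInt h a b + CInt g a b)%C.
Proof.
  intros Hab Hh Hg.
  apply (RInt_plus (V := C_R_CompleteNormedModule)); apply ex_CInt;
    rewrite Rmin_left, Rmax_right by auto; auto.
Qed.

Lemma CInt_Chasles h a b c : a <= b -> b <= c ->
  (forall t, a <= t <= c -> cat Rd h t) ->
  CInt h a c = (CInt h a b + CInt h b c)%C.
Proof.
  intros Hab Hbc Hh. symmetry.
  apply (RInt_Chasles (V := C_R_CompleteNormedModule)); apply ex_CInt;
    rewrite Rmin_left, Rmax_right by auto; intros; apply Hh; lra.
Qed.

Lemma CInt_pair h a b : a <= b -> (forall t, a <= t <= b -> cat Rd h t) ->
  CInt h a b = (RInt (fun t => Re (h t)) a b, RInt (fun t => Im (h t)) a b).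
Proof.
  intros Hab Hh.
  assert (E : ex_RInt (V := C_R_CompleteNormedModule) h a b)
    by (apply ex_CInt; rewrite Rmin_left, Rmax_right by auto; auto).
  destruct E as [l Hl].
  assert (H1 := is_RInt_fct_extend_fst (U := R_NormedModule) (V := R_NormedModule) h a b l Hl).
  assert (H2 := is_RInt_fct_extend_snd (U := R_NormedModule) (V := R_NormedModule) h a b l Hl).
  unfold CInt. rewrite (is_RInt_unique (V := C_R_CompleteNormedModule) h a b l Hl).
  rewrite (surjective_pairing l). unfold Re, Im.
  apply injective_projections; simpl; symmetry;
    apply (is_RInt_unique (V := R_CompleteNormedModule)); assumption.
Qed.

Lemma CInt_scal c h a b : a <= b -> (forall t, a <= t <= b -> cat Rd h t) ->
  CInt (fun t => c * h t)%C a b = (c * CInt h a b)%C.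
Proof.
  intros Hab Hh.
  assert (ER : forall t, a <= t <= b -> continuous (fun t => Re (h t)) t /\
                                     continuous (fun t => Im (h t)) t).
  { intros t Ht. split; apply cat_continuous_R; intros eps He;
      destruct (Hh t Ht eps He) as [e [He1 H]]; exists e; (split; [exact He1|]);
      intros y Hy; rewrite <- RtoC_minus, Cmod_R; eapply Rle_lt_trans; [|apply (H y Hy)| |apply (H y Hy)];
      eapply Rle_trans; [|apply Rmax_Cmod| |apply Rmax_Cmod].
    - apply (Rmax_l (Rabs (Re (h y) - Re (h t)))).
    - apply (Rmax_r (Rabs (Re (h y) - Re (h t)))). }
  assert (E1 : ex_RInt (fun t => Re (h t)) a b).
  { apply (ex_RInt_continuous (V := R_CompleteNormedModule)). rewrite Rmin_left, Rmax_right by auto.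
    intros; apply ER; auto. }
  assert (E2 : ex_RInt (fun t => Im (h t)) a b).
  { apply (ex_RInt_continuous (V := R_CompleteNormedModule)). rewrite Rmin_left, Rmax_right by auto.
    intros; apply ER; auto. }
  rewrite !CInt_pair; auto.
  2: intros; apply cat_mult; auto; apply cat_const.
  destruct c as [c1 c2].
  apply injective_projections; simpl.
  - transitivity (RInt (fun t => minus (scal c1 (Re (h t))) (scal c2 (Im (h t)))) a b); [reflexivity|].
    rewrite (RInt_minus (V := R_CompleteNormedModule));
      try apply (ex_RInt_scal (V := R_NormedModule)); auto.
    rewrite !(RInt_scal (V := R_CompleteNormedModule)); auto.
  - transitivity (RInt (fun t => plus (scal c1 (Im (h t))) (scal c2 (Re (h t)))) a b).
    { apply RInt_ext. intros; reflexivity. }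
    rewrite (RInt_plus (V := R_CompleteNormedModule));
      try apply (ex_RInt_scal (V := R_NormedModule)); auto.
    rewrite !(RInt_scal (V := R_CompleteNormedModule)); auto.
Qed.

Lemma CInt_const c a b : CInt (fun _ => c) a b = (RtoC (b - a) * c)%C.
Proof.
  unfold CInt. rewrite (RInt_const (V := C_R_CompleteNormedModule)).
  apply scal_R_Cmult.
Qed.

(** ** Averages over the circle *)

Definition avg (h : R -> C) : C := (RtoC (/ (2 * PI)) * CInt h 0 (2 * PI))%C.

Definition ravg (h : R -> R) : R := / (2 * PI) * RInt h 0 (2 * PI).

Definition ccont (h : R -> C) : Prop := forall t, cat Rd h t.

Lemma two_pi_pos : 0 < 2 * PI.
Proof. assert (H := PI_RGT_0). lra. Qed.

Lemma avg_ext h g : (forall t, h t = g t) -> avg h = avg g.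
Proof. intros H. unfold avg. f_equal. apply CInt_ext. auto. Qed.

Lemma avg_plus h g : ccont h -> ccont g -> avg (fun t => h t + g t)%C = (avg h + avg g)%C.
Proof.
  intros Hh Hg. unfold avg. assert (P := two_pi_pos). rewrite CInt_plus; auto; [ring|lra].
Qed.

Lemma avg_scal c h : ccont h -> avg (fun t => c * h t)%C = (c * avg h)%C.
Proof.
  intros Hh. unfold avg. assert (P := two_pi_pos). rewrite CInt_scal; auto; [ring|lra].
Qed.

Lemma avg_minus h g : ccont h -> ccont g -> avg (fun t => h t - g t)%C = (avg h - avg g)%C.
Proof.
  intros Hh Hg. rewrite (avg_ext _ (fun t => h t + RtoC (Ropp 1) * g t)%C).
  - rewrite avg_plus, avg_scal; auto; [|intros t; apply cat_mult; [apply cat_const|auto]].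
    rewrite RtoC_opp. ring.
  - intros. rewrite RtoC_opp. ring.
Qed.

Lemma avg_const c : avg (fun _ => c) = c.
Proof.
  unfold avg. rewrite CInt_const, Cmult_assoc, <- RtoC_mult.
  replace (/ (2 * PI) * (2 * PI - 0)) with 1; [ring|]. assert (P := two_pi_pos). field. lra.
Qed.

Lemma avg_csum (h : nat -> R -> C) n : (forall k, ccont (h k)) ->
  avg (fun t => csum (fun k => h k t) n) = csum (fun k => avg (h k)) n.
Proof.
  intros H. induction n as [|n IH]; simpl; [apply avg_const|].
  rewrite avg_plus, IH; auto. intros t. apply cat_csum. intros; apply H.
Qed.

Lemma avg_bound h M : ccont h -> (forall t, 0 <= t <= 2 * PI -> Cmod (h t) <= M) ->
  Cmod (avg h) <= M.
Proof.
  intros Hh HM. assert (P := two_pi_pos). unfold avg. rewrite Cmod_mult, Cmod_R.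
  assert (Hi : 0 < / (2 * PI)) by (apply Rinv_0_lt_compat; auto).
  rewrite Rabs_pos_eq by lra.
  assert (B := CInt_bound h 0 (2 * PI) M ltac:(lra) ltac:(auto) HM).
  apply Rle_trans with (/ (2 * PI) * ((2 * PI - 0) * M)).
  - apply Rmult_le_compat_l; lra.
  - right. field. lra.
Qed.

Lemma ravg_avg h : (forall t, continuous h t) -> avg (fun t => RtoC (h t)) = RtoC (ravg h).
Proof.
  intros H. unfold avg, ravg. assert (P := two_pi_pos). rewrite CInt_pair; [|lra|].
  - rewrite RtoC_mult. f_equal. unfold RtoC. f_equal. simpl.
    rewrite (RInt_const (V := R_CompleteNormedModule)). apply Rmult_0_r.
  - intros. apply continuous_cat_R, H.
Qed.

Lemma ravg_le f g : (forall t, continuous f t) -> (forall t, continuous g t) ->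
  (forall t, 0 <= t <= 2 * PI -> f t <= g t) -> ravg f <= ravg g.
Proof.
  intros Hf Hg H. unfold ravg. assert (P := two_pi_pos). apply Rmult_le_compat_l.
  - left. apply Rinv_0_lt_compat. auto.
  - apply RInt_le; [lra| | |].
    + apply (ex_RInt_continuous (V := R_CompleteNormedModule)). auto.
    + apply (ex_RInt_continuous (V := R_CompleteNormedModule)). auto.
    + intros; apply H; lra.
Qed.

Lemma ravg_const c : ravg (fun _ => c) = c.
Proof.
  unfold ravg. rewrite (RInt_const (V := R_CompleteNormedModule)).
  assert (P := two_pi_pos). change (/ (2 * PI) * ((2 * PI - 0) * c) = c). field. lra.
Qed.

Lemma ravg_plus f g : (forall t, continuous f t) -> (forall t, continuous g t) ->
  ravg (fun t => f t + g t) = ravg f + ravg g.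
Proof.
  intros Hf Hg. unfold ravg. rewrite (RInt_plus (V := R_CompleteNormedModule)).
  - change plus with Rplus. ring.
  - apply (ex_RInt_continuous (V := R_CompleteNormedModule)). auto.
  - apply (ex_RInt_continuous (V := R_CompleteNormedModule)). auto.
Qed.

Lemma ccont_sq h : ccont h -> forall t, continuous (fun t => Cmod (h t) ^ 2) t.
Proof. intros H t. apply cat_continuous_R, cat_Cmod2, H. Qed.

(** * Goursat's theorem and the constancy of circle averages *)

Definition mkC (a b : R) : C := (a, b).

(** Complex differentiability at $x + iy$ of a function of two real variables. *)
Definition cdiff2 (F : R -> R -> C) (x y : R) : Prop :=
  exists l : C, forall eps, 0 < eps -> exists del, 0 < del /\
    forall x' y', Rabs (x' - x) < del -> Rabs (y' - y) < del ->
      Cmod (F x' y' - F x y - l * mkC (x' - x) (y' - y))%C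
        <= eps * (Rabs (x' - x) + Rabs (y' - y)).

Lemma Cmod_pair_le (a b : R) : Cmod (mkC a b) <= Rabs a + Rabs b.
Proof.
  replace (mkC a b) with (RtoC a + Ci * RtoC b)%C
    by (apply injective_projections; simpl; ring).
  eapply Rle_trans; [apply Cmod_triangle|].
  rewrite Cmod_mult, Cmod_Ci, !Cmod_R. lra.
Qed.

Lemma cdiff2_cont F x y : cdiff2 F x y -> forall eps, 0 < eps ->
  exists del, 0 < del /\ forall x' y', Rabs (x' - x) < del -> Rabs (y' - y) < del ->
    Cmod (F x' y' - F x y) < eps.
Proof.
  intros [l Hl] eps He. destruct (Hl 1 ltac:(lra)) as [d [Hd H]].
  assert (HL := Cmod_ge_0 l).
  set (e := eps / (4 * (1 + Cmod l))).
  assert (He' : 0 < e) by (apply Rdiv_lt_0_compat; lra).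
  assert (Ee : e * (4 * (1 + Cmod l)) = eps) by (unfold e; field; lra).
  exists (Rmin d e). split; [apply Rmin_pos; auto|].
  intros x' y' Hx Hy.
  assert (Hx1 := Rlt_le_trans _ _ _ Hx (Rmin_l _ _)).
  assert (Hx2 := Rlt_le_trans _ _ _ Hx (Rmin_r _ _)).
  assert (Hy1 := Rlt_le_trans _ _ _ Hy (Rmin_l _ _)).
  assert (Hy2 := Rlt_le_trans _ _ _ Hy (Rmin_r _ _)).
  specialize (H x' y' Hx1 Hy1).
  replace (F x' y' - F x y)%C with
    ((F x' y' - F x y - l * mkC (x' - x) (y' - y)) + l * mkC (x' - x) (y' - y))%C by ring.
  eapply Rle_lt_trans; [apply Cmod_triangle|]. rewrite Cmod_mult.
  assert (B := Cmod_pair_le (x' - x) (y' - y)).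
  assert (Cmod l * Cmod (mkC (x' - x) (y' - y)) <= Cmod l * (Rabs (x' - x) + Rabs (y' - y)))
    by (apply Rmult_le_compat_l; auto).
  nra.
Qed.

Lemma cdiff2_cat_l F x y : cdiff2 F x y -> cat Rd (fun s => F s y) x.
Proof.
  intros H eps He. destruct (cdiff2_cont F x y H eps He) as [d [Hd H1]].
  exists d. split; auto. intros s Hs. apply H1; [exact Hs|].
  replace (y - y) with 0 by ring. rewrite Rabs_R0. auto.
Qed.

Lemma cdiff2_cat_r F x y : cdiff2 F x y -> cat Rd (F x) y.
Proof.
  intros H eps He. destruct (cdiff2_cont F x y H eps He) as [d [Hd H1]].
  exists d. split; auto. intros s Hs. apply H1; [|exact Hs].
  replace (x - x) with 0 by ring. rewrite Rabs_R0. auto.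
Qed.

Definition bnd (F : R -> R -> C) (x1 x2 y1 y2 : R) : C :=
  (CInt (fun s => F s y1) x1 x2 + Ci * CInt (F x2) y1 y2
   - CInt (fun s => F s y2) x1 x2 - Ci * CInt (F x1) y1 y2)%C.

Lemma bnd_split F x1 xm x2 y1 ym y2 :
  x1 <= xm <= x2 -> y1 <= ym <= y2 ->
  (forall x y, x1 <= x <= x2 -> y1 <= y <= y2 -> cdiff2 F x y) ->
  bnd F x1 x2 y1 y2 = (bnd F x1 xm y1 ym + bnd F xm x2 y1 ym
    + bnd F x1 xm ym y2 + bnd F xm x2 ym y2)%C.
Proof.
  intros Hx Hy H. unfold bnd.
  rewrite (CInt_Chasles (fun s => F s y1) x1 xm x2) by
    (try lra; intros; apply cdiff2_cat_l, H; lra).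
  rewrite (CInt_Chasles (fun s => F s y2) x1 xm x2) by
    (try lra; intros; apply cdiff2_cat_l, H; lra).
  rewrite (CInt_Chasles (F x1) y1 ym y2) by
    (try lra; intros; apply cdiff2_cat_r, H; lra).
  rewrite (CInt_Chasles (F x2) y1 ym y2) by
    (try lra; intros; apply cdiff2_cat_r, H; lra).
  ring.
Qed.

Lemma RInt_shift_id x0 a b : RInt (fun s => s - x0) a b = ((b - x0) ^ 2 - (a - x0) ^ 2) / 2.
Proof.
  apply (is_RInt_unique (V := R_CompleteNormedModule)).
  replace (((b - x0) ^ 2 - (a - x0) ^ 2) / 2) with
    (minus ((b - x0) ^ 2 / 2) ((a - x0) ^ 2 / 2)) by (unfold minus, plus, opp; simpl; field).
  apply (is_RInt_derive (V := R_CompleteNormedModule) (fun s => (s - x0) ^ 2 / 2)).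
  - intros x _. auto_derive; [auto|]. field.
  - intros x _. apply (continuous_minus (V := R_NormedModule)); [apply continuous_id|apply continuous_const].
Qed.

Lemma cat_aff_l x0 k t : cat Rd (fun s => mkC (s - x0) k) t.
Proof.
  intros eps He. exists eps. split; auto. intros y Hy.
  replace (mkC (y - x0) k - mkC (t - x0) k)%C with (RtoC (y - t))
    by (apply injective_projections; simpl; ring).
  rewrite Cmod_R. exact Hy.
Qed.

Lemma cat_aff_r x0 k t : cat Rd (fun s => mkC k (s - x0)) t.
Proof.
  intros eps He. exists eps. split; auto. intros y Hy.
  replace (mkC k (y - x0) - mkC k (t - x0))%C with (Ci * RtoC (y - t))%C
    by (apply injective_projections; simpl; ring).
  rewrite Cmod_mult, Cmod_Ci, Cmod_R, Rmult_1_l. exact Hy.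
Qed.

Lemma CInt_aff_l x0 k a b : a <= b ->
  CInt (fun s => mkC (s - x0) k) a b = mkC (((b - x0) ^ 2 - (a - x0) ^ 2) / 2) ((b - a) * k).
Proof.
  intros Hab. rewrite CInt_pair; auto using cat_aff_l. apply injective_projections; simpl.
  - rewrite RInt_shift_id. reflexivity.
  - apply (RInt_const (V := R_CompleteNormedModule)).
Qed.

Lemma CInt_aff_r x0 k a b : a <= b ->
  CInt (fun s => mkC k (s - x0)) a b = mkC ((b - a) * k) (((b - x0) ^ 2 - (a - x0) ^ 2) / 2).
Proof.
  intros Hab. rewrite CInt_pair; auto using cat_aff_r. apply injective_projections; simpl.
  - apply (RInt_const (V := R_CompleteNormedModule)).
  - rewrite RInt_shift_id. reflexivity.
Qed.

(** An affine function has a primitive, so only its distance to [F] counts. *)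
Lemma bnd_near_affine F c l x0 y0 x1 x2 y1 y2 M :
  x1 <= x2 -> y1 <= y2 ->
  (forall x y, x1 <= x <= x2 -> y1 <= y <= y2 -> cdiff2 F x y) ->
  (forall x y, x1 <= x <= x2 -> y1 <= y <= y2 ->
     Cmod (F x y - (c + l * mkC (x - x0) (y - y0)))%C <= M) ->
  Cmod (bnd F x1 x2 y1 y2) <= 2 * ((x2 - x1) + (y2 - y1)) * M.
Proof.
  intros Hx Hy HF HM.
  set (G := fun x y => (F x y - (c + l * mkC (x - x0) (y - y0)))%C).
  assert (Hor : forall y, y1 <= y <= y2 ->
    exists e, CInt (fun s => F s y) x1 x2 =
      (e + RtoC (x2 - x1) * c + l * mkC (((x2 - x0) ^ 2 - (x1 - x0) ^ 2) / 2) ((x2 - x1) * (y - y0)))%C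
      /\ Cmod e <= (x2 - x1) * M).
  { intros y Hyy. exists (CInt (fun s => G s y) x1 x2). 
    assert (cG : forall t, x1 <= t <= x2 -> cat Rd (fun s => G s y) t).
    { intros t Ht. apply cat_minus; [apply cdiff2_cat_l, HF; lra|].
      apply cat_plus; [apply cat_const|]. apply cat_mult; [apply cat_const|apply cat_aff_l]. }
    split.
    - rewrite <- CInt_aff_l by lra.
      rewrite <- CInt_scal, <- CInt_const, <- !CInt_plus; try lra; auto.
      + apply CInt_ext. intros t Ht. unfold G. ring.
      + intros; apply cat_plus; auto using cat_const.
      + intros; apply cat_mult; [apply cat_const|apply cat_aff_l].
      + intros; apply cat_const.
      + intros; apply cat_aff_l.
    - apply CInt_bound; auto. intros t Ht. apply HM; lra. }
  assert (Ver : forall x, x1 <= x <= x2 ->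
    exists e, CInt (F x) y1 y2 =
      (e + RtoC (y2 - y1) * c + l * mkC ((y2 - y1) * (x - x0)) (((y2 - y0) ^ 2 - (y1 - y0) ^ 2) / 2))%C
      /\ Cmod e <= (y2 - y1) * M).
  { intros x Hxx. exists (CInt (G x) y1 y2). 
    assert (cG : forall t, y1 <= t <= y2 -> cat Rd (G x) t).
    { intros t Ht. apply cat_minus; [apply cdiff2_cat_r, HF; lra|].
      apply cat_plus; [apply cat_const|]. apply cat_mult; [apply cat_const|apply cat_aff_r]. }
    split.
    - rewrite <- CInt_aff_r by lra.
      rewrite <- CInt_scal, <- CInt_const, <- !CInt_plus; try lra; auto.
      + apply CInt_ext. intros t Ht. unfold G. ring.
      + intros; apply cat_plus; auto using cat_const.
      + intros; apply cat_mult; [apply cat_const|apply cat_aff_r].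
      + intros; apply cat_const.
      + intros; apply cat_aff_r.
    - apply CInt_bound; auto. intros t Ht. apply HM; lra. }
  destruct (Hor y1 ltac:(lra)) as [e1 [E1 B1]]. destruct (Hor y2 ltac:(lra)) as [e2 [E2 B2]].
  destruct (Ver x1 ltac:(lra)) as [e3 [E3 B3]]. destruct (Ver x2 ltac:(lra)) as [e4 [E4 B4]].
  unfold bnd. rewrite E1, E2, E3, E4.
  match goal with |- Cmod ?z <= _ => replace z with (e1 + Ci * e4 + (- e2 + - (Ci * e3)))%C end.
  - eapply Rle_trans; [apply Cmod_triangle|].
    eapply Rle_trans; [apply Rplus_le_compat; apply Cmod_triangle|].
    rewrite !Cmod_opp, !Cmod_mult, Cmod_Ci. lra.
  - destruct e1, e2, e3, e4, c, l. apply injective_projections; simpl; field.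
Qed.

(** The rectangle at stage [n] of the bisection has its lower left corner at the given point
    and sides $a/2^n$, $b/2^n$. *)
Definition big (F : R -> R -> C) (x0 y0 a b : R) (n : nat) (x y : R) : Prop :=
  Cmod (bnd F x0 (x0 + a) y0 (y0 + b)) / 4 ^ n
    <= Cmod (bnd F x (x + a / 2 ^ n) y (y + b / 2 ^ n)).

Definition inside (x0 y0 a b : R) (n : nat) (x y : R) : Prop :=
  x0 <= x /\ x + a / 2 ^ n <= x0 + a /\ y0 <= y /\ y + b / 2 ^ n <= y0 + b.

Lemma bisect_step (F : R -> R -> C) (x0 y0 a b : R) (Ha : 0 < a) (Hb : 0 < b)
  (HF : forall x y, x0 <= x <= x0 + a -> y0 <= y <= y0 + b -> cdiff2 F x y) n x y :
  inside x0 y0 a b n x y -> big F x0 y0 a b n x y ->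
  exists x' y', inside x0 y0 a b (S n) x' y' /\ big F x0 y0 a b (S n) x' y' /\
    x <= x' <= x + a / 2 ^ S n /\ y <= y' <= y + b / 2 ^ S n.
Proof.
  intros [I1 [I2 [I3 I4]]] B.
  assert (P2 : 0 < 2 ^ n) by (apply pow_lt; lra). assert (P4 : 0 < 4 ^ n) by (apply pow_lt; lra).
  set (h := a / 2 ^ S n). set (k := b / 2 ^ S n).
  assert (Eh : a / 2 ^ n = h + h) by (unfold h; simpl; field; lra).
  assert (Ek : b / 2 ^ n = k + k) by (unfold k; simpl; field; lra).
  assert (Ph : 0 < h) by (apply Rdiv_lt_0_compat; [auto|apply pow_lt; lra]).
  assert (Pk : 0 < k) by (apply Rdiv_lt_0_compat; [auto|apply pow_lt; lra]).
  unfold big in B. rewrite Eh, Ek in *.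
  rewrite (bnd_split F x (x + h) _ y (y + k)) in B by (try lra; intros; apply HF; lra).
  set (I := Cmod (bnd F x0 (x0 + a) y0 (y0 + b))) in *.
  assert (EI : I / 4 ^ n = 4 * (I / 4 ^ S n)) by (simpl; field; lra).
  assert (T1 := Cmod_triangle
    (bnd F x (x + h) y (y + k) + bnd F (x + h) (x + (h + h)) y (y + k)
      + bnd F x (x + h) (y + k) (y + (k + k)))
    (bnd F (x + h) (x + (h + h)) (y + k) (y + (k + k)))).
  assert (T2 := Cmod_triangle
    (bnd F x (x + h) y (y + k) + bnd F (x + h) (x + (h + h)) y (y + k))
    (bnd F x (x + h) (y + k) (y + (k + k)))).
  assert (T3 := Cmod_triangle (bnd F x (x + h) y (y + k)) (bnd F (x + h) (x + (h + h)) y (y + k))).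
  assert (Go : forall x' y', (x' = x \/ x' = x + h) -> (y' = y \/ y' = y + k) ->
    I / 4 ^ S n <= Cmod (bnd F x' (x' + h) y' (y' + k)) ->
    exists x' y', inside x0 y0 a b (S n) x' y' /\ big F x0 y0 a b (S n) x' y' /\
    x <= x' <= x + h /\ y <= y' <= y + k).
  { intros x' y' Hx Hy HI. exists x', y'. unfold inside, big. fold h k I.
    repeat split; try lra; destruct Hx, Hy; lra. }
  replace (x + (h + h)) with (x + h + h) in * by ring.
  replace (y + (k + k)) with (y + k + k) in * by ring.
  destruct (Rle_dec (I / 4 ^ S n) (Cmod (bnd F x (x + h) y (y + k)))) as [q|q1];
    [apply (Go x y); auto|].
  destruct (Rle_dec (I / 4 ^ S n) (Cmod (bnd F (x + h) (x + h + h) y (y + k)))) as [q|q2];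
    [apply (Go (x + h) y); auto|].
  destruct (Rle_dec (I / 4 ^ S n) (Cmod (bnd F x (x + h) (y + k) (y + k + k)))) as [q|q3];
    [apply (Go x (y + k)); auto|].
  destruct (Rle_dec (I / 4 ^ S n) (Cmod (bnd F (x + h) (x + h + h) (y + k) (y + k + k)))) as [q|q4];
    [apply (Go (x + h) (y + k)); auto|].
  lra.
Qed.

Lemma geom_small x M eps : 0 <= x < 1 -> 0 <= M -> 0 < eps ->
  exists N, forall n, (N <= n)%nat -> M * x ^ n < eps.
Proof.
  intros Hx HM He.
  destruct (pow_lt_1_zero x ltac:(rewrite Rabs_pos_eq; lra) (eps / (M + 1))
    ltac:(apply Rdiv_lt_0_compat; lra)) as [N HN].
  exists N. intros n Hn. specialize (HN n Hn).
  assert (Hp : 0 <= x ^ n) by (apply pow_le; lra).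
  rewrite Rabs_pos_eq in HN by auto.
  assert ((M + 1) * x ^ n < eps).
  { apply Rmult_lt_reg_l with (/ (M + 1)); [apply Rinv_0_lt_compat; lra|].
    rewrite <- Rmult_assoc, Rinv_l, Rmult_1_l by lra. unfold Rdiv in HN. lra. }
  nra.
Qed.

Lemma dep_choice {T : Type} (P : nat -> T -> Prop) (Q : nat -> T -> T -> Prop) t0 :
  P O t0 -> (forall n t, P n t -> exists t', P (S n) t' /\ Q n t t') ->
  exists f : nat -> T, forall n, P n (f n) /\ Q n (f n) (f (S n)).
Proof.
  intros H0 HS.
  set (step := fun n (u : {t | P n t}) =>
    constructive_indefinite_description _ (HS n (proj1_sig u) (proj2_sig u))).
  set (f := fix f n : {t | P n t} := match n with
    | O => exist _ t0 H0
    | S n => exist _ (proj1_sig (step n (f n))) (proj1 (proj2_sig (step n (f n)))) end).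
  exists (fun n => proj1_sig (f n)). intros n. split; [apply (proj2_sig (f n))|].
  apply (proj2 (proj2_sig (step n (f n)))).
Qed.

Lemma nested_intervals (x : nat -> R) a : 0 <= a ->
  (forall n, x n <= x (S n) /\ x (S n) + a / 2 ^ S n <= x n + a / 2 ^ n) ->
  exists l, forall n, x n <= l <= x n + a / 2 ^ n.
Proof.
  intros Ha H.
  assert (P : forall n, 0 <= a / 2 ^ n).
  { intros n. apply Rmult_le_pos; auto. left. apply Rinv_0_lt_compat, pow_lt. lra. }
  assert (M : forall n m, (n <= m)%nat -> x n <= x m /\ x m + a / 2 ^ m <= x n + a / 2 ^ n).
  { intros n m Hnm. induction Hnm as [|m Hnm IH]; [lra|]. specialize (H m). lra. }
  assert (U : forall n m, x m <= x n + a / 2 ^ n).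
  { intros n m. destruct (Nat.le_ge_cases n m) as [h|h]; destruct (M _ _ h).
    - specialize (P m). lra.
    - specialize (P n). lra. }
  destruct (completeness (fun y => exists n, y = x n)) as [l [L1 L2]].
  - exists (x O + a / 2 ^ O). intros y [n ->]. apply U.
  - exists (x O), O. auto.
  - exists l. intros n. split; [apply L1; exists n; auto|].
    apply L2. intros y [m ->]. apply U.
Qed.

(** If the boundary integral were nonzero, quartering would give a nested sequence of
    rectangles on which it decreases no faster than the area; at their common point the
    function is affine up to a small multiple of the diameter, a contradiction. *)
Theorem goursat F x0 y0 a b : 0 < a -> 0 < b ->
  (forall x y, x0 <= x <= x0 + a -> y0 <= y <= y0 + b -> cdiff2 F x y) ->
  bnd F x0 (x0 + a) y0 (y0 + b) = RtoC 0.
Proof.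
  intros Ha Hb HF. set (I := Cmod (bnd F x0 (x0 + a) y0 (y0 + b))).
  destruct (dep_choice (fun n p => inside x0 y0 a b n (fst p) (snd p) /\ big F x0 y0 a b n (fst p) (snd p))
    (fun n p q => fst p <= fst q <= fst p + a / 2 ^ S n /\ snd p <= snd q <= snd p + b / 2 ^ S n)
    (x0, y0)) as [f Hf].
  - simpl. unfold inside, big. simpl. replace (a / 1) with a by field. replace (b / 1) with b by field.
    split; [lra|]. right. field.
  - intros n [x y] [H1 H2]. simpl in *.
    destruct (bisect_step F x0 y0 a b Ha Hb HF n x y H1 H2) as [x' [y' [G1 [G2 G3]]]].
    exists (x', y'). simpl. auto.
  - assert (half : forall c n, c / 2 ^ n = c / 2 ^ S n + c / 2 ^ S n).
    { intros c n. simpl. field. apply pow_nonzero. lra. }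
    destruct (nested_intervals (fun n => fst (f n)) a ltac:(lra)) as [X HX].
    { intros n. destruct (Hf n) as [_ [G _]]. rewrite (half a n). lra. }
    destruct (nested_intervals (fun n => snd (f n)) b ltac:(lra)) as [Y HY].
    { intros n. destruct (Hf n) as [_ [_ G]]. rewrite (half b n). lra. }
    apply Cmod_eq_0. apply Rle_antisym; [|apply Cmod_ge_0]. fold I.
    apply le_epsilon. intros eps He. rewrite Rplus_0_l.
    assert (HXY : cdiff2 F X Y).
    { specialize (HX O). specialize (HY O). destruct (Hf O) as [[[H1 [H2 [H3 H4]]] _] _].
      apply HF; lra. }
    destruct HXY as [l Hl].
    set (e := eps / (2 * (a + b) ^ 2)).
    assert (Hab : 0 < (a + b) ^ 2) by (apply pow_lt; lra).
    assert (He' : 0 < e) by (apply Rdiv_lt_0_compat; lra).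
    destruct (Hl e He') as [d [Hd HD]].
    destruct (geom_small (1 / 2) (a + b) d ltac:(lra) ltac:(lra) Hd) as [n Hn].
    specialize (Hn n (le_n _)).
    assert (E2 : forall c, c * (1 / 2) ^ n = c / 2 ^ n).
    { intros c. unfold Rdiv. rewrite Rmult_1_l, pow_inv. reflexivity. }
    rewrite E2 in Hn.
    assert (P2 : 0 < 2 ^ n) by (apply pow_lt; lra).
    assert (Eab : (a + b) / 2 ^ n = a / 2 ^ n + b / 2 ^ n) by (field; lra).
    assert (pa : 0 < a / 2 ^ n) by (apply Rdiv_lt_0_compat; lra).
    assert (pb : 0 < b / 2 ^ n) by (apply Rdiv_lt_0_compat; lra).
    destruct (Hf n) as [[[H1 [H2 [H3 H4]]] HB] _]. unfold big in HB. fold I in HB.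
    specialize (HX n). specialize (HY n). simpl in HX, HY.
    set (x := fst (f n)) in *. set (y := snd (f n)) in *.
    assert (N := bnd_near_affine F (F X Y) l X Y x (x + a / 2 ^ n) y (y + b / 2 ^ n)
      (e * ((a + b) / 2 ^ n))).
    assert (B : Cmod (bnd F x (x + a / 2 ^ n) y (y + b / 2 ^ n))
       <= 2 * ((x + a / 2 ^ n - x) + (y + b / 2 ^ n - y)) * (e * ((a + b) / 2 ^ n))).
    { apply N; try lra.
      - intros u v Hu Hv. apply HF; lra.
      - intros u v Hu Hv.
        assert (Bu : Rabs (u - X) <= a / 2 ^ n) by (apply Rabs_le; lra).
        assert (Bv : Rabs (v - Y) <= b / 2 ^ n) by (apply Rabs_le; lra).
        replace (F u v - (F X Y + l * mkC (u - X) (v - Y)))%C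
          with (F u v - F X Y - l * mkC (u - X) (v - Y))%C by ring.
        eapply Rle_trans; [apply HD; lra|]. apply Rmult_le_compat_l; lra. }
    assert (C4 : I / 4 ^ n <= eps / 4 ^ n).
    { eapply Rle_trans; [exact HB|]. eapply Rle_trans; [exact B|]. right.
      unfold e. replace 4 with (2 * 2) by ring. rewrite Rpow_mult_distr. field. lra. }
    apply Rmult_le_reg_r with (/ 4 ^ n); [apply Rinv_0_lt_compat, pow_lt; lra|exact C4].
Qed.

(** ** Complex derivatives *)

Definition cder (f : C -> C) (z l : C) : Prop :=
  forall eps, 0 < eps -> exists del, 0 < del /\ forall y, Cmod (y - z) < del ->
    Cmod (f y - f z - l * (y - z))%C <= eps * Cmod (y - z).

Lemma ex_derive_cder f z :
  ex_derive (K := C_AbsRing) (V := C_NormedModule) f z -> exists l, cder f z l.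
Proof.
  intros [l [_ H]]. exists l. intros eps He.
  destruct (H z (fun P HP => HP) (mkposreal eps He)) as [d Hd].
  exists d. split; [apply cond_pos|]. intros y Hy.
  specialize (Hd y Hy). simpl in Hd. 
  replace (l * (y - z))%C with ((y - z) * l)%C by ring. exact Hd.
Qed.

Lemma cder_ex_derive f z l : cder f z l ->
  ex_derive (K := C_AbsRing) (V := C_NormedModule) f z.
Proof.
  intros H. exists l. split; [apply is_linear_scal_l|].
  intros x Hx eps. assert (E : z = x).
  { apply (is_filter_lim_locally_unique (K := C_AbsRing) (V := AbsRing_NormedModule C_AbsRing)). exact Hx. }
  subst x. destruct (H eps (cond_pos eps)) as [d [Hd HD]].
  exists (mkposreal d Hd). intros y Hy.
  specialize (HD y Hy). replace (l * (y - z))%C with ((y - z) * l)%C in HD by ring. exact HD.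
Qed.

Lemma cder_cat f z l : cder f z l -> cat Cd f z.
Proof.
  intros H eps He. destruct (H 1 ltac:(lra)) as [d [Hd HD]].
  assert (HL := Cmod_ge_0 l).
  assert (He' : 0 < eps / (1 + Cmod l)) by (apply Rdiv_lt_0_compat; lra).
  exists (Rmin d (eps / (1 + Cmod l))). split; [apply Rmin_pos; auto|].
  intros y Hy. unfold Cd in Hy.
  assert (H1 := Rlt_le_trans _ _ _ Hy (Rmin_l _ _)).
  assert (H2 := Rlt_le_trans _ _ _ Hy (Rmin_r _ _)).
  specialize (HD y H1).
  replace (f y - f z)%C with ((f y - f z - l * (y - z)) + l * (y - z))%C by ring.
  eapply Rle_lt_trans; [apply Cmod_triangle|]. rewrite Cmod_mult.
  apply Rle_lt_trans with ((1 + Cmod l) * Cmod (y - z)); [lra|].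
  apply Rlt_le_trans with ((1 + Cmod l) * (eps / (1 + Cmod l))).
  - apply Rmult_lt_compat_l; lra.
  - right. field. lra.
Qed.

(** ** Logarithmic polar coordinates *)

Lemma Cmod_polar r t : 0 <= r -> Cmod (polar r t) = r.
Proof.
  intros Hr. unfold polar, Cmod. simpl fst. simpl snd.
  replace ((r * cos t) ^ 2 + (r * sin t) ^ 2) with (r ^ 2 * (Rsqr (sin t) + Rsqr (cos t)))
    by (unfold Rsqr; ring).
  rewrite sin2_cos2, Rmult_1_r, sqrt_pow2; auto.
Qed.

Lemma polar_mult r s t u : (polar r t * polar s u)%C = polar (r * s) (t + u).
Proof.
  unfold polar. rewrite cos_plus, sin_plus. apply injective_projections; simpl; ring.
Qed.

Lemma polar_cat r t : cat R2d (fun p => polar (fst p) (snd p)) (r, t).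
Proof.
  assert (cf : forall f : R -> R, continuity f -> forall x, continuous f x).
  { intros f Hf x. apply continuity_pt_filterlim, Hf. }
  assert (pr1 : cat R2d (fun p => RtoC (fst p)) (r, t)).
  { intros eps He. exists eps. split; auto. intros y Hy. rewrite <- RtoC_minus, Cmod_R.
    eapply Rle_lt_trans; [|exact Hy]. apply Rmax_l. }
  assert (pr2 : forall f : R -> R, continuity f -> cat R2d (fun p => RtoC (f (snd p))) (r, t)).
  { intros f Hf eps He. destruct (continuous_cat_R f t (cf f Hf t) eps He) as [d [Hd H]].
    exists d. split; auto. intros y Hy. apply (H (snd y)).
    eapply Rle_lt_trans; [|exact Hy]. apply Rmax_r. }
  apply cat_ext with (fun p => RtoC (fst p) * (RtoC (cos (snd p)) + Ci * RtoC (sin (snd p))))%C.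
  - intros y. unfold polar. apply injective_projections; simpl; ring.
  - apply cat_mult; auto. apply cat_plus; [apply (pr2 cos), continuity_cos|].
    apply cat_mult; [apply cat_const|apply (pr2 sin), continuity_sin].
Qed.

Lemma polar_cat_t r t : cat Rd (polar r) t.
Proof.
  intros eps He. destruct (polar_cat r t eps He) as [d [Hd H]].
  exists d. split; auto. intros s Hs. apply (H (r, s)).
  unfold R2d, Rd. simpl. replace (r - r) with 0 by ring. rewrite Rabs_R0.
  rewrite Rmax_right by apply Rabs_pos. exact Hs.
Qed.

(** $e^{s+it} = 1 + (s+it) + o(|s|+|t|)$. *)
Lemma polar_exp_0 eps : 0 < eps -> exists del, 0 < del /\ forall s t,
  Rabs s < del -> Rabs t < del ->
  Cmod (polar (exp s) t - RtoC 1 - mkC s t)%C <= eps * (Rabs s + Rabs t).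
Proof.
  intros He.
  assert (D : forall (f : R -> R) l, derivable_pt_lim f 0 l -> exists del, 0 < del /\
     forall s, Rabs s < del -> Rabs (f s - f 0 - l * s) <= eps / 8 * Rabs s).
  { intros f l Hf. destruct (Hf (eps / 8) ltac:(lra)) as [d Hd]. exists d.
    split; [apply cond_pos|]. intros s Hs. destruct (Req_dec s 0) as [->|Hs0].
    - replace (f 0 - f 0 - l * 0) with 0 by ring. rewrite Rabs_R0. lra.
    - specialize (Hd s Hs0 Hs). rewrite Rplus_0_l in Hd.
      replace (f s - f 0 - l * s) with (((f s - f 0) / s - l) * s) by (field; auto).
      rewrite Rabs_mult. apply Rmult_le_compat_r; [apply Rabs_pos|lra]. }
  destruct (D exp 1) as [d1 [p1 D1]]; [rewrite <- exp_0; apply derivable_pt_lim_exp|].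
  destruct (D sin 1) as [d2 [p2 D2]]; [rewrite <- cos_0; apply derivable_pt_lim_sin|].
  destruct (D cos 0) as [d3 [p3 D3]].
  { replace 0 with (- sin 0) at 2 by (rewrite sin_0; ring). apply derivable_pt_lim_cos. }
  destruct (continuous_cat_R exp 0 ltac:(apply continuity_pt_filterlim, derivable_continuous_pt, derivable_pt_exp) 1 ltac:(lra)) as [d4 [p4 D4]].
  set (m := Rmin (Rmin d1 d2) (Rmin (Rmin d3 d4) (Rmin 1 (eps / 8)))).
  assert (m1 : m <= d1) by (eapply Rle_trans; apply Rmin_l).
  assert (m2 : m <= d2) by (eapply Rle_trans; [apply Rmin_l|apply Rmin_r]).
  assert (m3 : m <= d3).
  { eapply Rle_trans; [apply Rmin_r|]. eapply Rle_trans; apply Rmin_l. }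
  assert (m4 : m <= d4).
  { eapply Rle_trans; [apply Rmin_r|]. eapply Rle_trans; [apply Rmin_l|apply Rmin_r]. }
  assert (m56 : m <= Rmin 1 (eps / 8)) by (eapply Rle_trans; [apply Rmin_r|apply Rmin_r]).
  assert (m5 := Rle_trans _ _ _ m56 (Rmin_r _ _)). assert (m6 := Rle_trans _ _ _ m56 (Rmin_l _ _)).
  exists m. split; [repeat apply Rmin_pos; lra|].
  intros s t Hs Ht.
  specialize (D1 s ltac:(lra)). specialize (D2 t ltac:(lra)). specialize (D3 t ltac:(lra)).
  assert (E : exp s < 2).
  { assert (X := D4 s). unfold Rd in X. replace (s - 0) with s in X by ring. specialize (X ltac:(lra)).
    rewrite <- RtoC_minus, Cmod_R, exp_0 in X. apply Rabs_def2 in X. lra. }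
  assert (E0 := exp_pos s).
  rewrite exp_0 in D1. rewrite sin_0 in D2. rewrite cos_0 in D3.
  replace (polar (exp s) t - RtoC 1 - mkC s t)%C with
    (mkC ((exp s - 1 - 1 * s) + exp s * (cos t - 1 - 0 * t))
         (exp s * (sin t - 0 - 1 * t) + ((exp s - 1 - 1 * s) * t + s * t)))
    by (apply injective_projections; simpl; ring).
  eapply Rle_trans; [apply Cmod_pair_le|].
  set (q := exp s - 1 - 1 * s) in *. set (w1 := cos t - 1 - 0 * t) in *.
  set (w2 := sin t - 0 - 1 * t) in *.
  assert (T1 := Rabs_triang q (exp s * w1)).
  assert (T2 := Rabs_triang (exp s * w2) (q * t + s * t)).
  assert (T3 := Rabs_triang (q * t) (s * t)).
  rewrite !Rabs_mult in *. rewrite (Rabs_pos_eq (exp s)) in * by lra.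
  assert (S0 := Rabs_pos s). assert (S1 := Rabs_pos t). assert (S2 := Rabs_pos w1).
  assert (S3 := Rabs_pos w2). assert (S4 := Rabs_pos q).
  assert (exp s * Rabs w1 <= 2 * (eps / 8 * Rabs t)) by (apply Rmult_le_compat; lra).
  assert (exp s * Rabs w2 <= 2 * (eps / 8 * Rabs t)) by (apply Rmult_le_compat; lra).
  assert (Rabs s * Rabs t <= eps / 8 * Rabs t) by (apply Rmult_le_compat; lra).
  assert (Rabs q * Rabs t <= eps / 8 * Rabs s * 1) by (apply Rmult_le_compat; lra).
  assert (0 <= eps * Rabs s) by nra. assert (0 <= eps * Rabs t) by nra.
  lra.
Qed.

Lemma log_polar_cdiff2 H l u v : cder H (polar (exp u) v) l ->
  cdiff2 (fun u v => H (polar (exp u) v)) u v.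
Proof.
  intros HD. set (E := polar (exp u) v) in *.
  assert (Hu := exp_pos u).
  assert (HE : Cmod E = exp u) by (apply Cmod_polar; lra).
  exists (l * E)%C. intros eps He.
  assert (HL := Cmod_ge_0 l).
  set (eta := Rmin 1 (eps / (2 * (1 + Cmod l) * exp u))).
  assert (pe : 0 < 2 * (1 + Cmod l) * exp u) by (apply Rmult_lt_0_compat; lra).
  assert (p1 : 0 < eta) by (apply Rmin_pos; [lra|apply Rdiv_lt_0_compat; auto]).
  assert (e1 : eta <= 1) by apply Rmin_l.
  assert (e2 : eta * (2 * (1 + Cmod l) * exp u) <= eps).
  { apply Rle_trans with (eps / (2 * (1 + Cmod l) * exp u) * (2 * (1 + Cmod l) * exp u)).
    - apply Rmult_le_compat_r; [lra|apply Rmin_r].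
    - right. field. lra. }
  destruct (polar_exp_0 eta p1) as [d1 [q1 D1]].
  set (eps' := eps / (4 * exp u)).
  assert (p2 : 0 < eps') by (apply Rdiv_lt_0_compat; lra).
  destruct (HD eps' p2) as [d2 [q2 D2]].
  set (d3 := d2 / (8 * exp u)).
  assert (p3 : 0 < d3) by (apply Rdiv_lt_0_compat; lra).
  exists (Rmin d1 d3). split; [apply Rmin_pos; auto|].
  intros u' v' Hu' Hv'.
  assert (s1 := Rlt_le_trans _ _ _ Hu' (Rmin_l _ _)). assert (s2 := Rlt_le_trans _ _ _ Hu' (Rmin_r _ _)).
  assert (t1 := Rlt_le_trans _ _ _ Hv' (Rmin_l _ _)). assert (t2 := Rlt_le_trans _ _ _ Hv' (Rmin_r _ _)).
  set (s := u' - u) in *. set (t := v' - v) in *.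
  assert (Ey : polar (exp u') v' = (E * polar (exp s) t)%C).
  { unfold E. rewrite polar_mult, <- exp_plus. f_equal; [f_equal|]; unfold s, t; ring. }
  specialize (D1 s t s1 t1). set (Rm := (polar (exp s) t - RtoC 1 - mkC s t)%C) in *.
  set (sg := Rabs s + Rabs t) in *.
  assert (w := Cmod_pair_le s t). fold sg in w.
  assert (Eyz : (polar (exp u') v' - E)%C = (E * (mkC s t + Rm))%C) by (rewrite Ey; unfold Rm; ring).
  assert (sg0 : 0 <= sg) by (unfold sg; assert (a1 := Rabs_pos s); assert (a2 := Rabs_pos t); lra).
  assert (By : Cmod (polar (exp u') v' - E) <= exp u * (2 * sg)).
  { rewrite Eyz, Cmod_mult, HE. apply Rmult_le_compat_l; [lra|].
    eapply Rle_trans; [apply Cmod_triangle|]. nra. }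
  assert (Bd : exp u * (2 * sg) < d2).
  { assert (Q : sg < 2 * d3) by (unfold sg; lra).
    apply Rlt_le_trans with (exp u * (2 * (2 * d3))).
    - apply Rmult_lt_compat_l; lra.
    - replace (exp u * (2 * (2 * d3))) with (d2 / 2) by (unfold d3; field; lra). lra. }
  specialize (D2 (polar (exp u') v') ltac:(lra)).
  fold E.
  replace (H (polar (exp u') v') - H E - l * E * mkC s t)%C with
    ((H (polar (exp u') v') - H E - l * (polar (exp u') v' - E)) + l * E * Rm)%C
    by (rewrite Eyz; ring).
  eapply Rle_trans; [apply Cmod_triangle|]. rewrite !Cmod_mult, HE.
  assert (K1 : eps' * Cmod (polar (exp u') v' - E) <= eps / 2 * sg).
  { apply Rle_trans with (eps' * (exp u * (2 * sg))).
    - apply Rmult_le_compat_l; lra.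
    - right. unfold eps'. field. lra. }
  assert (K2 : Cmod l * exp u * Cmod Rm <= eps / 2 * sg).
  { apply Rle_trans with ((1 + Cmod l) * exp u * (eta * sg)).
    - apply Rmult_le_compat; [apply Rmult_le_pos; lra|apply Cmod_ge_0|apply Rmult_le_compat_r; lra|exact D1].
    - nra. }
  lra.
Qed.

(** On the logarithmic rectangle the two radial sides cancel by periodicity. *)
Theorem circle_avg_const H r1 r2 : 0 < r1 < r2 ->
  (forall z, r1 <= Cmod z <= r2 -> exists l, cder H z l) ->
  avg (fun t => H (polar r1 t)) = avg (fun t => H (polar r2 t)).
Proof.
  intros Hr HD. set (F := fun u v => H (polar (exp u) v)).
  assert (Pi := two_pi_pos).
  assert (Hln : ln r1 < ln r2) by (apply ln_increasing; lra).
  assert (G := goursat F (ln r1) 0 (ln r2 - ln r1) (2 * PI) ltac:(lra) Pi).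
  assert (G0 : bnd F (ln r1) (ln r1 + (ln r2 - ln r1)) 0 (0 + 2 * PI) = RtoC 0).
  { apply G. intros x y Hx _. destruct (HD (polar (exp x) y)) as [l Hl].
    - rewrite Cmod_polar by (left; apply exp_pos).
      rewrite <- (exp_ln r1), <- (exp_ln r2) by lra. split.
      + destruct (Req_dec (ln r1) x) as [->|]; [lra|]. left. apply exp_increasing. lra.
      + destruct (Req_dec (ln r2) x) as [->|]; [lra|]. left. apply exp_increasing. lra.
    - apply (log_polar_cdiff2 H l x y Hl). }
  replace (ln r1 + (ln r2 - ln r1)) with (ln r2) in G0 by ring.
  rewrite Rplus_0_l in G0. unfold bnd in G0.
  rewrite (CInt_ext (fun s => F s (2 * PI)) (fun s => F s 0)) in G0.
  - rewrite (CInt_ext (F (ln r1)) (fun t => H (polar r1 t))) in G0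
      by (intros; unfold F; rewrite exp_ln by lra; reflexivity).
    rewrite (CInt_ext (F (ln r2)) (fun t => H (polar r2 t))) in G0
      by (intros; unfold F; rewrite exp_ln by lra; reflexivity).
    unfold avg. f_equal.
    set (A := CInt (fun t => H (polar r1 t)) 0 (2 * PI)) in *.
    set (B := CInt (fun t => H (polar r2 t)) 0 (2 * PI)) in *.
    replace A with (B - / Ci * (Ci * B - Ci * A))%C by (field; apply Ci_nz).
    match type of G0 with ?x = _ => replace (Ci * B - Ci * A)%C with x by ring end.
    rewrite G0. ring.
  - intros s _. unfold F, polar. rewrite cos_2PI, sin_2PI, cos_0, sin_0. reflexivity.
Qed.

(** ** Uniform continuity on circles *)

Lemma polar_2d_cont H r t : cat Cd H (polar r t) ->
  forall eps, 0 < eps -> exists del, 0 < del /\ forall r' t',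
    Rabs (r' - r) < del -> Rabs (t' - t) < del ->
    Cmod (H (polar r' t') - H (polar r t)) < eps.
Proof.
  intros HH eps He.
  destruct (cat_comp R2d H _ (r, t) (polar_cat r t) HH eps He) as [d [Hd D]].
  exists d. split; auto. intros r' t' H1 H2. apply (D (r', t')).
  apply Rmax_lub_lt; assumption.
Qed.

Lemma uniform_on_circle H r : (forall t, cat Cd H (polar r t)) ->
  forall eps, 0 < eps -> exists del, 0 < del /\ forall r' t,
    Rabs (r' - r) < del -> 0 <= t <= 2 * PI ->
    Cmod (H (polar r' t) - H (polar r t)) < eps.
Proof.
  intros HH eps He.
  assert (C1 : forall t, continuity_2d_pt (fun r t => Re (H (polar r t))) r t).
  { intros t e. destruct (polar_2d_cont H r t (HH t) e (cond_pos e)) as [d [Hd D]].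
    exists (mkposreal d Hd). intros u v Hu Hv.
    eapply Rle_lt_trans; [|apply (D u v Hu Hv)]. apply (re_le_Cmod (H (polar u v) - H (polar r t))). }
  assert (C2 : forall t, continuity_2d_pt (fun r t => Im (H (polar r t))) r t).
  { intros t e. destruct (polar_2d_cont H r t (HH t) e (cond_pos e)) as [d [Hd D]].
    exists (mkposreal d Hd). intros u v Hu Hv.
    eapply Rle_lt_trans; [|apply (D u v Hu Hv)].
    eapply Rle_trans; [|apply Rmax_Cmod]. apply Rmax_r. }
  destruct (uniform_continuity_2d_1d' _ 0 (2 * PI) r (fun x _ => C1 x) (mkposreal (eps / 2) ltac:(lra)))
    as [d1 D1].
  destruct (uniform_continuity_2d_1d' _ 0 (2 * PI) r (fun x _ => C2 x) (mkposreal (eps / 2) ltac:(lra)))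
    as [d2 D2].
  exists (Rmin d1 d2). split; [apply Rmin_pos; apply cond_pos|].
  intros r' t Hr Ht.
  assert (h1 := Rlt_le_trans _ _ _ Hr (Rmin_l _ _)). assert (h2 := Rlt_le_trans _ _ _ Hr (Rmin_r _ _)).
  apply Rabs_def2 in h1. apply Rabs_def2 in h2.
  assert (Z : Rabs (t - t) = 0) by (replace (t - t) with 0 by ring; apply Rabs_R0).
  assert (P1 := cond_pos d1). assert (P2 := cond_pos d2).
  specialize (D1 t r t r' Ht ltac:(lra) Ht ltac:(lra) ltac:(lra)).
  specialize (D2 t r t r' Ht ltac:(lra) Ht ltac:(lra) ltac:(lra)). simpl in D1, D2.
  eapply Rle_lt_trans; [apply (Cmod_pair_le (Re (H (polar r' t)) - Re (H (polar r t)))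
    (Im (H (polar r' t)) - Im (H (polar r t))))|]. lra.
Qed.

Lemma ccont_circle H r : (forall t, cat Cd H (polar r t)) -> ccont (fun t => H (polar r t)).
Proof. intros HH t. apply (cat_comp Rd H (polar r)); [apply polar_cat_t|apply HH]. Qed.

Lemma circle_avg_cont H r : (forall z, Cmod z < 1 -> cat Cd H z) -> 0 <= r < 1 ->
  forall eps, 0 < eps -> exists del, 0 < del /\ forall r', 0 <= r' < 1 -> Rabs (r' - r) < del ->
    Cmod (avg (fun t => H (polar r' t)) - avg (fun t => H (polar r t))) <= eps.
Proof.
  intros HH Hr eps He.
  assert (HC : forall s t, 0 <= s < 1 -> cat Cd H (polar s t)).
  { intros s t Hs. apply HH. rewrite Cmod_polar; lra. }
  destruct (uniform_on_circle H r (fun t => HC r t Hr) eps He) as [d [Hd D]].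
  exists d. split; auto. intros r' Hr' Hd'.
  rewrite <- avg_minus by (apply ccont_circle; intros; apply HC; auto).
  apply avg_bound.
  - intros t. apply cat_minus; apply ccont_circle; intros; apply HC; auto.
  - intros t Ht. left. apply D; auto.
Qed.

(** One exceptional radius is harmless: the average is constant on either side of it and
    continuous across it. *)
Lemma avg_removable H z0 : (forall z, Cmod z < 1 -> cat Cd H z) ->
  (forall z, Cmod z < 1 -> z <> z0 -> exists l, cder H z l) ->
  forall r, 0 <= r < 1 -> avg (fun t => H (polar r t)) = H (RtoC 0).
Proof.
  intros HC HD.
  set (J := fun r => avg (fun t => H (polar r t))).
  set (rho := Cmod z0).
  assert (J0 : J 0 = H (RtoC 0)).
  { unfold J. rewrite (avg_ext _ (fun _ => H (RtoC 0))); [apply avg_const|].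
    intros t. f_equal. unfold polar. apply injective_projections; simpl; ring. }
  assert (K : forall r1 r2, 0 < r1 < r2 -> r2 < 1 -> (r2 < rho \/ rho < r1) -> J r1 = J r2).
  { intros r1 r2 H12 H2 Hrho. apply circle_avg_const; auto.
    intros z Hz. apply HD; [lra|]. intros ->. fold rho in Hz. lra. }
  (* continuity: [J r = c] as soon as [J] takes the value [c] at radii arbitrarily near [r] *)
  assert (L : forall r c, 0 <= r < 1 -> (exists d, 0 < d /\ forall e, 0 < e < d ->
      exists r', 0 <= r' < 1 /\ Rabs (r' - r) < e /\ J r' = c) -> J r = c).
  { intros r c Hr [d [Hd H1]].
    assert (Z : Cmod (c - J r) = 0).
    { apply Rle_antisym; [|apply Cmod_ge_0]. apply le_epsilon. intros eps He. rewrite Rplus_0_l.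
      destruct (circle_avg_cont H r HC Hr eps He) as [d2 [Hd2 D2]].
      destruct (H1 (Rmin d2 d / 2)) as [r' [A1 [A2 A3]]].
      { assert (M0 : 0 < Rmin d2 d) by (apply Rmin_pos; auto).
        assert (M1 := Rmin_r d2 d). lra. }
      assert (M0 : 0 < Rmin d2 d) by (apply Rmin_pos; auto).
      assert (M1 := Rmin_l d2 d). rewrite <- A3. apply D2; auto. lra. }
    apply Cmod_eq_0 in Z. replace (J r) with (c - (c - J r))%C by ring. rewrite Z. ring. }
  assert (Hrho : 0 <= rho) by apply Cmod_ge_0.
  assert (S1 : forall r, 0 < r < rho -> r < 1 -> J r = J 0).
  { intros r Hr H1. symmetry. apply L; [lra|]. exists r. split; [lra|]. intros e He.
    exists (e / 2). split; [lra|]. split; [rewrite Rabs_pos_eq; lra|]. apply K; lra. }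
  assert (S2 : rho < 1 -> J rho = J 0).
  { intros H1. destruct Hrho as [Hp|<-]; [|reflexivity].
    apply L; [lra|]. exists rho. split; [lra|]. intros e He.
    exists (rho - e / 2). split; [lra|]. split; [rewrite Rabs_left; lra|]. apply S1; lra. }
  assert (S3 : forall r, rho < r < 1 -> J r = J 0).
  { intros r Hr. rewrite <- S2 by lra. symmetry. apply L; [lra|]. exists (r - rho). split; [lra|].
    intros e He. exists (rho + e / 2). split; [lra|]. split; [rewrite Rabs_pos_eq; lra|]. apply K; lra. }
  intros r Hr. fold (J r). rewrite <- J0.
  destruct (Req_dec r 0) as [->|Hr0]; [reflexivity|].
  destruct (Rtotal_order r rho) as [h|[h|h]].
  - apply S1; lra.
  - rewrite h. apply S2. lra.
  - apply S3; lra.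
Qed.

(** * Power series of analytic functions *)

(** Caratheodory's form of differentiability, for which the differentiation rules are
    algebraic identities. *)
Definition cdif (f : C -> C) (z : C) : Prop :=
  exists q, cat Cd q z /\ forall y, (f y - f z = q y * (y - z))%C.

Lemma Cd_refl x : Cd x x = 0.
Proof. unfold Cd. replace (x - x)%C with (RtoC 0) by ring. apply Cmod_0. Qed.

Lemma Cmod_minus_pos (x y : C) : x <> y -> 0 < Cmod (x - y).
Proof. intros H. apply Cmod_gt_0. apply Cminus_eq_contra, H. Qed.

Lemma cder_cdif f z l : cder f z l -> cdif f z.
Proof.
  intros H. exists (fun y => if Ceq_dec y z then l else (f y - f z) / (y - z))%C. split.
  - intros eps He. destruct (H (eps / 2) ltac:(lra)) as [d [Hd D]]. exists d. split; auto.
    intros y Hy. destruct (Ceq_dec z z) as [_|n]; [|congruence].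
    destruct (Ceq_dec y z) as [_|n].
    + replace (l - l)%C with (RtoC 0) by ring. rewrite Cmod_0. auto.
    + assert (nz := Cminus_eq_contra _ _ n).
      replace ((f y - f z) / (y - z) - l)%C with ((f y - f z - l * (y - z)) / (y - z))%C
        by (field; auto).
      rewrite Cmod_div by auto. assert (P := Cmod_minus_pos _ _ n).
      apply Rle_lt_trans with (eps / 2); [|lra].
      apply Rmult_le_reg_r with (Cmod (y - z)); auto.
      unfold Rdiv at 1. rewrite Rmult_assoc, Rinv_l, Rmult_1_r by lra. apply D, Hy.
  - intros y. destruct (Ceq_dec y z) as [->|n]; [ring|].
    field. apply Cminus_eq_contra, n.
Qed.

Lemma cdif_cder f z : cdif f z -> exists l, cder f z l.
Proof.
  intros [q [Hq E]]. exists (q z). intros eps He. destruct (Hq eps He) as [d [Hd D]].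
  exists d. split; auto. intros y Hy. rewrite E.
  replace (q y * (y - z) - q z * (y - z))%C with ((q y - q z) * (y - z))%C by ring.
  rewrite Cmod_mult. apply Rmult_le_compat_r; [apply Cmod_ge_0|]. left. apply D, Hy.
Qed.

Lemma cdif_cat f z : cdif f z -> cat Cd f z.
Proof. intros H. destruct (cdif_cder f z H) as [l Hl]. apply (cder_cat _ _ _ Hl). Qed.

Lemma cdif_const c z : cdif (fun _ => c) z.
Proof. exists (fun _ => RtoC 0). split; [apply cat_const|]. intros; ring. Qed.

Lemma cdif_id z : cdif (fun y => y) z.
Proof. exists (fun _ => RtoC 1). split; [apply cat_const|]. intros; ring. Qed.

Lemma cdif_plus f g z : cdif f z -> cdif g z -> cdif (fun y => f y + g y)%C z.
Proof.
  intros [p [Hp Ep]] [q [Hq Eq]]. exists (fun y => p y + q y)%C. split; [apply cat_plus; auto|].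
  intros y. replace ((p y + q y) * (y - z))%C with (p y * (y - z) + q y * (y - z))%C by ring.
  rewrite <- Ep, <- Eq. ring.
Qed.

Lemma cdif_mult f g z : cdif f z -> cdif g z -> cdif (fun y => f y * g y)%C z.
Proof.
  intros [p [Hp Ep]] Hg. assert (Cg := cdif_cat _ _ Hg). destruct Hg as [q [Hq Eq]].
  exists (fun y => p y * g y + f z * q y)%C. split.
  - apply cat_plus; apply cat_mult; auto using cat_const.
  - intros y. replace ((p y * g y + f z * q y) * (y - z))%C
      with ((p y * (y - z)) * g y + f z * (q y * (y - z)))%C by ring.
    rewrite <- Ep, <- Eq. ring.
Qed.

Lemma cdif_comp f g z : cdif g z -> cdif f (g z) -> cdif (fun y => f (g y)) z.
Proof.
  intros Hg [p [Hp Ep]]. assert (Cg := cdif_cat _ _ Hg). destruct Hg as [q [Hq Eq]].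
  exists (fun y => p (g y) * q y)%C. split.
  - apply cat_mult; auto. apply (cat_comp Cd p g); auto.
  - intros y. rewrite Ep, Eq. ring.
Qed.

Lemma cdif_minus f g z : cdif f z -> cdif g z -> cdif (fun y => f y - g y)%C z.
Proof.
  intros Hf [q [Hq Eq]]. apply (cdif_plus f (fun y => - g y)%C); auto.
  exists (fun y => - q y)%C. split; [apply cat_opp; auto|].
  intros y. replace (- q y * (y - z))%C with (- (q y * (y - z)))%C by ring.
  rewrite <- Eq. ring.
Qed.

Lemma cdif_pow f z n : cdif f z -> cdif (fun y => f y ^ n)%C z.
Proof.
  intros Hf. induction n as [|n IH]; simpl; [apply cdif_const|apply cdif_mult; auto].
Qed.

Lemma cdif_csum (f : nat -> C -> C) z n :
  (forall k, cdif (f k) z) -> cdif (fun y => csum (fun k => f k y) n) z.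
Proof.
  intros H; induction n; simpl; [apply cdif_const|apply cdif_plus; auto].
Qed.

Lemma cdif_ext_loc f g z : (exists e, 0 < e /\ forall y, Cd z y < e -> f y = g y) ->
  cdif f z -> cdif g z.
Proof.
  intros [e [He E]] H. destruct (cdif_cder _ _ H) as [l Hl]. apply cder_cdif with l.
  intros eps Heps. destruct (Hl eps Heps) as [d [Hd D]].
  exists (Rmin e d). split; [apply Rmin_pos; auto|]. intros y Hy.
  rewrite <- !E; [|rewrite Cd_refl; lra|eapply Rlt_le_trans; [exact Hy|apply Rmin_l]].
  apply D. eapply Rlt_le_trans; [exact Hy|apply Rmin_r].
Qed.

Lemma neq_nearby (z0 z : C) : z <> z0 -> exists e, 0 < e /\ forall y, Cd z y < e -> y <> z0.
Proof.
  intros H. exists (Cmod (z0 - z)). split; [apply Cmod_minus_pos; auto|].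
  intros y Hy ->. unfold Cd in Hy. lra.
Qed.

Lemma cdif_Cinv z : z <> RtoC 0 -> cdif Cinv z.
Proof.
  intros Hz. apply cder_cdif with (- / (z * z))%C.
  assert (Cq : cat Cd (fun y => - / (y * z))%C z).
  { apply cat_opp, cat_inv; [apply cat_mult; [apply cat_id|apply cat_const]|].
    apply Cmult_neq_0; auto. }
  intros eps He. destruct (Cq eps He) as [d [Hd D]].
  destruct (neq_nearby _ _ Hz) as [e [He' E]].
  exists (Rmin d e). split; [apply Rmin_pos; auto|]. intros y Hy.
  assert (Hy0 : y <> RtoC 0) by (apply E; eapply Rlt_le_trans; [exact Hy|apply Rmin_r]).
  replace (/ y - / z - - / (z * z) * (y - z))%C
    with ((- / (y * z) - - / (z * z)) * (y - z))%C by (field; auto).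
  rewrite Cmod_mult. apply Rmult_le_compat_r; [apply Cmod_ge_0|]. left. apply D.
  eapply Rlt_le_trans; [exact Hy|apply Rmin_l].
Qed.

Lemma cdif_inv f z : cdif f z -> f z <> RtoC 0 -> cdif (fun y => / f y)%C z.
Proof. intros H H0. apply (cdif_comp Cinv f); auto using cdif_Cinv. Qed.

Lemma analytic_cdif f z : analytic_disk f -> Cmod z < 1 -> cdif f z.
Proof.
  intros H Hz. destruct (ex_derive_cder f z (H z Hz)) as [l Hl]. apply (cder_cdif _ _ _ Hl).
Qed.

Lemma cdif_analytic f : (forall z, Cmod z < 1 -> cdif f z) -> analytic_disk f.
Proof.
  intros H z Hz. destruct (cdif_cder _ _ (H z Hz)) as [l Hl]. apply (cder_ex_derive _ _ _ Hl).
Qed.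

(** ** Averages of monomials *)

Lemma polar_pow r t n : (polar r t ^ n)%C = polar (r ^ n) (INR n * t).
Proof.
  induction n as [|n IH].
  - simpl. unfold polar. rewrite Rmult_0_l, cos_0, sin_0.
    apply injective_projections; simpl; ring.
  - rewrite Cpow_S, IH, polar_mult, S_INR. f_equal. ring.
Qed.

Lemma polar_conj r t : Cconj (polar r t) = polar r (- t).
Proof.
  unfold polar, Cconj. rewrite cos_neg, sin_neg. simpl. f_equal. ring.
Qed.

Lemma sin_int_2PI (k : Z) : sin (IZR k * (2 * PI)) = 0.
Proof.
  apply sin_eq_0_1. exists (2 * k)%Z. rewrite mult_IZR. ring.
Qed.

Lemma cos_int_2PI (k : Z) : cos (IZR k * (2 * PI)) = 1.
Proof.
  replace (IZR k * (2 * PI)) with (2 * (IZR k * PI)) by ring.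
  rewrite cos_2a_sin. rewrite (sin_eq_0_1 (IZR k * PI)); [ring|]. exists k. ring.
Qed.

Lemma polar_scaled_cat s k t : cat Rd (fun t => polar s (k * t)) t.
Proof.
  apply cat_ext with (fun t => RtoC s * (RtoC (cos (k * t)) + Ci * RtoC (sin (k * t))))%C.
  - intros y. unfold polar. apply injective_projections; simpl; ring.
  - assert (cf : forall f : R -> R, continuity f -> cat Rd (fun t => RtoC (f (k * t))) t).
    { intros f Hf. apply (continuous_cat_R (fun t => f (k * t))). apply continuity_pt_filterlim.
      apply (continuity_pt_comp (fun t => k * t) f); [|apply Hf].
      apply derivable_continuous_pt, derivable_pt_scal, derivable_pt_id. }
    apply cat_mult; [apply cat_const|]. apply cat_plus; [apply (cf cos), continuity_cos|].
    apply cat_mult; [apply cat_const|apply (cf sin), continuity_sin].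
Qed.

Lemma avg_polar_int s (k : Z) : k <> 0%Z -> avg (fun t => polar s (IZR k * t)) = RtoC 0.
Proof.
  intros Hk. unfold avg. assert (P := two_pi_pos). rewrite CInt_pair; [|lra|].
  2: intros; apply polar_scaled_cat.
  assert (Hk' : IZR k <> 0) by (apply not_0_IZR; auto).
  assert (H1 : RInt (fun t => Re (polar s (IZR k * t))) 0 (2 * PI) = 0).
  { apply (is_RInt_unique (V := R_CompleteNormedModule)).
    replace 0 with (minus (s * sin (IZR k * (2 * PI)) / IZR k) (s * sin (IZR k * 0) / IZR k)) at 2.
    - apply (is_RInt_derive (V := R_CompleteNormedModule) (fun t => s * sin (IZR k * t) / IZR k)).
      + intros x _. unfold polar, Re. simpl. auto_derive; auto. field. auto.
      + intros x _. apply cat_continuous_R. 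
        intros eps He. destruct (polar_scaled_cat s (IZR k) x eps He) as [d [Hd D]].
        exists d. split; auto. intros y Hy. eapply Rle_lt_trans; [|apply (D y Hy)].
        rewrite <- RtoC_minus, Cmod_R.
        apply (re_le_Cmod (polar s (IZR k * y) - polar s (IZR k * x))).
    - replace (IZR k * 0) with 0 by ring. rewrite sin_int_2PI, sin_0. unfold minus, plus, opp. simpl. field. auto. }
  assert (H2 : RInt (fun t => Im (polar s (IZR k * t))) 0 (2 * PI) = 0).
  { apply (is_RInt_unique (V := R_CompleteNormedModule)).
    replace 0 with (minus (- s * cos (IZR k * (2 * PI)) / IZR k) (- s * cos (IZR k * 0) / IZR k)) at 2.
    - apply (is_RInt_derive (V := R_CompleteNormedModule) (fun t => - s * cos (IZR k * t) / IZR k)).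
      + intros x _. unfold polar, Im. simpl. auto_derive; auto. field. auto.
      + intros x _. apply cat_continuous_R. 
        intros eps He. destruct (polar_scaled_cat s (IZR k) x eps He) as [d [Hd D]].
        exists d. split; auto. intros y Hy. eapply Rle_lt_trans; [|apply (D y Hy)].
        rewrite <- RtoC_minus, Cmod_R.
        eapply Rle_trans; [|apply Rmax_Cmod]. apply Rmax_r.
    - replace (IZR k * 0) with 0 by ring. rewrite cos_int_2PI, cos_0. unfold minus, plus, opp. simpl. field. auto. }
  rewrite H1, H2. apply injective_projections; simpl; ring.
Qed.

Lemma avg_monomials r n m :
  avg (fun t => polar r t ^ n * Cconj (polar r t ^ m))%C
    = RtoC (if Nat.eq_dec n m then r ^ (2 * n) else 0).
Proof.
  rewrite (avg_ext _ (fun t => polar (r ^ (n + m)) (IZR (Z.of_nat n - Z.of_nat m) * t))).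
  - destruct (Nat.eq_dec n m) as [->|H].
    + rewrite Z.sub_diag. rewrite (avg_ext _ (fun _ => RtoC (r ^ (2 * m)))); [apply avg_const|].
      intros t. rewrite Rmult_0_l. unfold polar. rewrite cos_0, sin_0.
      replace (m + m)%nat with (2 * m)%nat by lia. apply injective_projections; simpl; ring.
    + apply avg_polar_int. lia.
  - intros t. rewrite !polar_pow, polar_conj, polar_mult, <- pow_add. f_equal.
    rewrite minus_IZR, <- !INR_IZR_INZ. ring.
Qed.

(** ** Cauchy's formula *)

Definition ps (a : nat -> C) (z : C) (n : nat) : C := csum (fun k => a k * z ^ k)%C n.

Definition acoef (f : C -> C) (r : R) (n : nat) : C :=
  avg (fun t => f (polar r t) * / polar r t ^ n)%C.

(** Any radius in $(0,1)$ gives the Taylor coefficients; see [acoef_radius]. *)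
Definition coef (f : C -> C) (n : nat) : C := acoef f (1 / 2) n.

Lemma polar_neq_0 r t : 0 < r -> polar r t <> RtoC 0.
Proof. intros H. apply Cmod_gt_0. rewrite Cmod_polar; lra. Qed.

Lemma acoef_radius f r n : (forall z, Cmod z < 1 -> cdif f z) -> 0 < r < 1 ->
  acoef f r n = coef f n.
Proof.
  intros Hf Hr.
  assert (K : forall r1 r2, 0 < r1 < r2 -> r2 < 1 -> acoef f r1 n = acoef f r2 n).
  { intros r1 r2 H1 H2. apply (circle_avg_const (fun z => f z * / z ^ n)%C); auto.
    intros z Hz. apply cdif_cder. apply cdif_mult; [apply Hf; lra|].
    apply cdif_inv; [apply cdif_pow, cdif_id|]. apply Cpow_nz. apply Cmod_gt_0. lra. }
  unfold coef. destruct (Rtotal_order r (1 / 2)) as [h|[->|h]]; auto.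
  - apply K; lra.
  - symmetry. apply K; lra.
Qed.

Lemma ccont_bounded h : ccont h -> exists M, 0 <= M /\ forall t, 0 <= t <= 2 * PI -> Cmod (h t) <= M.
Proof.
  intros Hh. assert (P := two_pi_pos).
  destruct (continuity_ab_maj (fun t => Cmod (h t)) 0 (2 * PI) ltac:(lra)) as [Mx [HM _]].
  - intros c _. apply continuity_pt_filterlim. apply cat_continuous_R, cat_Cmod, Hh.
  - exists (Cmod (h Mx)). split; [apply Cmod_ge_0|]. exact HM.
Qed.

Lemma avg_inv_polar r n : 0 < r ->
  avg (fun t => / polar r t ^ n)%C = RtoC (if Nat.eq_dec n 0 then 1 else 0).
Proof.
  intros Hr. assert (Rn : r ^ n <> 0) by (apply pow_nonzero; lra).
  rewrite (avg_ext _ (fun t => RtoC (/ (r ^ (2 * n))) * (polar r t ^ 0 * Cconj (polar r t ^ n)))%C).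
  - rewrite avg_scal, avg_monomials.
    + rewrite <- RtoC_mult. f_equal. destruct (Nat.eq_dec 0 n) as [e|e]; destruct (Nat.eq_dec n 0) as [e'|e']; try lia.
      * subst n. simpl. field.
      * ring.
    + intros t. apply cat_mult; [|apply cat_conj]; apply cat_pow, polar_cat_t.
  - intros t. simpl (polar r t ^ 0)%C.
    assert (N := Cpow_nz _ n (polar_neq_0 r t Hr)).
    assert (E := Cmod2_conj (polar r t ^ n)).
    rewrite Cmod_pow, Cmod_polar in E by lra. rewrite <- pow_mult, Nat.mul_comm in E.
    assert (Q : RtoC (r ^ (2 * n)) <> RtoC 0) by (intros q; apply RtoC_inj in q; revert q; apply pow_nonzero; lra).
    rewrite RtoC_inv by (apply pow_nonzero; lra).
    rewrite Cmult_1_l.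
    replace (Cconj (polar r t ^ n)) with (RtoC (r ^ (2 * n)) / polar r t ^ n)%C
      by (rewrite E; field; auto).
    field. auto.
Qed.

(** The difference quotient at [z] times the variable vanishes at the origin and has the
    single singularity [z], which is removable; so its averages vanish. Expanding the Cauchy
    kernel in a geometric series turns this into the convergence of the Taylor series. *)
Theorem taylor_series f z : (forall z, Cmod z < 1 -> cdif f z) -> Cmod z < 1 ->
  forall eps, 0 < eps -> exists N, forall n, (N <= n)%nat -> Cmod (ps (coef f) z n - f z) < eps.
Proof.
  intros Hf Hz eps He.
  destruct (Hf z Hz) as [q [Hq Eq]].
  set (H := fun y => (q y * y)%C).
  assert (Qd : forall y, Cmod y < 1 -> y <> z -> cdif q y).
  { intros y Hy Hyz. apply cdif_ext_loc with (fun y => (f y - f z) * / (y - z))%C.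
    - destruct (neq_nearby _ _ Hyz) as [e [He' E]]. exists e. split; auto.
      intros u Hu. rewrite Eq. field. apply Cminus_eq_contra. auto.
    - apply cdif_mult; [apply cdif_minus; [apply Hf; auto|apply cdif_const]|].
      apply cdif_inv; [apply cdif_minus; [apply cdif_id|apply cdif_const]|].
      apply Cminus_eq_contra. auto. }
  assert (Hc : forall y, Cmod y < 1 -> cat Cd H y).
  { intros y Hy. apply cat_mult; [|apply cat_id].
    destruct (Ceq_dec y z) as [->|n]; [exact Hq|apply cdif_cat, Qd; auto]. }
  assert (Z : forall r, 0 <= r < 1 -> avg (fun t => H (polar r t)) = RtoC 0).
  { intros r Hr. rewrite (avg_removable H z Hc); auto.
    - unfold H. ring.
    - intros y Hy Hyz. apply cdif_cder, cdif_mult; [apply Qd; auto|apply cdif_id]. }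
  set (r := (1 + Cmod z) / 2). assert (Cz := Cmod_ge_0 z).
  assert (Hr : Cmod z < r < 1) by (unfold r; lra).
  assert (cH : ccont (fun t => H (polar r t))).
  { apply ccont_circle. intros t. apply Hc. rewrite Cmod_polar; lra. }
  assert (cf : ccont (fun t => f (polar r t))).
  { apply ccont_circle. intros t. apply cdif_cat, Hf. rewrite Cmod_polar; lra. }
  assert (ci : forall n, ccont (fun t => / polar r t ^ n)%C).
  { intros n t. apply cat_inv; [apply cat_pow, polar_cat_t|]. apply Cpow_nz, polar_neq_0. lra. }
  destruct (ccont_bounded _ cH) as [M [HM0 HM]].
  destruct (geom_small (Cmod z / r) M eps) as [N HN]; auto.
  { split; [apply Rmult_le_pos; [lra|left; apply Rinv_0_lt_compat; lra]|].
    apply Rmult_lt_reg_r with r; [lra|]. unfold Rdiv. rewrite Rmult_assoc, Rinv_l; lra. }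
  exists (S N). intros n Hn.
  assert (Id : (ps (coef f) z n - f z)%C =
     (RtoC 0 - avg (fun t => H (polar r t) * (z ^ n * / polar r t ^ n)))%C).
  { rewrite <- (Z r ltac:(lra)) at 1. rewrite <- avg_minus; auto.
    2: { intros t. apply cat_mult; [apply cH|apply cat_mult; [apply cat_const|apply ci]]. }
    rewrite (avg_ext _ (fun t => csum (fun k => z ^ k * (f (polar r t) * / polar r t ^ k)
        + (- f z * z ^ k) * / polar r t ^ k) n)%C).
    - rewrite (avg_csum (fun k t => z ^ k * (f (polar r t) * / polar r t ^ k)
        + (- f z * z ^ k) * / polar r t ^ k)%C).
      2: { intros k t. apply cat_plus; apply cat_mult; try apply cat_const; [|apply ci].
           apply cat_mult; [apply cf|apply ci]. }
      rewrite (csum_ext _ (fun k => coef f k * z ^ k +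
         (- f z) * RtoC (if Nat.eq_dec k 0 then 1 else 0))%C).
      + rewrite csum_plus, csum_scal. fold (ps (coef f) z n).
        replace (csum (fun k => RtoC (if Nat.eq_dec k 0 then 1 else 0)) n) with (RtoC 1); [ring|].
        destruct n as [|n]; [lia|]. clear. induction n as [|n IH]; [simpl; ring|].
        change (csum (fun k => RtoC (if Nat.eq_dec k 0 then 1 else 0)) (S (S n))) with
          (csum (fun k => RtoC (if Nat.eq_dec k 0 then 1 else 0)) (S n) +
            RtoC (if Nat.eq_dec (S n) 0 then 1 else 0))%C.
        rewrite <- IH. destruct (Nat.eq_dec (S n) 0); [lia|ring].
      + intros k _. rewrite avg_plus, !avg_scal, avg_inv_polar by
          (auto; try lra; intros t; first [apply ci | apply cat_mult; [first [apply cat_const|apply cf]|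
             first [apply ci|apply cat_mult; [apply cf|apply ci]]]]).
        fold (acoef f r k). rewrite acoef_radius by (auto; lra).
        destruct (Nat.eq_dec k 0) as [->|]; [simpl; ring|ring].
    - intros t. set (w := polar r t).
      assert (Hw : w <> RtoC 0) by (apply polar_neq_0; lra).
      assert (Hwz : w <> z).
      { intros E. assert (Cmod w = r) by (apply Cmod_polar; lra). rewrite E in *. lra. }
      assert (Hwz' := Cminus_eq_contra _ _ Hwz).
      unfold H. replace (q w) with ((f w - f z) / (w - z))%C by (rewrite Eq; field; auto).
      clear - Hw Hwz'. induction n as [|n IH]; simpl; [field; auto|].
      rewrite <- IH. assert (Q := Cpow_nz _ n Hw). field. auto. }
  rewrite Id. replace (RtoC 0 - avg (fun t => H (polar r t) * (z ^ n * / polar r t ^ n)))%C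
    with (- avg (fun t => H (polar r t) * (z ^ n * / polar r t ^ n)))%C by ring.
  rewrite Cmod_opp. apply Rle_lt_trans with (M * (Cmod z / r) ^ n); [|apply HN; lia].
  apply avg_bound.
  - intros t. apply cat_mult; [apply cH|apply cat_mult; [apply cat_const|apply ci]].
  - intros t Ht. rewrite !Cmod_mult, Cmod_inv, !Cmod_pow, Cmod_polar by
      (try lra; apply Cpow_nz, polar_neq_0; lra).
    unfold Rdiv. rewrite Rpow_mult_distr, pow_inv.
    apply Rmult_le_compat_r; auto.
    apply Rmult_le_pos; [apply pow_le; auto|left; apply Rinv_0_lt_compat, pow_lt; lra].
Qed.

(** ** Bessel's inequality, Parseval's identity and the growth of quadratic means *)

Lemma avg_conj h : ccont h -> avg (fun t => Cconj (h t)) = Cconj (avg h).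
Proof.
  intros Hh. unfold avg. assert (P := two_pi_pos).
  rewrite !CInt_pair; try lra; auto; [|intros; apply cat_conj, Hh].
  rewrite Cmult_conj. f_equal; [apply injective_projections; simpl; ring|].
  apply injective_projections; simpl; [reflexivity|].
  transitivity (RInt (fun t => opp (Im (h t))) 0 (2 * PI)); [reflexivity|].
  rewrite (RInt_opp (V := R_CompleteNormedModule)); [reflexivity|].
  apply (ex_RInt_continuous (V := R_CompleteNormedModule)). intros t _.
  apply cat_continuous_R. intros eps He. destruct (Hh t eps He) as [d [Hd D]].
  exists d. split; auto. intros y Hy. rewrite <- RtoC_minus, Cmod_R.
  eapply Rle_lt_trans; [|apply (D y Hy)]. eapply Rle_trans; [|apply Rmax_Cmod]. apply Rmax_r.
Qed.

Lemma csum_delta c x m N :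
  csum (fun k => c k * RtoC (if Nat.eq_dec k m then x else 0))%C N =
  (if lt_dec m N then c m * RtoC x else RtoC 0)%C.
Proof.
  induction N as [|N IH]; simpl; [destruct (lt_dec m 0); [lia|auto]|].
  rewrite IH. destruct (Nat.eq_dec N m) as [->|n].
  - destruct (lt_dec m m); [lia|]. destruct (lt_dec m (S m)); [ring|lia].
  - destruct (lt_dec m N), (lt_dec m (S N)); try lia; ring.
Qed.

Lemma csum_conj f n : Cconj (csum f n) = csum (fun k => Cconj (f k)) n.
Proof.
  induction n as [|n IH]; simpl; [apply injective_projections; simpl; ring|].
  rewrite Cplus_conj, IH. reflexivity.
Qed.

Lemma csum_RtoC f n : csum (fun k => RtoC (f k)) n = RtoC (rsum f n).
Proof. induction n as [|n IH]; simpl; auto. rewrite IH, RtoC_plus. reflexivity. Qed.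

Lemma ps_cat_circle a r N : ccont (fun t => ps a (polar r t) N).
Proof.
  intros t. unfold ps. apply (cat_csum Rd (fun k t => a k * polar r t ^ k)%C).
  intros k. apply cat_mult; [apply cat_const|apply cat_pow, polar_cat_t].
Qed.

Lemma avg_mul_conj_ps h a r N : ccont h ->
  avg (fun t => h t * Cconj (ps a (polar r t) N))%C
  = csum (fun k => Cconj (a k) * avg (fun t => h t * Cconj (polar r t ^ k)))%C N.
Proof.
  intros Hh.
  assert (cm : forall k, ccont (fun t => h t * Cconj (polar r t ^ k))%C).
  { intros k t. apply cat_mult; [apply Hh|apply cat_conj, cat_pow, polar_cat_t]. }
  rewrite (avg_ext _ (fun t => csum (fun k => Cconj (a k) * (h t * Cconj (polar r t ^ k))) N)%C).
  - rewrite (avg_csum (fun k t => Cconj (a k) * (h t * Cconj (polar r t ^ k)))%C).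
    + apply csum_ext. intros k _. apply avg_scal, cm.
    + intros k t. apply cat_mult; [apply cat_const|apply cm].
  - intros t. unfold ps. rewrite csum_conj, <- csum_scal. apply csum_ext. intros k _.
    rewrite Cmult_conj. ring.
Qed.

Lemma Cconj_mult_Cmod2 c : (Cconj c * c)%C = RtoC (Cmod c ^ 2).
Proof. rewrite Cmult_comm. symmetry. apply Cmod2_conj. Qed.

Lemma csum_coef_conj a r N :
  csum (fun k => Cconj (a k) * (a k * RtoC (r ^ (2 * k))))%C N
  = RtoC (rsum (fun k => Cmod (a k) ^ 2 * r ^ (2 * k)) N).
Proof.
  rewrite <- csum_RtoC. apply csum_ext. intros k _.
  rewrite Cmult_assoc, Cconj_mult_Cmod2, RtoC_mult. reflexivity.
Qed.

Lemma parseval a r N :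
  ravg (fun t => Cmod (ps a (polar r t) N) ^ 2) = rsum (fun k => Cmod (a k) ^ 2 * r ^ (2 * k)) N.
Proof.
  apply RtoC_inj. rewrite <- ravg_avg by (apply ccont_sq, ps_cat_circle).
  rewrite <- csum_coef_conj.
  rewrite (avg_ext _ (fun t => ps a (polar r t) N * Cconj (ps a (polar r t) N))%C)
    by (intros; apply Cmod2_conj).
  rewrite avg_mul_conj_ps by apply ps_cat_circle.
  apply csum_ext. intros m Hm. f_equal.
  rewrite (avg_ext _ (fun t => csum (fun k => a k * (polar r t ^ k * Cconj (polar r t ^ m))) N)%C).
  - rewrite (avg_csum (fun k t => a k * (polar r t ^ k * Cconj (polar r t ^ m)))%C).
    + rewrite (csum_ext _ (fun k => a k * RtoC (if Nat.eq_dec k m then r ^ (2 * m) else 0))%C).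
      * rewrite csum_delta. destruct (lt_dec m N); [reflexivity|lia].
      * intros k _. rewrite avg_scal, avg_monomials.
        -- destruct (Nat.eq_dec k m) as [->|]; reflexivity.
        -- intros t. apply cat_mult; [|apply cat_conj]; apply cat_pow, polar_cat_t.
    + intros k t. apply cat_mult; [apply cat_const|].
      apply cat_mult; [|apply cat_conj]; apply cat_pow, polar_cat_t.
  - intros t. unfold ps. rewrite Cmult_comm, <- csum_scal. apply csum_ext. intros; ring.
Qed.

Lemma ravg_nonneg h : (forall t, continuous h t) -> (forall t, 0 <= h t) -> 0 <= ravg h.
Proof.
  intros Hc H. rewrite <- (ravg_const 0). apply ravg_le; auto. intros; apply continuous_const.
Qed.

(** The mean of $|h - P|^2$ is nonnegative, $P$ being the partial sum of [a]; the hypothesis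
    says that the cross terms are those of an orthogonal projection. *)
Lemma bessel h a r N : ccont h ->
  (forall k, avg (fun t => h t * Cconj (polar r t ^ k))%C = (a k * RtoC (r ^ (2 * k)))%C) ->
  rsum (fun k => Cmod (a k) ^ 2 * r ^ (2 * k)) N <= ravg (fun t => Cmod (h t) ^ 2).
Proof.
  intros Hh Ha. set (P := fun t => ps a (polar r t) N).
  assert (cP : ccont P) by apply ps_cat_circle.
  assert (cD : ccont (fun t => h t - P t)%C) by (intros t; apply cat_minus; auto).
  set (S := rsum (fun k => Cmod (a k) ^ 2 * r ^ (2 * k)) N).
  assert (X : avg (fun t => h t * Cconj (P t))%C = RtoC S).
  { unfold P. rewrite avg_mul_conj_ps by auto. unfold S. rewrite <- csum_coef_conj.
    apply csum_ext. intros k _. rewrite Ha. reflexivity. }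
  assert (cX : ccont (fun t => h t * Cconj (P t))%C).
  { intros t. apply cat_mult; auto. apply cat_conj, cP. }
  assert (X' : avg (fun t => Cconj (h t * Cconj (P t)))%C = RtoC S).
  { rewrite avg_conj, X by auto. apply injective_projections; simpl; ring. }
  assert (N0 : 0 <= ravg (fun t => Cmod (h t - P t) ^ 2)).
  { apply ravg_nonneg; [apply (ccont_sq _ cD)|intros; apply pow2_ge_0]. }
  assert (E : RtoC (ravg (fun t => Cmod (h t - P t) ^ 2)%R) =
    (RtoC (ravg (fun t => Cmod (h t) ^ 2)%R) - RtoC S - RtoC S + RtoC S)%C).
  { assert (PS : RtoC S = avg (fun t => RtoC (Cmod (P t) ^ 2))).
    { rewrite ravg_avg by (apply ccont_sq, cP). f_equal. symmetry. apply parseval. }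
    rewrite PS at 3. rewrite <- X at 1. rewrite <- X'.
    rewrite <- !ravg_avg by (apply ccont_sq; auto).
    assert (c1 : ccont (fun t => RtoC (Cmod (h t) ^ 2))) by (intros t; apply cat_Cmod2, Hh).
    assert (c2 : ccont (fun t => RtoC (Cmod (P t) ^ 2))) by (intros t; apply cat_Cmod2, cP).
    assert (c3 : ccont (fun t => Cconj (h t * Cconj (P t)))%C) by (intros t; apply cat_conj, cX).
    rewrite <- !avg_minus, <- avg_plus; auto.
    - apply avg_ext. intros t. rewrite !Cmod2_conj, Cminus_conj, Cmult_conj, Cconj_conj. ring.
    - intros t. apply cat_minus; auto. apply cat_minus; auto.
    - intros t. apply cat_minus; auto. }
  assert (E2 : ravg (fun t => Cmod (h t - P t) ^ 2) = ravg (fun t => Cmod (h t) ^ 2) - S).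
  { apply RtoC_inj. rewrite E, RtoC_minus. ring. }
  lra.
Qed.

Lemma coef_bessel f r N : (forall z, Cmod z < 1 -> cdif f z) -> 0 < r < 1 ->
  rsum (fun k => Cmod (coef f k) ^ 2 * r ^ (2 * k)) N <= ravg (fun t => Cmod (f (polar r t)) ^ 2).
Proof.
  intros Hf Hr.
  assert (cf : ccont (fun t => f (polar r t))).
  { apply ccont_circle. intros t. apply cdif_cat, Hf. rewrite Cmod_polar; lra. }
  apply bessel; auto. intros k.
  rewrite <- (acoef_radius f r k) by auto. unfold acoef.
  rewrite Cmult_comm, <- avg_scal.
  2: { intros t. apply cat_mult; auto. apply cat_inv; [apply cat_pow, polar_cat_t|].
       apply Cpow_nz, polar_neq_0; lra. }
  apply avg_ext. intros t.
  assert (N0 := Cpow_nz _ k (polar_neq_0 r t (proj1 Hr))).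
  assert (E := Cmod2_conj (polar r t ^ k)).
  rewrite Cmod_pow, Cmod_polar in E by lra. rewrite <- pow_mult, Nat.mul_comm in E.
  rewrite E. field. auto.
Qed.

(** Square-summable sequences, with the square of the norm at most [M]. *)
Definition l2b (a : nat -> C) (M : R) : Prop := forall N, rsum (fun k => Cmod (a k) ^ 2) N <= M.

Lemma l2b_coef_bound a M k : l2b a M -> Cmod (a k) ^ 2 <= M.
Proof.
  intros H. eapply Rle_trans; [|apply (H (S k))].
  apply (rsum_term_le (fun k => Cmod (a k) ^ 2)); [intros; apply pow2_ge_0|lia].
Qed.

Lemma rsum_cont_radius (c : nat -> R) N : 
  continuous (fun r => rsum (fun k => c k * r ^ (2 * k)) N) 1.
Proof.
  induction N as [|N IH]; simpl; [apply continuous_const|].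
  apply (continuous_plus (V := R_NormedModule)); auto.
  apply (continuous_mult (K := R_AbsRing)); [apply continuous_const|].
  apply continuity_pt_filterlim. apply derivable_continuous_pt, derivable_pt_pow.
Qed.

Lemma rsum_radius_limit (c : nat -> R) N M :
  (forall r, 0 < r < 1 -> rsum (fun k => c k * r ^ (2 * k)) N <= M) -> rsum c N <= M.
Proof.
  intros H. apply le_epsilon. intros eps He.
  assert (Hc := continuous_cat_R _ _ (rsum_cont_radius c N)).
  destruct (Hc eps He) as [d [Hd D]].
  set (r := 1 - Rmin d 1 / 2).
  assert (m1 : 0 < Rmin d 1) by (apply Rmin_pos; lra).
  assert (m2 := Rmin_l d 1). assert (m3 := Rmin_r d 1).
  assert (Hr : 0 < r < 1) by (unfold r; lra).
  assert (K : Rd 1 r < d) by (unfold Rd, r; rewrite Rabs_left; lra).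
  specialize (D r K). rewrite <- RtoC_minus, Cmod_R in D. apply Rabs_def2 in D.
  assert (E : rsum (fun k => c k * 1 ^ (2 * k)) N = rsum c N).
  { apply rsum_ext. intros. rewrite pow1. ring. }
  rewrite E in D. specialize (H r Hr). lra.
Qed.

(** ** Quadratic means *)

Lemma mean2_sq f r : mean2 f r = sqrt (ravg (fun t => Cmod (f (polar r t)) ^ 2)).
Proof. reflexivity. Qed.

Lemma mean2_le f r M : 0 <= M -> 
  ravg (fun t => Cmod (f (polar r t)) ^ 2) <= M ^ 2 -> mean2 f r <= M.
Proof.
  intros HM H. rewrite mean2_sq, <- (sqrt_pow2 M HM). apply sqrt_le_1_alt, H.
Qed.

Lemma mean2_ge f r M : (forall z, Cmod z < 1 -> cat Cd f z) -> 0 <= r < 1 -> mean2 f r <= M ->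
  ravg (fun t => Cmod (f (polar r t)) ^ 2) <= M ^ 2.
Proof.
  intros Hf Hr H. rewrite mean2_sq in H.
  set (X := ravg (fun t => Cmod (f (polar r t)) ^ 2)) in *.
  assert (HX : 0 <= X).
  { apply ravg_nonneg; [|intros; apply pow2_ge_0]. apply ccont_sq, ccont_circle.
    intros t. apply Hf. rewrite Cmod_polar; lra. }
  rewrite <- (sqrt_sqrt X HX). assert (P := sqrt_pos X). simpl. rewrite Rmult_1_r.
  apply Rmult_le_compat; auto.
Qed.

Lemma coef_l2b f M : (forall z, Cmod z < 1 -> cdif f z) ->
  (forall r, 0 <= r < 1 -> mean2 f r <= M) -> l2b (coef f) (M ^ 2).
Proof.
  intros Hf HM N. apply rsum_radius_limit. intros r Hr.
  eapply Rle_trans; [apply coef_bessel; auto|]. apply mean2_ge; try lra.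
  - intros; apply cdif_cat; auto.
  - apply HM. lra.
Qed.

Lemma sq_close (a b : C) eta X : Cmod (a - b) <= eta -> Cmod b <= X -> 0 <= eta ->
  Cmod a ^ 2 <= Cmod b ^ 2 + eta * (2 * X + eta).
Proof.
  intros H1 H2 He. assert (T := Cmod_triangle (a - b) b).
  replace (a - b + b)%C with a in T by ring.
  assert (P1 := Cmod_ge_0 a). assert (P2 := Cmod_ge_0 b).
  assert (Cmod a <= Cmod b + eta) by lra.
  assert (Cmod a ^ 2 <= (Cmod b + eta) ^ 2) by (apply pow_incr; lra).
  assert (eta * Cmod b <= eta * X) by (apply Rmult_le_compat_l; auto).
  nra.
Qed.

Lemma ravg_sq_close h g eta X : ccont h -> ccont g ->
  (forall t, 0 <= t <= 2 * PI -> Cmod (h t - g t) <= eta) ->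
  (forall t, 0 <= t <= 2 * PI -> Cmod (g t) <= X) -> 0 <= eta ->
  ravg (fun t => Cmod (h t) ^ 2) <= ravg (fun t => Cmod (g t) ^ 2) + eta * (2 * X + eta).
Proof.
  intros Hh Hg H1 H2 He.
  rewrite <- (ravg_const (eta * (2 * X + eta))) at 1.
  assert (c1 := ccont_sq _ Hh). assert (c2 := ccont_sq _ Hg).
  rewrite <- ravg_plus by (auto; intros; apply continuous_const).
  apply ravg_le; auto.
  - intros t. apply (continuous_plus (V := R_NormedModule)); auto. apply continuous_const.
  - intros t Ht. apply sq_close; auto.
Qed.

Lemma ravg_sq_limit h X M : ccont h -> 
  (forall t, 0 <= t <= 2 * PI -> Cmod (h t) <= X) ->
  (forall eta, 0 < eta -> exists g, ccont g /\
     (forall t, 0 <= t <= 2 * PI -> Cmod (h t - g t) <= eta) /\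
     ravg (fun t => Cmod (g t) ^ 2) <= M) ->
  ravg (fun t => Cmod (h t) ^ 2) <= M.
Proof.
  intros Hh HX H. assert (X0 : 0 <= X).
  { eapply Rle_trans; [apply Cmod_ge_0|apply (HX 0)]. assert (P := two_pi_pos). lra. }
  apply le_epsilon. intros eps He.
  set (eta := Rmin 1 (eps / (2 * X + 3))).
  assert (E0 : 0 < eps / (2 * X + 3)) by (apply Rdiv_lt_0_compat; lra).
  assert (e0 : 0 < eta) by (apply Rmin_pos; lra).
  assert (e1 : eta <= 1) by apply Rmin_l.
  assert (e2 : eta * (2 * X + 3) <= eps).
  { apply Rle_trans with (eps / (2 * X + 3) * (2 * X + 3)).
    - apply Rmult_le_compat_r; [lra|apply Rmin_r].
    - right. field. lra. }
  destruct (H eta e0) as [g [Hg [G1 G2]]].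
  eapply Rle_trans; [apply (ravg_sq_close h g eta (X + 1)); auto; try lra|].
  - intros t Ht. assert (T := Cmod_triangle (h t) (g t - h t)).
    replace (h t + (g t - h t))%C with (g t) in T by ring.
    rewrite Cmod_minus_sym in T. specialize (G1 t Ht). specialize (HX t Ht). rewrite Cmod_minus_sym in T.
    rewrite (Cmod_minus_sym (g t)) in T. lra.
  - nra.
Qed.

Lemma ps_cat_tail a M s z x n m : 0 <= s -> 0 <= M ->
  (forall k, Cmod (a k) <= M * s ^ k) -> Cmod z * s <= x -> 0 <= x < 1 -> 
  Cmod (ps a z (n + m) - ps a z n) <= M * x ^ n / (1 - x).
Proof.
  intros Hs HM Ha Hz Hx. unfold ps. rewrite csum_shift.
  match goal with |- Cmod (?u + ?v - ?u) <= _ => replace (u + v - u)%C with v by ring end.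
  eapply Rle_trans; [apply Cmod_csum|].
  apply Rle_trans with (rsum (fun k => M * x ^ n * x ^ k) m).
  - apply rsum_le. intros k _. rewrite Cmod_mult, Cmod_pow.
    apply Rle_trans with (M * s ^ (n + k) * Cmod z ^ (n + k)).
    + apply Rmult_le_compat_r; [apply pow_le, Cmod_ge_0|apply Ha].
    + rewrite Rmult_assoc, <- Rpow_mult_distr, Rmult_assoc, <- pow_add.
      apply Rmult_le_compat_l; auto. apply pow_incr. split; [|lra].
      apply Rmult_le_pos; [auto|apply Cmod_ge_0].
  - rewrite rsum_scal. unfold Rdiv. apply Rmult_le_compat_l; [|apply rsum_geom_le; auto].
    apply Rmult_le_pos; auto. apply pow_le. lra.
Qed.

Definition psum (a : nat -> C) (z l : C) : Prop :=
  forall eps, 0 < eps -> exists N, forall n, (N <= n)%nat -> Cmod (ps a z n - l) < eps.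

Lemma psum_tail a M s z x n l : 0 <= s -> 0 <= M ->
  (forall k, Cmod (a k) <= M * s ^ k) -> Cmod z * s <= x -> 0 <= x < 1 -> psum a z l ->
  Cmod (l - ps a z n) <= M * x ^ n / (1 - x).
Proof.
  intros Hs HM Ha Hz Hx Hl. apply le_epsilon. intros eps He.
  destruct (Hl eps He) as [N HN]. specialize (HN (n + N)%nat ltac:(lia)).
  assert (T := ps_cat_tail a M s z x n N Hs HM Ha Hz Hx).
  replace (l - ps a z n)%C with (- (ps a z (n + N) - l) + (ps a z (n + N) - ps a z n))%C by ring.
  eapply Rle_trans; [apply Cmod_triangle|]. rewrite Cmod_opp. lra.
Qed.

Lemma coef_bound f r : (forall z, Cmod z < 1 -> cdif f z) -> 0 < r < 1 ->
  exists M, 0 <= M /\ forall k, Cmod (coef f k) <= M * (/ r) ^ k.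
Proof.
  intros Hf Hr.
  assert (cf : ccont (fun t => f (polar r t))).
  { apply ccont_circle. intros t. apply cdif_cat, Hf. rewrite Cmod_polar; lra. }
  destruct (ccont_bounded _ cf) as [M [M0 HM]]. exists M. split; auto. intros k.
  rewrite <- (acoef_radius f r k) by auto. apply avg_bound.
  - intros t. apply cat_mult; auto. apply cat_inv; [apply cat_pow, polar_cat_t|].
    apply Cpow_nz, polar_neq_0; lra.
  - intros t Ht. rewrite Cmod_mult, Cmod_inv, Cmod_pow, Cmod_polar, pow_inv by
      (try lra; apply Cpow_nz, polar_neq_0; lra).
    apply Rmult_le_compat_r; auto. left. apply Rinv_0_lt_compat, pow_lt. lra.
Qed.

(** Parseval on the smaller circle, where the Taylor series converges uniformly, and Bessel
    on the larger one. *)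
Lemma ravg_sq_mono G r s : (forall z, Cmod z < 1 -> cdif G z) -> 0 <= r < s -> s < 1 ->
  ravg (fun t => Cmod (G (polar r t)) ^ 2) <= ravg (fun t => Cmod (G (polar s t)) ^ 2).
Proof.
  intros HG Hr Hs.
  assert (cG : forall u, 0 <= u < 1 -> ccont (fun t => G (polar u t))).
  { intros u Hu. apply ccont_circle. intros t. apply cdif_cat, HG. rewrite Cmod_polar; lra. }
  destruct (ccont_bounded _ (cG r ltac:(lra))) as [X [_ HX]].
  destruct (coef_bound G s HG ltac:(lra)) as [M [M0 HM]].
  assert (His : 0 < / s) by (apply Rinv_0_lt_compat; lra).
  assert (x1 : r * / s < 1).
  { apply Rmult_lt_reg_r with s; [lra|]. rewrite Rmult_assoc, Rinv_l; lra. }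
  assert (x0 : 0 <= r * / s) by (apply Rmult_le_pos; lra).
  apply (ravg_sq_limit _ X); auto; [apply cG; lra|].
  intros eta He. 
  destruct (geom_small (r * / s) (M / (1 - r * / s)) eta ltac:(lra)) as [N HN]; auto.
  { apply Rmult_le_pos; [lra|left; apply Rinv_0_lt_compat; lra]. }
  exists (fun t => ps (coef G) (polar r t) N). split; [apply ps_cat_circle|]. split.
  - intros t Ht. specialize (HN N (le_n _)).
    eapply Rle_trans; [apply (psum_tail (coef G) M (/ s) _ (r * / s))|]; auto; try lra.
    + rewrite Cmod_polar; lra.
    + intros e Hee. apply taylor_series; auto. rewrite Cmod_polar; lra.
  - rewrite parseval. eapply Rle_trans; [|apply (coef_bessel G s N); auto; lra].
    apply rsum_le. intros k _. apply Rmult_le_compat_l; [apply pow2_ge_0|].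
    apply pow_incr. lra.
Qed.

(** Uniform continuity up to the boundary lets the larger circle of [ravg_sq_mono] tend to the
    unit circle. *)
Theorem ravg_sq_boundary G r : (forall z, Cmod z < 1 -> cdif G z) -> (forall z, cat Cd G z) ->
  0 <= r < 1 ->
  ravg (fun t => Cmod (G (polar r t)) ^ 2) <= ravg (fun t => Cmod (G (polar 1 t)) ^ 2).
Proof.
  intros HG HC Hr.
  assert (cG : forall u, ccont (fun t => G (polar u t))) by (intros u; apply ccont_circle; auto).
  destruct (ccont_bounded _ (cG 1)) as [X [X0 HX]].
  apply le_epsilon. intros eps He.
  set (eta := Rmin 1 (eps / (2 * X + 1))).
  assert (E0 : 0 < eps / (2 * X + 1)) by (apply Rdiv_lt_0_compat; lra).
  assert (e0 : 0 < eta) by (apply Rmin_pos; lra).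
  assert (e1 : eta <= 1) by apply Rmin_l.
  assert (e2 : eta * (2 * X + 1) <= eps).
  { apply Rle_trans with (eps / (2 * X + 1) * (2 * X + 1)).
    - apply Rmult_le_compat_r; [lra|apply Rmin_r].
    - right. field. lra. }
  destruct (uniform_on_circle G 1 (fun t => HC _) eta e0) as [d [Hd D]].
  set (s := 1 - Rmin d (1 - r) / 2).
  assert (m1 : 0 < Rmin d (1 - r)) by (apply Rmin_pos; lra).
  assert (m2 := Rmin_l d (1 - r)). assert (m3 := Rmin_r d (1 - r)).
  assert (Hs : r < s < 1) by (unfold s; lra).
  eapply Rle_trans; [apply (ravg_sq_mono G r s); auto; lra|].
  eapply Rle_trans; [apply (ravg_sq_close _ (fun t => G (polar 1 t)) eta X); auto; try lra|].
  - intros t Ht. left. apply D; auto. unfold s. rewrite Rabs_left; lra.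
  - nra.
Qed.

(** * Dividing by Blaschke factors in the space of square-summable sequences *)

Definition clim (s : nat -> C) : C :=
  (real (Lim_seq (fun n => Re (s n))), real (Lim_seq (fun n => Im (s n)))).

Lemma clim_correct s :
  (forall eps, 0 < eps -> exists N, forall n m, (N <= n)%nat -> (N <= m)%nat ->
     Cmod (s n - s m) < eps) ->
  forall eps, 0 < eps -> exists N, forall n, (N <= n)%nat -> Cmod (s n - clim s) < eps.
Proof.
  intros H.
  assert (G : forall p : C -> R, (forall c, Rabs (p c) <= Cmod c) ->
    (forall a b, p (a - b)%C = p a - p b) ->
    is_lim_seq (fun n => p (s n)) (real (Lim_seq (fun n => p (s n))))).
  { intros p Hp Hl. apply Lim_seq_correct', ex_lim_seq_cauchy_corr. intros eps.
    destruct (H eps (cond_pos eps)) as [N HN]. exists N. intros n m Hn Hm.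
    rewrite <- Hl. eapply Rle_lt_trans; [apply Hp|]. apply HN; lia. }
  intros eps He.
  assert (G1 := G Re re_le_Cmod (fun a b => eq_refl)).
  assert (G2 := G Im (fun c => Rle_trans _ _ _ (Rmax_r _ _) (Rmax_Cmod c)) (fun a b => eq_refl)).
  apply is_lim_seq_spec in G1. apply is_lim_seq_spec in G2.
  destruct (G1 (mkposreal (eps / 2) ltac:(lra))) as [N1 H1].
  destruct (G2 (mkposreal (eps / 2) ltac:(lra))) as [N2 H2].
  exists (Nat.max N1 N2). intros n Hn.
  specialize (H1 n ltac:(lia)). specialize (H2 n ltac:(lia)). simpl in H1, H2.
  eapply Rle_lt_trans; [apply (Cmod_pair_le (Re (s n) - Re (clim s)) (Im (s n) - Im (clim s)))|].
  simpl. lra.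
Qed.

Definition ps_value (a : nat -> C) (z : C) : C := clim (ps a z).

Definition bdd (a : nat -> C) : Prop := exists M, 0 <= M /\ forall k, Cmod (a k) <= M.

Definition shift (m : nat) (a : nat -> C) : nat -> C := fun k => a (m + k)%nat.

Lemma ps_value_correct a z : bdd a -> Cmod z < 1 -> psum a z (ps_value a z).
Proof.
  intros [M [M0 HM]] Hz. refine (clim_correct (ps a z) _).
  assert (Hz0 := Cmod_ge_0 z).
  assert (T : forall n m, Cmod (ps a z (n + m) - ps a z n) <= M * Cmod z ^ n / (1 - Cmod z)).
  { intros n m. apply ps_cat_tail with 1; auto; try lra.
    intros k. rewrite pow1, Rmult_1_r. auto. }
  intros eps He.
  destruct (geom_small (Cmod z) (M / (1 - Cmod z)) (eps / 2) ltac:(lra)) as [N HN]; [|lra|].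
  { apply Rmult_le_pos; [lra|left; apply Rinv_0_lt_compat; lra]. }
  specialize (HN N (le_n _)).
  assert (K : forall n, (N <= n)%nat -> Cmod (ps a z n - ps a z N) < eps / 2).
  { intros n Hn. replace n with (N + (n - N))%nat by lia. eapply Rle_lt_trans; [apply T|].
    unfold Rdiv in *. lra. }
  exists N. intros n m Hn Hm.
  replace (ps a z n - ps a z m)%C with ((ps a z n - ps a z N) + - (ps a z m - ps a z N))%C by ring.
  eapply Rle_lt_trans; [apply Cmod_triangle|]. rewrite Cmod_opp.
  specialize (K n Hn) as K1. specialize (K m Hm) as K2. lra.
Qed.

Lemma psum_unique a z l l' : psum a z l -> psum a z l' -> l = l'.
Proof.
  intros H1 H2. assert (Z : Cmod (l - l') = 0).
  { apply Rle_antisym; [|apply Cmod_ge_0]. apply le_epsilon. intros eps He.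
    destruct (H1 (eps / 2) ltac:(lra)) as [N1 A1]. destruct (H2 (eps / 2) ltac:(lra)) as [N2 A2].
    specialize (A1 (N1 + N2)%nat ltac:(lia)). specialize (A2 (N1 + N2)%nat ltac:(lia)).
    replace (l - l')%C with (- (ps a z (N1 + N2) - l) + (ps a z (N1 + N2) - l'))%C by ring.
    eapply Rle_trans; [apply Cmod_triangle|]. rewrite Cmod_opp. lra. }
  apply Cmod_eq_0 in Z. replace l with (l - l' + l')%C by ring. rewrite Z. ring.
Qed.

Lemma psum_lin a b c z l l' : psum a z l -> psum b z l' ->
  psum (fun k => a k + c * b k)%C z (l + c * l')%C.
Proof.
  intros H1 H2 eps He. assert (Hc := Cmod_ge_0 c).
  set (e := eps / (2 + Cmod c)).
  assert (He' : 0 < e) by (apply Rdiv_lt_0_compat; lra).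
  destruct (H1 e He') as [N1 A1]. destruct (H2 e He') as [N2 A2].
  exists (N1 + N2)%nat. intros n Hn. specialize (A1 n ltac:(lia)). specialize (A2 n ltac:(lia)).
  replace (ps (fun k => a k + c * b k)%C z n) with (ps a z n + c * ps b z n)%C.
  - replace (ps a z n + c * ps b z n - (l + c * l'))%C
      with ((ps a z n - l) + c * (ps b z n - l'))%C by ring.
    eapply Rle_lt_trans; [apply Cmod_triangle|]. rewrite Cmod_mult.
    apply Rlt_le_trans with (e + (1 + Cmod c) * e).
    + assert (Cmod c * Cmod (ps b z n - l') <= Cmod c * e) by (apply Rmult_le_compat_l; lra). lra.
    + right. unfold e. field. lra.
  - unfold ps. rewrite <- csum_scal, <- csum_plus. apply csum_ext. intros; ring.
Qed.

Lemma ps_value_lin a b c z : bdd a -> bdd b -> Cmod z < 1 ->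
  ps_value (fun k => a k + c * b k)%C z = (ps_value a z + c * ps_value b z)%C.
Proof.
  intros Ha Hb Hz. apply psum_unique with (fun k => a k + c * b k)%C z.
  - apply ps_value_correct; auto. destruct Ha as [M [M0 HM]], Hb as [M' [M0' HM']].
    assert (Hc := Cmod_ge_0 c). exists (M + Cmod c * M'). split.
    + assert (0 <= Cmod c * M') by (apply Rmult_le_pos; auto). lra.
    + intros k. eapply Rle_trans; [apply Cmod_triangle|]. rewrite Cmod_mult.
      specialize (HM k). assert (Cmod c * Cmod (b k) <= Cmod c * M') by (apply Rmult_le_compat_l; auto). lra.
  - apply psum_lin; apply ps_value_correct; auto.
Qed.

Lemma bdd_shift a m : bdd a -> bdd (shift m a).
Proof. intros [M [M0 HM]]. exists M. split; auto. intros; apply HM. Qed.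

Lemma ps_S a z n : ps a z (S n) = (a O + z * ps (shift 1 a) z n)%C.
Proof.
  unfold ps. rewrite <- csum_scal. replace (S n) with (1 + n)%nat by lia. rewrite csum_shift.
  simpl csum at 1. rewrite (csum_ext _ (fun k => z * (shift 1 a k * z ^ k))%C).
  - simpl. ring.
  - intros k _. unfold shift. simpl. ring.
Qed.

Lemma ps_value_shift a z : bdd a -> Cmod z < 1 -> ps_value a z = (a O + z * ps_value (shift 1 a) z)%C.
Proof.
  intros Ha Hz. apply psum_unique with a z; [apply ps_value_correct; auto|].
  intros eps He. destruct (ps_value_correct (shift 1 a) z (bdd_shift _ _ Ha) Hz eps He) as [N HN].
  exists (S N). intros n Hn. destruct n as [|n]; [lia|]. specialize (HN n ltac:(lia)).
  rewrite ps_S.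
  replace (a O + z * ps (shift 1 a) z n - (a O + z * ps_value (shift 1 a) z))%C
    with (z * (ps (shift 1 a) z n - ps_value (shift 1 a) z))%C by ring.
  rewrite Cmod_mult. assert (H1 := Cmod_ge_0 (ps (shift 1 a) z n - ps_value (shift 1 a) z)).
  assert (H2 := Cmod_ge_0 z). nra.
Qed.

Lemma l2b_bdd a M : l2b a M -> bdd a.
Proof.
  intros H. exists (sqrt M). split; [apply sqrt_pos|]. intros k.
  rewrite <- (sqrt_pow2 (Cmod (a k))) by apply Cmod_ge_0.
  apply sqrt_le_1_alt, l2b_coef_bound, H.
Qed.

Lemma l2b_shift a M m : l2b a M -> l2b (shift m a) (M - rsum (fun k => Cmod (a k) ^ 2) m).
Proof.
  intros H N. specialize (H (m + N)%nat). rewrite rsum_shift in H.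
  change (rsum (fun k => Cmod (shift m a k) ^ 2) N)
    with (rsum (fun k => Cmod (a (m + k)%nat) ^ 2) N). lra.
Qed.

Lemma cauchy_schwarz (x y : nat -> R) n :
  (rsum (fun k => x k * y k) n) ^ 2 <= rsum (fun k => x k ^ 2) n * rsum (fun k => y k ^ 2) n.
Proof.
  induction n as [|n IH]; cbn [rsum]; [lra|].
  set (S := rsum (fun k => x k * y k) n) in *. set (A := rsum (fun k => x k ^ 2) n) in *.
  set (B := rsum (fun k => y k ^ 2) n) in *. set (u := x n). set (v := y n).
  assert (A0 : 0 <= A) by (apply rsum_nonneg; intros; apply pow2_ge_0).
  assert (B0 : 0 <= B) by (apply rsum_nonneg; intros; apply pow2_ge_0).
  assert (Q : 2 * S * (u * v) <= A * v ^ 2 + B * u ^ 2).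
  { assert (Q0 : 0 <= A * v ^ 2 + B * u ^ 2).
    { assert (P1 := pow2_ge_0 u). assert (P2 := pow2_ge_0 v). nra. }
    assert (Q1 : Rsqr (2 * S * (u * v)) <= Rsqr (A * v ^ 2 + B * u ^ 2)).
    { unfold Rsqr. assert (P1 := pow2_ge_0 (A * v ^ 2 - B * u ^ 2)).
      assert (P2 : S ^ 2 * (u * v) ^ 2 <= A * B * (u * v) ^ 2)
        by (apply Rmult_le_compat_r; [apply pow2_ge_0|auto]).
      nra. }
    apply Rsqr_le_abs_0 in Q1. rewrite (Rabs_pos_eq (A * v ^ 2 + B * u ^ 2)) in Q1 by auto.
    eapply Rle_trans; [apply Rle_abs|exact Q1]. }
  nra.
Qed.

(** Cauchy-Schwarz against the geometric series. *)
Lemma ps_value_bound a M z : l2b a M -> Cmod z < 1 -> (1 - Cmod z ^ 2) * Cmod (ps_value a z) ^ 2 <= M.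
Proof.
  intros H Hz. assert (Hz0 := Cmod_ge_0 z).
  assert (Hz2 : 0 <= Cmod z ^ 2 < 1) by (split; [apply pow2_ge_0|nra]).
  assert (M0 : 0 <= M) by (apply (H O)).
  set (K := M / (1 - Cmod z ^ 2)).
  assert (P : forall n, Cmod (ps a z n) ^ 2 <= K).
  { intros n. apply Rle_trans with (rsum (fun k => Cmod (a k) * Cmod z ^ k) n ^ 2).
    - apply pow_incr. split; [apply Cmod_ge_0|]. eapply Rle_trans; [apply Cmod_csum|].
      right. apply rsum_ext. intros. rewrite Cmod_mult, Cmod_pow. reflexivity.
    - eapply Rle_trans; [apply cauchy_schwarz|]. unfold K, Rdiv.
      apply Rmult_le_compat; [apply rsum_nonneg; intros; apply pow2_ge_0
        |apply rsum_nonneg; intros; apply pow2_ge_0|apply H|].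
      rewrite (rsum_ext _ (fun k => (Cmod z ^ 2) ^ k)).
      + apply rsum_geom_le. auto.
      + intros. rewrite <- !pow_mult. f_equal. lia. }
  assert (K0 : 0 <= K) by (eapply Rle_trans; [|apply (P O)]; apply pow2_ge_0).
  assert (E : Cmod (ps_value a z) <= sqrt K).
  { apply le_epsilon. intros eps He. destruct (ps_value_correct a z (l2b_bdd _ _ H) Hz eps He) as [N HN].
    specialize (HN N (le_n _)). specialize (P N).
    assert (S1 : Cmod (ps a z N) <= sqrt K).
    { rewrite <- (sqrt_pow2 (Cmod (ps a z N))) by apply Cmod_ge_0. apply sqrt_le_1_alt, P. }
    replace (ps_value a z) with (ps a z N + - (ps a z N - ps_value a z))%C by ring.
    eapply Rle_trans; [apply Cmod_triangle|]. rewrite Cmod_opp. lra. }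
  assert (E2 : Cmod (ps_value a z) ^ 2 <= K).
  { replace K with (sqrt K ^ 2) by (simpl; rewrite Rmult_1_r; apply sqrt_sqrt; auto).
    apply pow_incr. split; [apply Cmod_ge_0|auto]. }
  replace M with ((1 - Cmod z ^ 2) * K) by (unfold K; field; lra).
  apply Rmult_le_compat_l; lra.
Qed.

(** ** One zero *)

(** The coefficients of $(1 - a L)^{-1} f$, where $L$ is the backward shift; [divide] applies
    $L - \bar a$ to them. *)
Definition tails (a : C) (f : nat -> C) (m : nat) : C := ps_value (shift m f) a.

(** The adjoint of multiplication by the Blaschke factor with zero [a], on coefficients. *)
Definition divide (a : C) (f : nat -> C) (m : nat) : C :=
  (tails a f (S m) - Cconj a * tails a f m)%C.

Definition blaschke (a z : C) : C := ((z - a) / (1 - Cconj a * z))%C.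

(** The reproducing kernel at [a], scaled to take the value $1$ there. *)
Definition kern (a z : C) : C := (RtoC (1 - Cmod a ^ 2) / (1 - Cconj a * z))%C.

Lemma tails_rec a f m : bdd f -> Cmod a < 1 -> tails a f m = (f m + a * tails a f (S m))%C.
Proof.
  intros Hf Ha. unfold tails. rewrite ps_value_shift; auto using bdd_shift.
  f_equal; [unfold shift; f_equal; lia|]. do 2 f_equal.
  apply functional_extensionality. intros k. unfold shift. f_equal. lia.
Qed.

Lemma Cmod2_minus_mult (a u v : C) :
  Cmod (v - Cconj a * u) ^ 2 - Cmod (u - a * v) ^ 2
  = (1 - Cmod a ^ 2) * (Cmod v ^ 2 - Cmod u ^ 2).
Proof. rewrite !Cmod2_alt. destruct a, u, v. simpl. ring. Qed.

(** The difference between the partial sums of squares telescopes to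
    $(1-|a|^2)(|u_N|^2-|u_0|^2)$, where $u_m$ are the tails, and the term $|u_N|^2$ is
    controlled by the part of [f] that has not been summed. *)
Lemma divide_l2b a f M : l2b f M -> Cmod a < 1 -> l2b (divide a f) M.
Proof.
  intros Hf Ha N. assert (Hb := l2b_bdd _ _ Hf). assert (Ha0 := Cmod_ge_0 a).
  set (k := 1 - Cmod a ^ 2). assert (Hk : 0 < k) by (unfold k; nra).
  assert (T : forall N, rsum (fun m => Cmod (divide a f m) ^ 2) N =
    rsum (fun m => Cmod (f m) ^ 2) N + k * (Cmod (tails a f N) ^ 2 - Cmod (tails a f O) ^ 2)).
  { intros n. induction n as [|n IH]; cbn [rsum]; [ring|]. rewrite IH.
    assert (E := Cmod2_minus_mult a (tails a f n) (tails a f (S n))).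
    assert (E2 := tails_rec a f n Hb Ha).
    replace (tails a f n - a * tails a f (S n))%C with (f n) in E by (rewrite E2 at 1; ring).
    unfold divide at 1. fold k in E. lra. }
  rewrite T. assert (B := ps_value_bound _ _ a (l2b_shift _ _ N Hf) Ha).
  fold (tails a f N) k in B. assert (P := pow2_ge_0 (Cmod (tails a f O))). nra.
Qed.

Lemma den_neq_0 a z : Cmod a < 1 -> Cmod z <= 1 -> (1 - Cconj a * z)%C <> RtoC 0.
Proof.
  intros Ha Hz E. assert (T := Cmod_triangle (1 - Cconj a * z) (Cconj a * z)).
  replace (1 - Cconj a * z + Cconj a * z)%C with (RtoC 1) in T by ring.
  rewrite E, Cmod_0, Cmod_1, Cmod_mult, Cmod_conj in T.
  assert (A0 := Cmod_ge_0 a). assert (Z0 := Cmod_ge_0 z). nra.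
Qed.

(** With $U = \sum u_m z^m$ and $V = \sum u_{m+1} z^m$ the generating functions of the tails,
    both sides are combinations of $V$ and $u_0 = f(a)$, because $U = u_0 + zV$. *)
Lemma divide_identity a f M z : l2b f M -> Cmod a < 1 -> Cmod z < 1 ->
  ps_value f z = (ps_value f a * kern a z + blaschke a z * ps_value (divide a f) z)%C.
Proof.
  intros Hf Ha Hz. assert (Hb := l2b_bdd _ _ Hf).
  set (u := tails a f).
  assert (Hu : bdd u).
  { exists (sqrt (M / (1 - Cmod a ^ 2))). split; [apply sqrt_pos|]. intros k.
    rewrite <- (sqrt_pow2 (Cmod (u k))) by apply Cmod_ge_0. apply sqrt_le_1_alt.
    assert (B := ps_value_bound _ _ a (l2b_shift _ _ k Hf) Ha). fold (tails a f k) (u k) in B.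
    assert (P : 0 <= rsum (fun k => Cmod (f k) ^ 2) k) by (apply rsum_nonneg; intros; apply pow2_ge_0).
    assert (A0 := Cmod_ge_0 a). assert (K : 0 < 1 - Cmod a ^ 2) by nra.
    apply Rmult_le_reg_r with (1 - Cmod a ^ 2); auto. unfold Rdiv. rewrite Rmult_assoc, Rinv_l; lra. }
  assert (Ef : ps_value f z = (ps_value u z + - a * ps_value (shift 1 u) z)%C).
  { rewrite <- ps_value_lin; auto using bdd_shift. f_equal. apply functional_extensionality. intros m.
    unfold shift. simpl. unfold u. rewrite (tails_rec a f m) by auto. ring. }
  assert (Eg : ps_value (divide a f) z = (ps_value (shift 1 u) z + - Cconj a * ps_value u z)%C).
  { rewrite <- ps_value_lin; auto using bdd_shift. f_equal. apply functional_extensionality. intros m.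
    unfold shift, divide. simpl. fold u. ring. }
  assert (EU := ps_value_shift u z Hu Hz).
  assert (E0 : ps_value f a = u O) by reflexivity.
  assert (D := den_neq_0 a z Ha (Rlt_le _ _ Hz)).
  rewrite Ef, Eg, EU, E0. unfold kern, blaschke.
  rewrite RtoC_minus, Cmod2_conj. field. exact D.
Qed.

(** ** Several zeros *)

Fixpoint divide_all (pts : nat -> C) (f : nat -> C) (n : nat) : nat -> C :=
  match n with O => f | S k => divide (pts k) (divide_all pts f k) end.

Fixpoint bprod (pts : nat -> C) (n : nat) (z : C) : C :=
  match n with O => RtoC 1 | S k => (bprod pts k z * blaschke (pts k) z)%C end.

(** The Takenaka-Malmquist functions, up to normalisation. *)
Definition tmf (pts : nat -> C) (i : nat) (z : C) : C := (kern (pts i) z * bprod pts i z)%C.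

Definition tmcoef (pts : nat -> C) (i : nat) (f : nat -> C) : C := ps_value (divide_all pts f i) (pts i).

Lemma divide_all_l2b pts f M n : (forall i, Cmod (pts i) < 1) -> l2b f M -> l2b (divide_all pts f n) M.
Proof. intros Hp Hf. induction n; simpl; auto. apply divide_l2b; auto. Qed.

Lemma tm_expansion pts f M z n : (forall i, Cmod (pts i) < 1) -> l2b f M -> Cmod z < 1 ->
  ps_value f z = (csum (fun i => tmcoef pts i f * tmf pts i z) n + bprod pts n z * ps_value (divide_all pts f n) z)%C.
Proof.
  intros Hp Hf Hz. induction n as [|n IH]; simpl; [ring|].
  rewrite IH, (divide_identity (pts n) (divide_all pts f n) M z); auto using divide_all_l2b.
  unfold tmf, tmcoef. ring.
Qed.

Lemma tails_lin a f g c m : bdd f -> bdd g -> Cmod a < 1 ->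
  tails a (fun k => f k + c * g k)%C m = (tails a f m + c * tails a g m)%C.
Proof. intros Hf Hg Ha. unfold tails. rewrite <- ps_value_lin; auto using bdd_shift. Qed.

Lemma divide_all_lin pts f g c M M' n : (forall i, Cmod (pts i) < 1) -> l2b f M -> l2b g M' ->
  divide_all pts (fun k => f k + c * g k)%C n = (fun k => divide_all pts f n k + c * divide_all pts g n k)%C.
Proof.
  intros Hp Hf Hg. induction n as [|n IH]; simpl; auto. rewrite IH.
  apply functional_extensionality. intros m. unfold divide.
  assert (B1 := l2b_bdd _ _ (divide_all_l2b pts f M n Hp Hf)).
  assert (B2 := l2b_bdd _ _ (divide_all_l2b pts g M' n Hp Hg)).
  rewrite !tails_lin by auto. ring.
Qed.

Lemma tmcoef_lin pts f g c M M' i : (forall i, Cmod (pts i) < 1) -> l2b f M -> l2b g M' ->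
  tmcoef pts i (fun k => f k + c * g k)%C = (tmcoef pts i f + c * tmcoef pts i g)%C.
Proof.
  intros Hp Hf Hg. unfold tmcoef. rewrite (divide_all_lin pts f g c M M'); auto.
  apply ps_value_lin; auto.
  - apply (l2b_bdd _ M), divide_all_l2b; auto.
  - apply (l2b_bdd _ M'), divide_all_l2b; auto.
Qed.

Lemma tmcoef_bound pts f M i : (forall i, Cmod (pts i) < 1) -> l2b f M ->
  Cmod (tmcoef pts i f) <= sqrt (M / (1 - Cmod (pts i) ^ 2)).
Proof.
  intros Hp Hf. assert (B := ps_value_bound _ _ (pts i) (divide_all_l2b pts f M i Hp Hf) (Hp i)).
  fold (tmcoef pts i f) in B. specialize (Hp i). assert (A0 := Cmod_ge_0 (pts i)).
  rewrite <- (sqrt_pow2 (Cmod (tmcoef pts i f))) by apply Cmod_ge_0. apply sqrt_le_1_alt.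
  assert (K : 0 < 1 - Cmod (pts i) ^ 2) by nra.
  apply Rmult_le_reg_r with (1 - Cmod (pts i) ^ 2); auto.
  unfold Rdiv. rewrite Rmult_assoc, Rinv_l; lra.
Qed.

(** ** Size and regularity of Blaschke products on the closed disk *)

Lemma blaschke_sq a z : Cmod a < 1 -> Cmod z <= 1 ->
  Cmod (blaschke a z) ^ 2 = 1 - (1 - Cmod a ^ 2) * (1 - Cmod z ^ 2) / Cmod (1 - Cconj a * z) ^ 2.
Proof.
  intros Ha Hz. assert (D := den_neq_0 a z Ha Hz). unfold blaschke. rewrite Cmod_div by auto.
  assert (P : 0 < Cmod (1 - Cconj a * z)) by (apply Cmod_gt_0; auto).
  assert (E := Cmod2_minus_mult a z 1). 
  replace (z - a * 1)%C with (z - a)%C in E by ring. rewrite Cmod_1 in E.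
  apply Rmult_eq_reg_r with (Cmod (1 - Cconj a * z) ^ 2); [|apply pow_nonzero; lra].
  unfold Rdiv. rewrite Rpow_mult_distr, pow_inv.
  field_simplify; try lra.
Qed.

Lemma blaschke_le_1 a z : Cmod a < 1 -> Cmod z <= 1 -> Cmod (blaschke a z) <= 1.
Proof.
  intros Ha Hz. assert (E := blaschke_sq a z Ha Hz).
  assert (D : 0 < Cmod (1 - Cconj a * z)) by (apply Cmod_gt_0, den_neq_0; auto).
  assert (A0 := Cmod_ge_0 a). assert (Z0 := Cmod_ge_0 z).
  assert (Q : 0 <= (1 - Cmod a ^ 2) * (1 - Cmod z ^ 2) / Cmod (1 - Cconj a * z) ^ 2).
  { apply Rmult_le_pos; [apply Rmult_le_pos; nra|]. left. apply Rinv_0_lt_compat, pow_lt, D. }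
  assert (B0 := Cmod_ge_0 (blaschke a z)). nra.
Qed.

Lemma bprod_le_1 pts n z : (forall i, Cmod (pts i) < 1) -> Cmod z <= 1 -> Cmod (bprod pts n z) <= 1.
Proof.
  intros Hp Hz. induction n as [|n IH]; simpl; [rewrite Cmod_1; lra|]. rewrite Cmod_mult.
  assert (B := blaschke_le_1 (pts n) z (Hp n) Hz).
  assert (B0 := Cmod_ge_0 (blaschke (pts n) z)). assert (B1 := Cmod_ge_0 (bprod pts n z)). nra.
Qed.

Lemma cdif_den a z : cdif (fun y => 1 - Cconj a * y)%C z.
Proof.
  apply cdif_minus; [apply cdif_const|]. apply cdif_mult; [apply cdif_const|apply cdif_id].
Qed.

Lemma blaschke_cdif a z : Cmod a < 1 -> Cmod z <= 1 -> cdif (blaschke a) z.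
Proof.
  intros Ha Hz. apply cdif_mult; [apply cdif_minus; [apply cdif_id|apply cdif_const]|].
  apply cdif_inv; [apply cdif_den|apply den_neq_0; auto].
Qed.

Lemma kern_cdif a z : Cmod a < 1 -> Cmod z <= 1 -> cdif (kern a) z.
Proof.
  intros Ha Hz. apply cdif_mult; [apply cdif_const|].
  apply cdif_inv; [apply cdif_den|apply den_neq_0; auto].
Qed.

Lemma bprod_cdif pts n z : (forall i, Cmod (pts i) < 1) -> Cmod z <= 1 -> cdif (bprod pts n) z.
Proof.
  intros Hp Hz. induction n as [|n IH]; simpl; [apply cdif_const|].
  apply cdif_mult; auto using blaschke_cdif.
Qed.

Lemma tmf_cdif pts i z : (forall i, Cmod (pts i) < 1) -> Cmod z <= 1 -> cdif (tmf pts i) z.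
Proof. intros Hp Hz. apply cdif_mult; auto using kern_cdif, bprod_cdif. Qed.

Lemma kern_bound a z : Cmod a < 1 -> Cmod z <= 1 -> Cmod (kern a z) <= 2.
Proof.
  intros Ha Hz. unfold kern. rewrite Cmod_div by (apply den_neq_0; auto).
  assert (A0 := Cmod_ge_0 a). assert (Z0 := Cmod_ge_0 z).
  rewrite Cmod_R, Rabs_pos_eq by nra.
  assert (T := Cmod_triangle (1 - Cconj a * z) (Cconj a * z)).
  replace (1 - Cconj a * z + Cconj a * z)%C with (RtoC 1) in T by ring.
  rewrite Cmod_1, Cmod_mult, Cmod_conj in T.
  assert (D : 1 - Cmod a <= Cmod (1 - Cconj a * z)) by nra.
  apply Rmult_le_reg_r with (Cmod (1 - Cconj a * z)); [lra|].
  unfold Rdiv. rewrite Rmult_assoc, Rinv_l by lra. nra.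
Qed.

Lemma tmf_bound pts i z : (forall i, Cmod (pts i) < 1) -> Cmod z <= 1 -> Cmod (tmf pts i z) <= 2.
Proof.
  intros Hp Hz. unfold tmf. rewrite Cmod_mult.
  assert (B1 := kern_bound (pts i) z (Hp i) Hz). assert (B2 := bprod_le_1 pts i z Hp Hz).
  assert (B3 := Cmod_ge_0 (kern (pts i) z)). assert (B4 := Cmod_ge_0 (bprod pts i z)). nra.
Qed.

(** The zeros are visited periodically, so that each of [d] periods contributes a factor. *)
Lemma bprod_periodic (q : nat -> C) L d e z beta :
  (forall i, Cmod (q i) < 1) -> Cmod z <= 1 -> (e < L)%nat -> Cmod (blaschke (q e) z) ^ 2 <= beta ->
  Cmod (bprod (fun i => q (i mod L)%nat) (d * L) z) ^ 2 <= beta ^ d.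
Proof.
  intros Hq Hz He Hb. set (pts := fun i => q (i mod L)%nat).
  assert (Hp : forall i, Cmod (pts i) < 1) by (intros; apply Hq).
  assert (Mono : forall n m, Cmod (bprod pts (n + m) z) <= Cmod (bprod pts n z)).
  { intros n m. induction m as [|m IH]; [rewrite Nat.add_0_r; lra|].
    rewrite Nat.add_succ_r. simpl. rewrite Cmod_mult.
    assert (B := blaschke_le_1 (pts (n + m)%nat) z (Hp _) Hz).
    assert (B0 := Cmod_ge_0 (blaschke (pts (n + m)%nat) z)).
    assert (B1 := Cmod_ge_0 (bprod pts (n + m) z)). nra. }
  assert (Hb0 : 0 <= beta) by (eapply Rle_trans; [|exact Hb]; apply pow2_ge_0).
  induction d as [|d IH]; [simpl; rewrite Cmod_1; lra|].
  replace (S d * L)%nat with (d * L + e + 1 + (L - e - 1))%nat by lia.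
  eapply Rle_trans; [apply pow_incr; split; [apply Cmod_ge_0|apply Mono]|].
  rewrite Nat.add_1_r. cbn [bprod]. rewrite Cmod_mult, Rpow_mult_distr.
  replace (pts (d * L + e)%nat) with (q e).
  2: { unfold pts. f_equal. rewrite Nat.add_comm, Nat.Div0.mod_add, Nat.mod_small; auto. }
  change (beta ^ S d) with (beta * beta ^ d). rewrite (Rmult_comm beta).
  apply Rmult_le_compat; try apply pow2_ge_0; auto.
  eapply Rle_trans; [|exact IH]. apply pow_incr. split; [apply Cmod_ge_0|apply Mono].
Qed.

(** * A Hardy-Hilbert inequality for polynomials on the unit interval *)

Definition mean_upto (g : nat -> R) (n : nat) : R := rsum g n / INR n.

(** Hardy's inequality: if $A_n$ is the mean of the first $n$ terms, of which $g_n$ is the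
    last, then $A_n^2 - 2 A_n g_n \le (n-1) A_{n-1}^2 - n A_n^2$, and this telescopes. *)
Lemma hardy g N :
  rsum (fun n => g n * mean_upto g (S n)) N <= 2 * rsum (fun n => g n ^ 2) N.
Proof.
  set (B := mean_upto g).
  assert (EB : forall n, INR n * B n = rsum g n).
  { intros n. unfold B, mean_upto. destruct n as [|n]; [simpl; ring|]. field.
    apply not_0_INR. lia. }
  assert (T : rsum (fun n => B (S n) ^ 2 + - 2 * (g n * B (S n))) N + INR N * B N ^ 2 <= 0).
  { induction N as [|N IH]; [simpl; lra|]. cbn [rsum].
    assert (E1 := EB N). assert (E2 := EB (S N)). cbn [rsum] in E2.
    rewrite S_INR in *. rewrite <- E1 in E2.
    assert (G : g N = (INR N + 1) * B (S N) - INR N * B N) by lra.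
    assert (P := pow2_ge_0 (B (S N) - B N)). assert (N0 := pos_INR N).
    assert (0 <= INR N * (B (S N) - B N) ^ 2) by (apply Rmult_le_pos; auto).
    rewrite G. nra. }
  rewrite rsum_plus, (rsum_scal (- 2)) in T.
  assert (P : 0 <= INR N * B N ^ 2) by (apply Rmult_le_pos; [apply pos_INR|apply pow2_ge_0]).
  assert (Y : rsum (fun n => 2 * (g n * B (S n))) N <=
    rsum (fun n => / 2 * B (S n) ^ 2 + 2 * g n ^ 2) N).
  { apply rsum_le. intros k _. assert (Q := pow2_ge_0 (B (S k) - 2 * g k)). nra. }
  rewrite rsum_plus, !rsum_scal in Y. lra.
Qed.

(** The exponents are shifted by one so that the polynomial vanishes at $0$: composed with
    a tent, it then vanishes outside the support of the tent. *)
Definition rpoly (g : nat -> R) (n : nat) (x : R) : R := rsum (fun k => g k * x ^ S k) n.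

Lemma rpoly_continuous g n x : continuous (rpoly g n) x.
Proof.
  unfold rpoly. induction n as [|n IH]; cbn [rsum]; [apply continuous_const|].
  apply (continuous_plus (V := R_NormedModule)); auto.
  apply (continuous_mult (K := R_AbsRing)); [apply continuous_const|].
  apply continuity_pt_filterlim, derivable_continuous_pt, derivable_pt_pow.
Qed.

Lemma exR (f : R -> R) a b : (forall x, continuous f x) -> ex_RInt f a b.
Proof. intros H. apply (ex_RInt_continuous (V := R_CompleteNormedModule)). auto. Qed.

Lemma continuous_extR (f g : R -> R) x : (forall y, f y = g y) -> continuous f x -> continuous g x.
Proof. exact (continuous_ext f g x). Qed.

Lemma continuous_sq (f : R -> R) x : continuous f x -> continuous (fun x => f x ^ 2) x.
Proof.
  intros H. apply continuous_extR with (fun x => mult (f x) (f x)).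
  - intros y. unfold mult. simpl. ring.
  - apply (continuous_mult (K := R_AbsRing)); auto.
Qed.

Lemma RInt_pow_01 n : RInt (fun x => x ^ n) 0 1 = / INR (S n).
Proof.
  assert (N0 : INR (S n) <> 0) by (apply not_0_INR; lia).
  apply (is_RInt_unique (V := R_CompleteNormedModule)).
  replace (/ INR (S n)) with (minus (1 ^ S n / INR (S n)) (0 ^ S n / INR (S n))).
  - apply (is_RInt_derive (V := R_CompleteNormedModule) (fun x => x ^ S n / INR (S n))).
    + intros x _. auto_derive; auto. change (match n with O => 1 | S _ => INR n + 1 end) with (INR (S n)).
      field. auto.
    + intros x _. apply continuity_pt_filterlim, derivable_continuous_pt, derivable_pt_pow.
  - rewrite pow1, pow_ne_zero by lia. unfold minus, plus, opp. simpl. field. exact N0.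
Qed.

(** Adding the last term $g_N x^{N+1}$ increases the square by at most
    $2 g_N x^N \sum_{k \le N} g_k$ on the unit interval, whose integral is twice the
    corresponding term of Hardy's inequality. *)
Lemma RInt_rpoly_sq g N : (forall k, 0 <= g k) ->
  RInt (fun x => rpoly g N x ^ 2) 0 1 <= 4 * rsum (fun n => g n ^ 2) N.
Proof.
  intros Hg. apply Rle_trans with (2 * rsum (fun n => g n * mean_upto g (S n)) N);
    [|assert (H := hardy g N); lra].
  induction N as [|N IH].
  - simpl. unfold rpoly. simpl. rewrite (RInt_ext _ (fun _ => 0)) by (intros; simpl; ring).
    rewrite (RInt_const (V := R_CompleteNormedModule)).
    change (scal (1 - 0) 0) with ((1 - 0) * 0). lra.
  - set (c := 2 * (g N * rsum g (S N))).
    assert (cP : forall n x, continuous (fun x => rpoly g n x ^ 2) x)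
      by (intros; apply continuous_sq, rpoly_continuous).
    assert (cx : forall x, continuous (fun x => c * x ^ N) x).
    { intros x. apply (continuous_mult (K := R_AbsRing)); [apply continuous_const|].
      apply continuity_pt_filterlim, derivable_continuous_pt, derivable_pt_pow. }
    apply Rle_trans with (RInt (fun x => rpoly g N x ^ 2 + c * x ^ N) 0 1).
    + apply RInt_le; [lra|apply exR; auto| |].
      * apply exR. intros x. apply (continuous_plus (V := R_NormedModule)); auto.
      * intros x Hx. unfold rpoly. cbn [rsum]. fold (rpoly g N x).
        assert (Px : forall n, 0 <= rpoly g n x <= rsum g n).
        { intros n. unfold rpoly. split.
          - apply rsum_nonneg. intros k. apply Rmult_le_pos; auto. apply pow_le. lra.
          - apply rsum_le. intros k _. rewrite <- (Rmult_1_r (g k)) at 2.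
            apply Rmult_le_compat_l; auto. rewrite <- (pow1 (S k)). apply pow_incr. lra. }
        assert (P1 := Px N). assert (P2 := Px (S N)). unfold rpoly at 1 2 in P2. cbn [rsum] in P2.
        fold (rpoly g N x) in P2. 
        assert (xN : 0 <= x ^ N) by (apply pow_le; lra).
        assert (xS : 0 <= x ^ S N <= x ^ N) by (simpl; nra).
        set (p := rpoly g N x) in *. set (u := g N * x ^ S N) in *.
        assert (u0 : 0 <= u <= g N * x ^ N).
        { unfold u. split; [apply Rmult_le_pos; auto; lra|apply Rmult_le_compat_l; auto; lra]. }
        assert (Hc : 2 * u * (p + u) <= c * x ^ N).
        { unfold c. cbn [rsum].
          replace (2 * (g N * (rsum g N + g N)) * x ^ N) with
            (2 * (g N * x ^ N) * (rsum g N + g N)) by ring.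
          apply Rmult_le_compat; lra. }
        nra.
    + rewrite (RInt_plus (V := R_CompleteNormedModule)); [|apply exR; auto|apply exR; auto].
      rewrite (RInt_ext (fun x => c * x ^ N) (fun x => scal c (x ^ N))) by (intros; reflexivity).
      rewrite (RInt_scal (V := R_CompleteNormedModule)).
      2: { apply exR. intros x. apply continuity_pt_filterlim, derivable_continuous_pt, derivable_pt_pow. }
      rewrite RInt_pow_01. cbn [rsum].
      change (RInt (fun x => rpoly g N x ^ 2) 0 1 + c * / INR (S N) <=
        2 * (rsum (fun n => g n * mean_upto g (S n)) N + g N * mean_upto g (S N))).
      unfold mean_upto at 2. unfold c, Rdiv. lra.
Qed.

(** ** Integrating tents *)

Lemma Rmax0_continuous (f : R -> R) x : continuous f x -> continuous (fun x => Rmax 0 (f x)) x.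
Proof.
  intros H. apply continuous_extR with (fun x => scal (/ 2) (plus (f x) (Rabs (f x)))).
  - intros y. unfold scal, plus, mult. simpl. unfold mult. simpl.
    unfold Rmax. destruct (Rle_dec 0 (f y)); [rewrite Rabs_pos_eq by auto|rewrite Rabs_left by lra]; field.
  - apply (continuous_scal_r (V := R_NormedModule)).
    apply (continuous_plus (V := R_NormedModule)); auto.
    apply (continuous_comp f Rabs); auto. apply continuous_Rabs.
Qed.

Lemma continuous_affine u v x : continuous (fun x => u * x + v) x.
Proof.
  apply (continuous_plus (V := R_NormedModule)); [|apply continuous_const].
  apply (continuous_scal_r (V := R_NormedModule) u (fun x => x)). apply continuous_id.
Qed.

Lemma RInt_nonneg_mono (f : R -> R) a b c d : (forall x, continuous f x) -> (forall x, 0 <= f x) ->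
  a <= b -> b <= c -> c <= d -> RInt f b c <= RInt f a d.
Proof.
  intros Hc H0 Hab Hbc Hcd.
  assert (E1 := RInt_Chasles (V := R_CompleteNormedModule) f a b d (exR f _ _ Hc) (exR f _ _ Hc)).
  assert (E2 := RInt_Chasles (V := R_CompleteNormedModule) f b c d (exR f _ _ Hc) (exR f _ _ Hc)).
  unfold plus in E1, E2. simpl in E1, E2.
  assert (P1 : 0 <= RInt f a b) by (apply RInt_ge_0; auto; apply exR; auto).
  assert (P2 : 0 <= RInt f c d) by (apply RInt_ge_0; auto; apply exR; auto).
  lra.
Qed.

Lemma RInt_half_tent Q b L : (forall x, continuous Q x) -> Q 0 = 0 -> 0 < b -> / b <= L ->
  RInt (fun s => Q (Rmax 0 (1 - b * s))) 0 L = / b * RInt Q 0 1.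
Proof.
  intros Hc Q0 Hb HL. assert (Hib : 0 < / b) by (apply Rinv_0_lt_compat; auto).
  set (h := fun s => Q (Rmax 0 (1 - b * s))).
  assert (ch : forall x, continuous h x).
  { intros x. apply (continuous_comp (fun s => Rmax 0 (1 - b * s)) Q); auto.
    apply Rmax0_continuous. apply continuous_extR with (fun s => - b * s + 1); [intros; ring|].
    apply continuous_affine. }
  rewrite <- (RInt_Chasles (V := R_CompleteNormedModule) h 0 (/ b) L) by (apply exR; auto).
  rewrite (RInt_ext h (fun _ => 0) (/ b) L).
  2: { intros s Hs. rewrite Rmin_left in Hs by auto. unfold h. rewrite Rmax_left; auto.
       assert (b * / b <= b * s) by (apply Rmult_le_compat_l; lra). rewrite Rinv_r in *; lra. }
  rewrite (RInt_const (V := R_CompleteNormedModule)).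
  assert (E := RInt_comp_lin (V := R_CompleteNormedModule) Q (- b) 1 0 (/ b) (exR _ _ _ Hc)).
  replace (- b * 0 + 1) with 1 in E by ring. replace (- b * / b + 1) with 0 in E by (field; lra).
  rewrite <- (opp_RInt_swap (V := R_CompleteNormedModule) Q 0 1) in E by (apply exR; auto).
  rewrite (RInt_scal (V := R_CompleteNormedModule)) in E.
  2: { apply exR. intros x. apply (continuous_comp (fun y => - b * y + 1) Q); auto. apply continuous_affine. }
  rewrite (RInt_ext h (fun y => Q (- b * y + 1)) 0 (/ b)).
  2: { intros s Hs. rewrite Rmin_left, Rmax_right in Hs by lra. unfold h. f_equal.
       rewrite Rmax_right; [ring|].
       assert (b * s <= b * / b) by (apply Rmult_le_compat_l; lra). rewrite Rinv_r in *; lra. }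
  set (X := RInt (fun y => Q (- b * y + 1)) 0 (/ b)) in *. set (Y := RInt Q 0 1) in *.
  change (- b * X = - Y) in E. change (X + (L - / b) * 0 = / b * Y).
  apply Rmult_eq_reg_l with b; [|lra]. rewrite <- Rmult_assoc, Rinv_r by lra. lra.
Qed.

Lemma RInt_tent Q b tau : (forall x, continuous Q x) -> (forall x, 0 <= Q x) -> Q 0 = 0 -> 0 < b ->
  RInt (fun t => Q (Rmax 0 (1 - b * Rabs (t - tau)))) 0 (2 * PI) <= 2 / b * RInt Q 0 1.
Proof.
  intros Hc Hp Q0 Hb. assert (Pi := two_pi_pos).
  assert (Hib : 0 < / b) by (apply Rinv_0_lt_compat; auto).
  set (L := 2 * PI + Rabs tau + / b). assert (At := Rabs_pos tau).
  assert (At1 := Rle_abs tau). assert (At2 := Rle_abs (- tau)). rewrite Rabs_Ropp in At2.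
  set (f := fun t => Q (Rmax 0 (1 - b * Rabs (t - tau)))).
  set (h := fun s => Q (Rmax 0 (1 - b * s))).
  assert (ch : forall x, continuous h x).
  { intros x. apply (continuous_comp (fun s => Rmax 0 (1 - b * s)) Q); auto.
    apply Rmax0_continuous. apply continuous_extR with (fun s => - b * s + 1); [intros; ring|].
    apply continuous_affine. }
  assert (cf : forall x, continuous f x).
  { intros x. apply (continuous_comp (fun t => Rabs (t - tau)) h); auto.
    apply (continuous_comp (fun t => t - tau) Rabs); [|apply continuous_Rabs].
    apply continuous_extR with (fun t => 1 * t + - tau); [intros; ring|]. apply continuous_affine. }
  eapply Rle_trans; [apply (RInt_nonneg_mono f (tau - L) 0 (2 * PI) (tau + L)); auto;
    try (intros; apply Hp); unfold L; lra|].
  assert (H := RInt_half_tent Q b L Hc Q0 Hb ltac:(unfold L; lra)). fold h in H.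
  assert (E1 := RInt_comp_lin (V := R_CompleteNormedModule) h 1 (- tau) tau (tau + L) (exR _ _ _ ch)).
  replace (1 * tau + - tau) with 0 in E1 by ring. replace (1 * (tau + L) + - tau) with L in E1 by ring.
  assert (E2 := RInt_comp_lin (V := R_CompleteNormedModule) h (-1) tau (tau - L) tau (exR _ _ _ ch)).
  replace (-1 * (tau - L) + tau) with L in E2 by ring. replace (-1 * tau + tau) with 0 in E2 by ring.
  rewrite <- (opp_RInt_swap (V := R_CompleteNormedModule) h 0 L) in E2 by (apply exR; auto).
  rewrite (RInt_scal (V := R_CompleteNormedModule)) in E1, E2.
  2: { apply exR. intros x. apply (continuous_comp (fun y => -1 * y + tau) h); auto. apply continuous_affine. }
  2: { apply exR. intros x. apply (continuous_comp (fun y => 1 * y + - tau) h); auto. apply continuous_affine. }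
  assert (L0 : 0 <= L) by (unfold L; lra).
  rewrite (RInt_ext (fun y => h (1 * y + - tau)) f) in E1.
  2: { intros t Ht. rewrite Rmin_left, Rmax_right in Ht by lra. unfold f, h. do 3 f_equal.
       rewrite Rabs_pos_eq by lra. ring. }
  rewrite (RInt_ext (fun y => h (-1 * y + tau)) f) in E2.
  2: { intros t Ht. rewrite Rmin_left, Rmax_right in Ht by lra. unfold f, h. do 3 f_equal.
       rewrite Rabs_left by lra. ring. }
  rewrite <- (RInt_Chasles (V := R_CompleteNormedModule) f (tau - L) tau (tau + L)) by (apply exR; auto).
  set (X1 := RInt f tau (tau + L)) in *. set (X2 := RInt f (tau - L) tau) in *.
  set (Y := RInt h 0 L) in *. change (1 * X1 = Y) in E1. change (-1 * X2 = - Y) in E2.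
  change (X2 + X1 <= 2 / b * RInt Q 0 1). unfold Rdiv. lra.
Qed.

(** * The points of contact *)

Lemma circ_dist_spec s t :
  (exists k : Z, circ_dist s t = Rabs (s - t + 2 * PI * IZR k)) /\
  (forall k : Z, circ_dist s t <= Rabs (s - t + 2 * PI * IZR k)) /\ circ_dist s t <= PI.
Proof.
  assert (Pi := PI_RGT_0). set (x := s - t).
  set (k0 := (- Int_part (x / (2 * PI) + / 2))%Z).
  assert (B0 : Rabs (x + 2 * PI * IZR k0) <= PI).
  { unfold k0. rewrite opp_IZR. destruct (base_Int_part (x / (2 * PI) + / 2)) as [I1 I2].
    set (n := IZR (Int_part (x / (2 * PI) + / 2))) in *.
    assert (E : x = 2 * PI * (x / (2 * PI))) by (field; lra).
    set (y := x / (2 * PI)) in *. rewrite E. apply Rabs_le. nra. }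
  assert (Mn : forall k, Rabs (x + 2 * PI * IZR k0) <= Rabs (x + 2 * PI * IZR k)).
  { intros k. destruct (Z.eq_dec k k0) as [->|n]; [lra|].
    apply Rle_trans with PI; auto.
    assert (E : x + 2 * PI * IZR k = 2 * PI * IZR (k - k0) + (x + 2 * PI * IZR k0))
      by (rewrite minus_IZR; ring).
    rewrite E. assert (Hk : 1 <= Rabs (IZR (k - k0))).
    { rewrite <- abs_IZR. apply IZR_le. lia. }
    assert (T := Rabs_triang_inv (2 * PI * IZR (k - k0)) (- (x + 2 * PI * IZR k0))).
    rewrite Rabs_Ropp, Rabs_mult, (Rabs_pos_eq (2 * PI)) in T by lra.
    replace (2 * PI * IZR (k - k0) - - (x + 2 * PI * IZR k0)) with
      (2 * PI * IZR (k - k0) + (x + 2 * PI * IZR k0)) in T by ring.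
    nra. }
  assert (E : circ_dist s t = Rabs (x + 2 * PI * IZR k0)).
  { unfold circ_dist. rewrite (is_glb_Rbar_unique _ (Finite (Rabs (x + 2 * PI * IZR k0)))); auto.
    split.
    - intros y [k ->]. apply Mn.
    - intros b Hb. apply Hb. exists k0. reflexivity. }
  rewrite E. split; [exists k0; auto|split; auto].
Qed.

Lemma circ_dist_nonneg s t : 0 <= circ_dist s t.
Proof. destruct (circ_dist_spec s t) as [[k ->] _]. apply Rabs_pos. Qed.

Lemma circ_dist_le s t : circ_dist s t <= Rabs (s - t).
Proof.
  destruct (circ_dist_spec s t) as [_ [H _]]. specialize (H 0%Z).
  replace (s - t + 2 * PI * IZR 0) with (s - t) in H by ring. exact H.
Qed.

Lemma polar_period r t (k : Z) : polar r (t - 2 * PI * IZR k) = polar r t.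
Proof.
  replace (t - 2 * PI * IZR k) with (t + - (IZR k * (2 * PI))) by ring.
  unfold polar. rewrite cos_plus, sin_plus, cos_neg, sin_neg, cos_int_2PI, sin_int_2PI.
  apply injective_projections; simpl; ring.
Qed.

(** Lets distances on the circle be replaced by distances between reals. *)
Lemma nearest_representative t tj : exists tau, (forall r, polar r tau = polar r tj) /\
  circ_dist t tau = Rabs (t - tau) /\ circ_dist t tau = circ_dist t tj.
Proof.
  destruct (circ_dist_spec t tj) as [[k Hk] [Hmin _]].
  exists (tj - 2 * PI * IZR k). split; [intros; apply polar_period|].
  assert (E : circ_dist t tj = Rabs (t - (tj - 2 * PI * IZR k))) by (rewrite Hk; f_equal; ring).
  assert (L1 := circ_dist_le t (tj - 2 * PI * IZR k)).
  destruct (circ_dist_spec t (tj - 2 * PI * IZR k)) as [[k' Hk'] _].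
  assert (L2 := Hmin (k + k')%Z). rewrite plus_IZR in L2.
  replace (t - tj + 2 * PI * (IZR k + IZR k')) with
    (t - (tj - 2 * PI * IZR k) + 2 * PI * IZR k') in L2 by ring.
  split; lra.
Qed.

Lemma circ_dist_0 s t : circ_dist s t = 0 -> Rabs (s - t) <= PI -> s = t.
Proof.
  intros H Hst. destruct (circ_dist_spec s t) as [[k Hk] _]. rewrite Hk in H.
  assert (Pi := PI_RGT_0).
  assert (E : s - t + 2 * PI * IZR k = 0).
  { destruct (Req_dec (s - t + 2 * PI * IZR k) 0) as [e|n]; auto. apply Rabs_no_R0 in n. lra. }
  assert (k = 0%Z).
  { destruct (Z.eq_dec k 0) as [|n]; auto. exfalso.
    assert (K1 : 1 <= Rabs (IZR k)) by (rewrite <- abs_IZR; apply IZR_le; lia).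
    replace (s - t) with (2 * PI * - IZR k) in Hst by lra.
    rewrite Rabs_mult, Rabs_Ropp, (Rabs_pos_eq (2 * PI)) in Hst by lra. nra. }
  subst k. lra.
Qed.

Lemma separated_finite (S : R -> Prop) rho a b : 0 < rho ->
  (forall s t, S s -> S t -> Rabs (s - t) <= rho -> s = t) ->
  exists (M : nat) (tau : nat -> R), forall t, S t -> a <= t <= b ->
    exists m, (m < M)%nat /\ t = tau m.
Proof.
  intros Hr Hsep.
  set (cell := fun m t => S t /\ a + INR m * rho <= t <= a + INR m * rho + rho).
  destruct (nfloor_ex (Rmax 0 ((b - a) / rho)) (Rmax_l _ _)) as [n Hn].
  exists (n + 1)%nat, (fun m => epsilon (inhabits 0) (cell m)).
  intros t Ht Hab.
  destruct (nfloor_ex ((t - a) / rho)) as [m Hm].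
  { apply Rmult_le_pos; [lra|left; apply Rinv_0_lt_compat; auto]. }
  assert (Et : t = a + (t - a) / rho * rho) by (field; lra).
  assert (C : cell m t).
  { split; auto. set (y := (t - a) / rho) in *. nra. }
  exists m. split.
  - assert (L : (t - a) / rho <= (b - a) / rho)
      by (apply Rmult_le_compat_r; [left; apply Rinv_0_lt_compat; auto|lra]).
    assert (L2 := Rmax_r 0 ((b - a) / rho)).
    apply INR_lt. rewrite plus_INR. simpl. lra.
  - destruct (epsilon_spec (inhabits 0) (cell m) (ex_intro _ t C)) as [S1 S2].
    destruct C as [_ C]. apply Hsep; auto. apply Rabs_le. lra.
Qed.

Lemma positive_min (r : nat -> R) p : (forall j, (1 <= j <= p)%nat -> 0 < r j) ->
  exists rho, 0 < rho /\ forall j, (1 <= j <= p)%nat -> rho <= r j.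
Proof.
  induction p as [|p IH]; intros H.
  - exists 1. split; [lra|]. intros; lia.
  - destruct IH as [rho [H1 H2]]; [intros; apply H; lia|].
    exists (Rmin rho (r (S p))). split; [apply Rmin_pos; auto; apply H; lia|].
    intros j Hj. destruct (Nat.eq_dec j (S p)) as [->|]; [apply Rmin_r|].
    eapply Rle_trans; [apply Rmin_l|]. apply H2. lia.
Qed.

Lemma contact_norm phi p xi j : contact_set phi p xi -> (1 <= j <= p)%nat -> Cmod (xi j) = 1.
Proof. intros [_ H] Hj. apply (H (xi j)). exists j. auto. Qed.

(** Two distinct contact parameters are farther apart than $\min(\min_j r_j, \pi)$: on the
    arc around one of them, the second condition of regularity separates the boundary values, while the
    first one makes them equal wherever they are unimodular. Hence finitely many arcs,
    centred at contact points, cover the circle. *)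
Lemma finite_cover phi p xi w A r C0 c0 :
  contact_set phi p xi -> modulus w A -> globally_regular phi p xi w A r C0 c0 ->
  exists (M : nat) (tau : nat -> R), forall t, 0 <= t <= 2 * PI -> exists m j,
    (m < M)%nat /\ (1 <= j <= p)%nat /\ bdry phi (tau m) = xi j /\
    circ_dist t (tau m) = Rabs (t - tau m) /\ Rabs (t - tau m) <= r j.
Proof.
  intros Hct Hm Hg. assert (Pi := PI_RGT_0).
  destruct (positive_min r p) as [rho [Hr1 Hr2]].
  { intros j Hj. apply (gr_radius _ _ _ _ _ _ _ _ Hg j Hj). }
  set (S := fun t => exists j, (1 <= j <= p)%nat /\ bdry phi t = xi j).
  destruct (separated_finite S (Rmin rho PI) (- PI) (3 * PI)) as [M [tau Htau]].
  - apply Rmin_pos; auto.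
  - intros s t [i [Hi Es]] [j [Hj Et]] Hst.
    assert (Hst1 := Rle_trans _ _ _ Hst (Rmin_l _ _)).
    assert (Hst2 := Rle_trans _ _ _ Hst (Rmin_r _ _)).
    assert (D := circ_dist_le s t). assert (Dj := Hr2 j Hj).
    assert (N := gr_nontangential _ _ _ _ _ _ _ _ Hg j t s Hj Et ltac:(lra)).
    assert (L := gr_lower _ _ _ _ _ _ _ _ Hg j t s Hj Et ltac:(lra)).
    rewrite Es in N at 2. rewrite (contact_norm phi p xi i Hct Hi) in N.
    destruct (gr_consts _ _ _ _ _ _ _ _ Hg) as [HC Hc].
    destruct (gr_radius _ _ _ _ _ _ _ _ Hg j Hj) as [Rj RA].
    apply circ_dist_0; auto.
    destruct (circ_dist_nonneg s t) as [P|P]; auto. exfalso.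
    assert (W := mod_incr _ _ Hm 0 (circ_dist s t) (Rle_refl _) P ltac:(lra)).
    rewrite (mod_zero _ _ Hm) in W. nra.
  - exists M, tau. intros t Ht.
    destruct (gr_cover _ _ _ _ _ _ _ _ Hg t) as [j [tj [Hj [Etj Hd]]]].
    destruct (nearest_representative t tj) as [ta [E1 [E2 E3]]].
    assert (Eb : bdry phi ta = xi j) by (unfold bdry; rewrite E1; exact Etj).
    assert (Dp := proj2 (proj2 (circ_dist_spec t tj))).
    assert (Ha : - PI <= ta <= 3 * PI).
    { rewrite <- E3, E2 in Dp. apply Rabs_le_between in Dp. lra. }
    destruct (Htau ta (ex_intro _ j (conj Hj Eb)) Ha) as [m [Hm1 Hm2]].
    exists m, j. rewrite <- Hm2. repeat split; auto; try lia; lra.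
Qed.

(** * Zeros of the Blaschke product *)

(** If [z] approaches [xi] within a Stolz angle, then a zero on the radius through [xi], at a
    distance from [xi] comparable to that of [z], is at a bounded hyperbolic distance
    from [z]. *)
Lemma blaschke_small xi z h x C M : Cmod xi = 1 -> 0 < h <= 1 -> Cmod z <= 1 -> 0 < C ->
  x = Cmod (z - xi) -> x <= C * (1 - Cmod z) -> h <= x -> x <= M * h ->
  Cmod (blaschke (RtoC (1 - h) * xi)%C z) ^ 2 <= 1 - / (4 * C * M).
Proof.
  intros Hxi Hh Hz HC Ex Hx1 Hx2 Hx3.
  set (a := (RtoC (1 - h) * xi)%C).
  assert (Ha : Cmod a = 1 - h) by (unfold a; rewrite Cmod_mult, Hxi, Cmod_R, Rabs_pos_eq; lra).
  rewrite blaschke_sq by lra.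
  assert (D : 0 < Cmod (1 - Cconj a * z)) by (apply Cmod_gt_0, den_neq_0; lra).
  assert (D2 : Cmod (1 - Cconj a * z) <= 2 * x).
  { replace (1 - Cconj a * z)%C with (Cconj xi * (xi - z) + RtoC h * (Cconj xi * z))%C.
    - eapply Rle_trans; [apply Cmod_triangle|].
      rewrite !Cmod_mult, Cmod_conj, Hxi, Cmod_R, Rabs_pos_eq, Cmod_minus_sym, <- Ex by lra.
      assert (Z0 := Cmod_ge_0 z). nra.
    - assert (E : (Cconj xi * xi)%C = RtoC 1).
      { rewrite Cconj_mult_Cmod2, Hxi. f_equal. ring. }
      unfold a. rewrite Cmult_conj.
      replace (Cconj (RtoC (1 - h))) with (1 - RtoC h)%C by (apply injective_projections; simpl; ring).
      replace (Cconj xi * (xi - z))%C with (Cconj xi * xi - Cconj xi * z)%C by ring.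
      rewrite E. ring. }
  assert (x0 : 0 < x) by lra.
  assert (HM : 0 < M) by nra.
  assert (Z0 := Cmod_ge_0 z).
  assert (N1 : h * (x / C) <= (1 - Cmod a ^ 2) * (1 - Cmod z ^ 2)).
  { assert (Q : x / C <= 1 - Cmod z).
    { apply Rmult_le_reg_r with C; auto. unfold Rdiv. rewrite Rmult_assoc, Rinv_l; lra. }
    assert (0 < x / C) by (apply Rdiv_lt_0_compat; auto).
    rewrite Ha. apply Rmult_le_compat; try lra; nra. }
  assert (N2 : / (4 * C * M) <= h * (x / C) / (2 * x) ^ 2).
  { replace (h * (x / C) / (2 * x) ^ 2) with (h / (4 * C * x)) by (field; lra).
    apply Rmult_le_reg_r with (4 * C * x * M); [repeat apply Rmult_lt_0_compat; lra|].
    replace (/ (4 * C * M) * (4 * C * x * M)) with x by (field; lra).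
    replace (h / (4 * C * x) * (4 * C * x * M)) with (M * h) by (field; lra). exact Hx3. }
  assert (N3 : h * (x / C) / (2 * x) ^ 2 <=
    (1 - Cmod a ^ 2) * (1 - Cmod z ^ 2) / Cmod (1 - Cconj a * z) ^ 2).
  { assert (0 < x / C) by (apply Rdiv_lt_0_compat; auto).
    apply Rmult_le_compat; [nra|left; apply Rinv_0_lt_compat, pow_lt; lra|exact N1|].
    apply Rinv_le_contravar; [apply pow_lt; auto|]. apply pow_incr. lra. }
  lra.
Qed.

(** The factor $4/\lambda$ allows for the points that are farther than $\lambda$ from the
    contact point: they are assigned to the largest scale. *)
Lemma dyadic_scale lam x N : 0 < lam <= 1 -> (1 <= N)%nat -> lam / 2 ^ N <= x <= 2 ->
  exists k, (1 <= k <= N)%nat /\ lam / 2 ^ k <= x <= 4 / lam * (lam / 2 ^ k).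
Proof.
  intros Hl HN. induction N as [|N IH]; [lia|]. intros Hx.
  destruct (Nat.eq_dec N 0) as [->|HN0].
  - exists 1%nat. split; [lia|]. split; [lra|]. replace (4 / lam * (lam / 2 ^ 1)) with 2; [lra|].
    simpl. field. lra.
  - destruct (Rle_dec (lam / 2 ^ N) x) as [h|h].
    + destruct (IH ltac:(lia) ltac:(lra)) as [k [Hk1 Hk2]]. exists k. split; [lia|auto].
    + exists (S N). split; [lia|]. split; [lra|].
      assert (P : 0 < 2 ^ N) by (apply pow_lt; lra).
      assert (Q : 0 < / 2 ^ N) by (apply Rinv_0_lt_compat; auto).
      replace (4 / lam * (lam / 2 ^ S N)) with (2 * / 2 ^ N) by (simpl; field; lra).
      unfold Rdiv in h. nra.
Qed.

Definition zero_at (p : nat) (xi : nat -> C) (lam : R) (e : nat) : C :=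
  (RtoC (1 - lam / 2 ^ (1 + e / p)) * xi (1 + e mod p)%nat)%C.

Lemma half_pow_le k : (1 <= k)%nat -> 0 < / 2 ^ k <= / 2.
Proof.
  intros Hk. assert (P : 0 < 2 ^ k) by (apply pow_lt; lra).
  split; [apply Rinv_0_lt_compat; auto|]. apply Rinv_le_contravar; [lra|].
  destruct k as [|k]; [lia|]. simpl. assert (1 <= 2 ^ k) by (apply pow_R1_Rle; lra). lra.
Qed.

Lemma zero_at_disk p xi lam e : (1 <= p)%nat -> (forall j, (1 <= j <= p)%nat -> Cmod (xi j) = 1) ->
  0 < lam <= 1 -> Cmod (zero_at p xi lam e) < 1.
Proof.
  intros Hp Hxi Hl. unfold zero_at. rewrite Cmod_mult, Hxi.
  - assert (B := half_pow_le (1 + e / p) ltac:(lia)). unfold Rdiv.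
    rewrite Cmod_R, Rabs_pos_eq; nra.
  - assert (H := Nat.mod_upper_bound e p ltac:(lia)). lia.
Qed.

Lemma zero_at_index p xi lam j k : (1 <= j <= p)%nat -> (1 <= k)%nat ->
  zero_at p xi lam ((j - 1) + (k - 1) * p) = (RtoC (1 - lam / 2 ^ k) * xi j)%C.
Proof.
  intros Hj Hk. unfold zero_at. rewrite Nat.Div0.mod_add, Nat.mod_small, Nat.div_add by lia.
  rewrite Nat.div_small by lia. do 3 f_equal; [|lia]. do 3 f_equal. lia.
Qed.

(** The first $dpN$ terms of this periodic sequence contain each point
    $(1-\lambda 2^{-k})\xi_j$ with $1 \le k \le N$ exactly $d$ times. *)
Definition bzeros (p : nat) (xi : nat -> C) (lam : R) (N : nat) (i : nat) : C :=
  zero_at p xi lam (i mod (p * N)).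

Lemma bprod_small p xi lam C N d j z :
  (1 <= p)%nat -> (forall j, (1 <= j <= p)%nat -> Cmod (xi j) = 1) -> 0 < lam <= 1 -> 0 < C ->
  (1 <= N)%nat -> (1 <= j <= p)%nat -> Cmod z <= 1 ->
  Cmod (z - xi j) <= C * (1 - Cmod z) -> lam / 2 ^ N <= Cmod (z - xi j) ->
  Cmod (bprod (bzeros p xi lam N) (d * (p * N)) z) ^ 2 <= exp (- (lam / (16 * C)) * INR d).
Proof.
  intros Hp Hxi Hl HC HN Hj Hz H1 H2.
  set (x := Cmod (z - xi j)) in *.
  assert (x2 : x <= 2).
  { unfold x. eapply Rle_trans; [apply (Cmod_triangle z (- xi j))|]. rewrite Cmod_opp, Hxi; auto. lra. }
  destruct (dyadic_scale lam x N Hl HN ltac:(lra)) as [k [Hk [Hk1 Hk2]]].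
  assert (B := half_pow_le k ltac:(lia)).
  assert (Sm := blaschke_small (xi j) z (lam / 2 ^ k) x C (4 / lam) (Hxi j Hj)
    ltac:(unfold Rdiv; nra) Hz HC eq_refl H1 Hk1 Hk2).
  rewrite <- (zero_at_index p xi lam j k Hj ltac:(lia)) in Sm.
  replace (/ (4 * C * (4 / lam))) with (lam / (16 * C)) in Sm by (field; lra).
  set (dl := lam / (16 * C)) in *.
  assert (He : (j - 1 + (k - 1) * p < p * N)%nat) by nia.
  eapply Rle_trans.
  - apply (bprod_periodic (zero_at p xi lam) (p * N) d (j - 1 + (k - 1) * p) z (1 - dl)); auto.
    intros i. apply zero_at_disk; auto.
  - replace (- dl * INR d) with (INR d * - dl) by ring.
    assert (E : exp (INR d * - dl) = exp (- dl) ^ d).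
    { clear. induction d as [|d IH]; [simpl; rewrite Rmult_0_l; apply exp_0|].
      rewrite S_INR, Rmult_plus_distr_r, Rmult_1_l, exp_plus, IH. simpl. ring. }
    rewrite E. apply pow_incr. split; [eapply Rle_trans; [apply pow2_ge_0|exact Sm]|].
    assert (X := exp_ineq1_le (- dl)). lra.
Qed.

(** * The boundary estimate *)

Lemma concave_chord w A s S : modulus w A -> concave_upto w A -> 0 <= s <= S -> 0 < S <= A ->
  s / S * w S <= w s.
Proof.
  intros Hm Hc Hs HS.
  assert (Q : 0 <= s / S <= 1).
  { split; [apply Rmult_le_pos; [lra|left; apply Rinv_0_lt_compat; lra]|].
    apply Rmult_le_reg_r with S; [lra|]. unfold Rdiv. rewrite Rmult_assoc, Rinv_l; lra. }
  assert (H := Hc S 0 (s / S) ltac:(lra) ltac:(lra) Q).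
  rewrite (mod_zero _ _ Hm) in H. replace (s / S * S + (1 - s / S) * 0) with s in H by (field; lra).
  lra.
Qed.

(** Since $\omega(h)/h \to \infty$, the inverse lies below the diagonal near $0$; this makes the
    integers $d_N$ positive. *)
Lemma small_scale w A winv B : modulus w A ->
  filterlim (fun h => w h / h) (at_right 0) (Rbar_locally p_infty) ->
  inverse_upto w A winv -> 0 < B ->
  exists kappa, 0 < kappa <= B /\ kappa <= w A /\
    forall y, 0 < y <= kappa -> 0 < winv y <= A /\ w (winv y) = y /\ winv y <= y.
Proof.
  intros Hm Hlim [_ Hinv] HB. assert (HA := mod_pos _ _ Hm).
  destruct (Hlim (fun y => 1 < y)) as [d Hd]; [exists 1; auto|].
  set (h := Rmin (d / 2) A). assert (dp := cond_pos d).
  assert (h0 : 0 < h) by (apply Rmin_pos; lra).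
  assert (h1 : h <= d / 2) by apply Rmin_l. assert (h2 : h <= A) by apply Rmin_r.
  assert (wh : 0 < w h).
  { assert (W := mod_incr _ _ Hm 0 h (Rle_refl _) h0 h2). rewrite (mod_zero _ _ Hm) in W. auto. }
  assert (whA : w h <= w A).
  { destruct h2 as [l|e]; [|rewrite e; lra]. left. apply (mod_incr _ _ Hm); lra. }
  exists (Rmin B (w h)). split; [split; [apply Rmin_pos; auto|apply Rmin_l]|].
  split; [eapply Rle_trans; [apply Rmin_r|auto]|].
  intros y Hy. assert (Hy2 : y <= w h) by (eapply Rle_trans; [apply Hy|apply Rmin_r]).
  destruct (Hinv y ltac:(lra)) as [I1 I2]. 
  assert (P : 0 < winv y).
  { destruct I1 as [[q|q] _]; auto. rewrite <- q, (mod_zero _ _ Hm) in I2. lra. }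
  assert (U : winv y <= h).
  { destruct (Rle_dec (winv y) h) as [u|u]; auto. exfalso.
    assert (W := mod_incr _ _ Hm h (winv y) ltac:(lra) ltac:(lra) ltac:(lra)). lra. }
  split; [lra|]. split; auto.
  assert (K : 1 < w (winv y) / winv y).
  { apply Hd; [|exact P]. unfold ball. simpl. unfold AbsRing_ball, abs, minus, plus, opp. simpl.
    replace (winv y + - 0) with (winv y) by ring. rewrite Rabs_pos_eq; lra. }
  rewrite I2 in K. apply (Rmult_lt_compat_r (winv y)) in K; auto.
  unfold Rdiv in K. rewrite Rmult_assoc, Rinv_l in K; lra.
Qed.

Lemma ps_le_rpoly g z n x : Cmod z <= x -> / 2 <= x ->
  Cmod (ps g z n) ^ 2 <= 4 * rpoly (fun k => Cmod (g k)) n x ^ 2.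
Proof.
  intros Hz Hx. assert (Z0 := Cmod_ge_0 z).
  replace (4 * rpoly (fun k => Cmod (g k)) n x ^ 2)
    with ((2 * rpoly (fun k => Cmod (g k)) n x) ^ 2) by ring.
  apply pow_incr. split; [apply Cmod_ge_0|].
  eapply Rle_trans; [apply Cmod_csum|]. unfold rpoly. rewrite <- rsum_scal.
  apply rsum_le. intros k _. rewrite Cmod_mult, Cmod_pow.
  replace (2 * (Cmod (g k) * x ^ S k)) with (Cmod (g k) * (2 * x * x ^ k)) by (simpl; ring).
  apply Rmult_le_compat_l; [apply Cmod_ge_0|].
  assert (P1 : Cmod z ^ k <= x ^ k) by (apply pow_incr; lra).
  assert (P2 : 0 <= Cmod z ^ k) by (apply pow_le; auto). nra.
Qed.

Lemma continuous_rsum (f : nat -> R -> R) n x : (forall k, continuous (f k) x) ->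
  continuous (fun x => rsum (fun k => f k x) n) x.
Proof.
  intros H. induction n as [|n IH]; cbn [rsum]; [apply continuous_const|].
  apply (continuous_plus (V := R_NormedModule)); auto.
Qed.

Lemma RInt_rsum_le (f : nat -> R -> R) n a b K : (forall k x, continuous (f k) x) ->
  (forall k, RInt (f k) a b <= K) -> RInt (fun x => rsum (fun k => f k x) n) a b <= INR n * K.
Proof.
  intros Hc HK. induction n as [|n IH].
  - cbn [rsum]. rewrite (RInt_const (V := R_CompleteNormedModule)). simpl.
    change (scal (b - a) 0) with ((b - a) * 0). lra.
  - cbn [rsum]. rewrite (RInt_plus (V := R_CompleteNormedModule)).
    + rewrite S_INR. specialize (HK n). unfold plus. simpl. lra.
    + apply exR. intros x. apply continuous_rsum. auto.
    + apply exR. auto.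
Qed.

(** Near a contact point, at distance $s$ from it, $|\gamma| \le 1 - c_1 \omega(s)$. By
    concavity $\omega(s) \ge s\,\omega(s_N)/s_N$ for $s \le s_N$, and
    $\omega(s) \ge s\,\omega(A)/A$ throughout, which accounts for the constant [b2]. So
    in both regimes the curve approaches the circle at a linear rate, and a linear change of
    variable reduces the integral of the square of a polynomial to its integral over a
    radius, with a factor proportional to $s_N/\omega(s_N)$ where nothing is known about the
    Blaschke product. *)
Theorem boundary_estimate (gam B : R -> C) (M : nat) (tau : nat -> R) (w : R -> R) c1 b2 A sN beta :
  ccont gam -> ccont B -> (forall t, Cmod (B t) <= 1) ->
  0 < c1 -> 0 < b2 -> 0 <= beta -> 0 < sN -> 0 < w sN -> c1 * w sN <= / 2 -> b2 * A <= / 2 ->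
  (forall s, 0 <= s <= sN -> s / sN * w sN <= w s) ->
  (forall t, 0 <= t <= 2 * PI -> exists m, (m < M)%nat /\
     Rabs (t - tau m) <= A /\ Cmod (gam t) <= 1 - c1 * w (Rabs (t - tau m)) /\
     Cmod (gam t) <= 1 - b2 * Rabs (t - tau m) /\
     (sN <= Rabs (t - tau m) -> Cmod (B t) ^ 2 <= beta)) ->
  forall g n, ravg (fun t => Cmod (B t * ps g (gam t) n) ^ 2) <=
    32 * INR M * (/ c1 + / b2) * (sN / w sN + beta) * rsum (fun k => Cmod (g k) ^ 2) n.
Proof.
  intros Hg HB HB1 Hc1 Hb2 Hbeta HsN HwN Hs1 Hs2 Hch Hcov g n.
  set (Q := fun x => rpoly (fun k => Cmod (g k)) n x ^ 2).
  assert (cQ : forall x, continuous Q x) by (intros; apply continuous_sq, rpoly_continuous).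
  assert (Q0 : Q 0 = 0).
  { unfold Q, rpoly. rewrite (rsum_ext _ (fun _ => 0 * 0)) by (intros; simpl; ring).
    rewrite (rsum_scal 0 (fun _ => 0)). ring. }
  assert (Qp : forall x, 0 <= Q x) by (intros; apply pow2_ge_0).
  set (S := rsum (fun k => Cmod (g k) ^ 2) n).
  assert (QI : RInt Q 0 1 <= 4 * S) by (apply RInt_rpoly_sq; intros; apply Cmod_ge_0).
  set (b1 := c1 * w sN / sN).
  assert (Hb1 : 0 < b1) by (apply Rdiv_lt_0_compat; auto; apply Rmult_lt_0_compat; auto).
  set (tent := fun b m t => Q (Rmax 0 (1 - b * Rabs (t - tau m)))).
  assert (ct : forall b m t, continuous (tent b m) t).
  { intros b m t. apply (continuous_comp (fun t => Rmax 0 (1 - b * Rabs (t - tau m))) Q); auto.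
    apply Rmax0_continuous.
    apply continuous_extR with (fun t => - b * Rabs (t - tau m) + 1); [intros; ring|].
    apply (continuous_comp (fun t => Rabs (t - tau m)) (fun y => - b * y + 1)); [|apply continuous_affine].
    apply (continuous_comp (fun t => t - tau m) Rabs); [|apply continuous_Rabs].
    apply continuous_extR with (fun t => 1 * t + - tau m); [intros; ring|]. apply continuous_affine. }
  set (F := fun m t => 4 * tent b1 m t + 4 * beta * tent b2 m t).
  assert (cF : forall m t, continuous (F m) t).
  { intros m t. apply (continuous_plus (V := R_NormedModule));
      apply (continuous_scal_r (V := R_NormedModule)); apply ct. }
  assert (Fp : forall m t, 0 <= F m t).
  { intros m t. unfold F, tent. assert (P1 := Qp (Rmax 0 (1 - b1 * Rabs (t - tau m)))).
    assert (P2 := Qp (Rmax 0 (1 - b2 * Rabs (t - tau m)))). nra. }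
  assert (cV : forall t, continuous (fun t => Cmod (B t * ps g (gam t) n) ^ 2) t).
  { apply ccont_sq. intros t. apply cat_mult; [apply HB|].
    apply (cat_csum Rd (fun k t => g k * gam t ^ k)%C). intros k.
    apply cat_mult; [apply cat_const|apply cat_pow, Hg]. }
  assert (Pt : forall t, 0 <= t <= 2 * PI ->
    Cmod (B t * ps g (gam t) n) ^ 2 <= rsum (fun m => F m t) M).
  { intros t Ht. destruct (Hcov t Ht) as [m [Hm [HA [H1 [H2 H3]]]]].
    eapply Rle_trans; [|apply (rsum_term_le (fun m => F m t) M m); auto].
    rewrite Cmod_mult, Rpow_mult_distr.
    set (s := Rabs (t - tau m)) in *. assert (s0 : 0 <= s) by apply Rabs_pos.
    assert (P1 := Qp (Rmax 0 (1 - b1 * s))). assert (P2 := Qp (Rmax 0 (1 - b2 * s))).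
    assert (p0 := pow2_ge_0 (Cmod (ps g (gam t) n))).
    assert (q0 := pow2_ge_0 (Cmod (B t))).
    unfold F, tent. fold s.
    destruct (Rle_dec s sN) as [hs|hs].
    - assert (W := Hch s (conj s0 hs)).
      assert (b1s : b1 * s = c1 * (s / sN * w sN)) by (unfold b1; field; lra).
      assert (sm : s / sN * w sN <= w sN).
      { rewrite <- (Rmult_1_l (w sN)) at 2. apply Rmult_le_compat_r; [lra|].
        apply Rmult_le_reg_r with sN; [lra|]. unfold Rdiv. rewrite Rmult_assoc, Rinv_l; lra. }
      assert (X : / 2 <= 1 - b1 * s) by (rewrite b1s; nra).
      assert (Y : Cmod (gam t) <= 1 - b1 * s) by (rewrite b1s; nra).
      assert (Z := ps_le_rpoly g (gam t) n (1 - b1 * s) Y X). fold (Q (1 - b1 * s)) in Z.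
      rewrite (Rmax_right 0 (1 - b1 * s)) in * by lra.
      assert (B2 : Cmod (B t) ^ 2 <= 1).
      { rewrite <- (pow1 2). apply pow_incr. split; [apply Cmod_ge_0|auto]. }
      nra.
    - assert (X : / 2 <= 1 - b2 * s) by nra.
      assert (Z := ps_le_rpoly g (gam t) n (1 - b2 * s) H2 X). fold (Q (1 - b2 * s)) in Z.
      rewrite (Rmax_right 0 (1 - b2 * s)) in * by lra.
      assert (B2 := H3 ltac:(lra)).
      assert (Cmod (B t) ^ 2 * Cmod (ps g (gam t) n) ^ 2 <= beta * (4 * Q (1 - b2 * s)))
        by (apply Rmult_le_compat; auto). lra. }
  assert (Pi := PI2_1). 
  assert (I1 : RInt (fun t => Cmod (B t * ps g (gam t) n) ^ 2) 0 (2 * PI) <=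
      RInt (fun t => rsum (fun m => F m t) M) 0 (2 * PI)).
  { apply RInt_le; [lra|apply exR; auto| |intros; apply Pt; lra].
    apply exR. intros t. apply continuous_rsum. auto. }
  set (K := 32 * (/ c1 + / b2) * (sN / w sN + beta) * S).
  assert (S0 : 0 <= S) by (apply rsum_nonneg; intros; apply pow2_ge_0).
  assert (ic : 0 < / c1) by (apply Rinv_0_lt_compat; auto).
  assert (ib : 0 < / b2) by (apply Rinv_0_lt_compat; auto).
  assert (ib1 : / b1 = / c1 * (sN / w sN)) by (unfold b1; field; lra).
  assert (e0 : 0 < sN / w sN) by (apply Rdiv_lt_0_compat; auto).
  assert (I2 : RInt (fun t => rsum (fun m => F m t) M) 0 (2 * PI) <= INR M * K).
  { apply RInt_rsum_le; auto. intros m. unfold F.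
    rewrite (RInt_plus (V := R_CompleteNormedModule)).
    2: { apply exR. intros t. apply (continuous_scal_r (V := R_NormedModule)), ct. }
    2: { apply exR. intros t. apply (continuous_scal_r (V := R_NormedModule)), ct. }
    rewrite (RInt_scal (V := R_CompleteNormedModule) (tent b1 m)) by (apply exR; auto).
    rewrite (RInt_scal (V := R_CompleteNormedModule) (tent b2 m)) by (apply exR; auto).
    assert (T1 := RInt_tent Q b1 (tau m) cQ Qp Q0 Hb1). fold (tent b1 m) in T1.
    assert (T2 := RInt_tent Q b2 (tau m) cQ Qp Q0 Hb2). fold (tent b2 m) in T2.
    set (X1 := RInt (tent b1 m) 0 (2 * PI)) in *. set (X2 := RInt (tent b2 m) 0 (2 * PI)) in *.
    change (4 * X1 + 4 * beta * X2 <= K).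
    assert (U1 : X1 <= 8 * (/ c1 * (sN / w sN)) * S).
    { eapply Rle_trans; [exact T1|]. unfold Rdiv at 1. rewrite ib1.
      assert (0 < / c1 * (sN / w sN)) by (apply Rmult_lt_0_compat; auto). nra. }
    assert (U2 : X2 <= 8 * / b2 * S).
    { eapply Rle_trans; [exact T2|]. unfold Rdiv at 1. nra. }
    assert (U3 : beta * X2 <= beta * (8 * / b2 * S)) by (apply Rmult_le_compat_l; auto).
    unfold K. set (u := / c1) in *. set (v := / b2) in *. set (e := sN / w sN) in *.
    clearbody u v e.
    assert (0 <= v * e * S) by (repeat apply Rmult_le_pos; lra).
    assert (0 <= u * beta * S) by (repeat apply Rmult_le_pos; lra).
    nra. }
  assert (K0 : 0 <= INR M * K).
  { apply Rmult_le_pos; [apply pos_INR|]. unfold K. repeat apply Rmult_le_pos; lra. }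
  unfold ravg. replace (32 * INR M * (/ c1 + / b2) * (sN / w sN + beta) * S) with (INR M * K)
    by (unfold K; ring).
  assert (i2 : 0 < / (2 * PI) <= 1).
  { split; [apply Rinv_0_lt_compat; lra|]. rewrite <- Rinv_1. apply Rinv_le_contravar; lra. }
  set (I := RInt (fun t => Cmod (B t * ps g (gam t) n) ^ 2) 0 (2 * PI)) in *. nra.
Qed.

(** * The closed disk *)

(** The radial retraction onto the closed disk turns a function continuous there into one
    continuous on the whole plane. *)
Definition ret (z : C) : C := (z * / RtoC (Rmax 1 (Cmod z)))%C.

Lemma Rmax_1_neq_0 z : RtoC (Rmax 1 (Cmod z)) <> RtoC 0.
Proof. intros E. apply RtoC_inj in E. assert (H := Rmax_l 1 (Cmod z)). lra. Qed.

Lemma ret_id z : Cmod z <= 1 -> ret z = z.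
Proof.
  intros H. unfold ret. rewrite Rmax_left by auto. field.
Qed.

Lemma ret_le_1 z : Cmod (ret z) <= 1.
Proof.
  unfold ret. rewrite Cmod_mult, Cmod_inv by apply Rmax_1_neq_0.
  assert (H := Rmax_l 1 (Cmod z)). assert (H2 := Rmax_r 1 (Cmod z)).
  rewrite Cmod_R, Rabs_pos_eq by lra.
  apply Rmult_le_reg_r with (Rmax 1 (Cmod z)); [lra|].
  rewrite Rmult_assoc, Rinv_l; lra.
Qed.

Lemma ret_cat z : cat Cd ret z.
Proof.
  apply cat_mult; [apply cat_id|]. apply cat_inv; [|apply Rmax_1_neq_0].
  intros eps He. exists eps. split; auto. intros y Hy. rewrite <- RtoC_minus, Cmod_R.
  eapply Rle_lt_trans; [|exact Hy]. unfold Cd.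
  eapply Rle_trans; [|apply Cmod_triangle_inv]. unfold Rmax.
  destruct (Rle_dec 1 (Cmod y)), (Rle_dec 1 (Cmod z)); unfold Rabs;
    repeat destruct Rcase_abs; lra.
Qed.

Lemma disk_algebra_cat phi z : disk_algebra phi -> cat Cd (fun y => phi (ret y)) z.
Proof.
  intros [Hc _] eps He.
  assert (He2 : 0 < eps / 2) by lra.
  destruct (Hc (ret z) (ret_le_1 z) (ball (phi (ret z)) (mkposreal _ He2))) as [d Hd].
  { exists (mkposreal _ He2). intros y Hy. exact Hy. }
  destruct (ret_cat z d (cond_pos d)) as [d2 [Hd2 D2]].
  exists d2. split; auto. intros y Hy.
  assert (B : ball (phi (ret z)) (mkposreal _ He2) (phi (ret y))).
  { apply Hd; [|apply ret_le_1]. apply C_NormedModule_mixin_compat1. apply D2, Hy. }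
  apply C_NormedModule_mixin_compat2 in B.
  eapply Rlt_le_trans; [exact B|]. simpl.
  assert (sqrt 2 <= 2).
  { rewrite <- (sqrt_pow2 2) at 2 by lra. apply sqrt_le_1_alt. lra. }
  nra.
Qed.

Lemma symbol_cdisk phi z : symbol phi -> disk_algebra phi -> Cmod z <= 1 -> Cmod (phi z) <= 1.
Proof.
  intros [_ Hs] Hd Hz. apply le_epsilon. intros eps He.
  destruct (disk_algebra_cat phi z Hd eps He) as [d [Hd0 D]].
  set (t := Rmin d 1 / 2).
  assert (m1 : 0 < Rmin d 1) by (apply Rmin_pos; lra).
  assert (m2 := Rmin_l d 1). assert (m3 := Rmin_r d 1).
  assert (Ht : 0 < t < d /\ t < 1) by (unfold t; lra).
  set (y := (RtoC (1 - t) * z)%C).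
  assert (Z0 := Cmod_ge_0 z).
  assert (Hy : Cmod y < 1) by (unfold y; rewrite Cmod_mult, Cmod_R, Rabs_pos_eq; nra).
  assert (Q : Cd z y < d).
  { unfold Cd. replace (y - z)%C with (- (RtoC t * z))%C by (unfold y; rewrite RtoC_minus; ring).
    rewrite Cmod_opp, Cmod_mult, Cmod_R, Rabs_pos_eq by lra. nra. }
  specialize (D y Q). simpl in D. rewrite !ret_id in D by lra.
  specialize (Hs y Hy). unfold in_disk in Hs.
  assert (T := Cmod_triangle (phi y) (- (phi y - phi z))). rewrite Cmod_opp in T.
  replace (phi y + - (phi y - phi z))%C with (phi z) in T by ring. lra.
Qed.

Lemma bdry_ccont phi : disk_algebra phi -> ccont (bdry phi).
Proof.
  intros H t.
  apply cat_ext with (fun t => phi (ret (polar 1 t))).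
  - intros y. unfold bdry. rewrite ret_id; auto. rewrite Cmod_polar; lra.
  - apply (cat_comp Rd (fun y => phi (ret y)) (polar 1)); [apply polar_cat_t|].
    apply disk_algebra_cat, H.
Qed.

Lemma bdry_le_1 phi t : symbol phi -> disk_algebra phi -> Cmod (bdry phi t) <= 1.
Proof. intros H1 H2. apply symbol_cdisk; auto. rewrite Cmod_polar; lra. Qed.

(** * From the boundary to the Hardy space norm *)

(** A polynomial composed with [phi] belongs to the disk algebra, so that its means are at
    most the boundary mean; a power series is a locally uniform limit of polynomials. *)
Lemma mean2_from_boundary phi pts n X g h r :
  symbol phi -> disk_algebra phi -> (forall i, Cmod (pts i) < 1) -> 0 <= X ->
  (forall g m, ravg (fun t => Cmod (bprod pts n (bdry phi t) * ps g (bdry phi t) m) ^ 2) <=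
     X ^ 2 * rsum (fun k => Cmod (g k) ^ 2) m) ->
  l2b g 1 -> (forall z, Cmod z < 1 -> cat Cd h z) ->
  (forall z, Cmod z < 1 -> h z = (bprod pts n (phi z) * ps_value g (phi z))%C) ->
  0 <= r < 1 -> mean2 h r <= X.
Proof.
  intros Hs Hd Hp HX HB Hg Hh Eh Hr. apply mean2_le; auto.
  assert (ch : ccont (fun t => h (polar r t))).
  { apply ccont_circle. intros t. apply Hh. rewrite Cmod_polar; lra. }
  destruct (ccont_bounded _ ch) as [K [_ HK]].
  assert (cphi : forall z, Cmod z < 1 -> cdif phi z).
  { intros z Hz. apply analytic_cdif; auto. apply Hs. }
  destruct (continuity_ab_maj (fun t => Cmod (phi (polar r t))) 0 (2 * PI)) as [tm [Htm _]].
  { assert (P := two_pi_pos). lra. }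
  { intros c _. apply continuity_pt_filterlim. apply cat_continuous_R, cat_Cmod.
    apply (ccont_circle phi r). intros t. apply cdif_cat, cphi. rewrite Cmod_polar; lra. }
  set (rho := Cmod (phi (polar r tm))) in *.
  assert (Hrho : 0 <= rho < 1).
  { split; [apply Cmod_ge_0|]. apply Hs. unfold in_disk. rewrite Cmod_polar; lra. }
  apply (ravg_sq_limit _ K); auto. intros eta He.
  destruct (geom_small rho (1 / (1 - rho)) eta Hrho) as [N HN]; auto.
  { unfold Rdiv. rewrite Rmult_1_l. left. apply Rinv_0_lt_compat. lra. }
  specialize (HN N (le_n _)).
  set (G := fun z => (bprod pts n (phi (ret z)) * ps g (phi (ret z)) N)%C).
  assert (G1 : forall z, Cmod z <= 1 -> G z = (bprod pts n (phi z) * ps g (phi z) N)%C).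
  { intros z Hz. unfold G. rewrite ret_id; auto. }
  assert (cG : forall z, cat Cd G z).
  { intros z. assert (c0 := disk_algebra_cat phi z Hd).
    apply cat_mult.
    - apply (cat_comp Cd (bprod pts n) (fun y => phi (ret y))); auto.
      apply cdif_cat, bprod_cdif; auto. apply symbol_cdisk; auto using ret_le_1.
    - apply (cat_csum Cd (fun k y => g k * phi (ret y) ^ k)%C). intros k.
      apply cat_mult; [apply cat_const|apply cat_pow, c0]. }
  assert (dG : forall z, Cmod z < 1 -> cdif G z).
  { intros z Hz. apply cdif_ext_loc with (fun z => (bprod pts n (phi z) * ps g (phi z) N)%C).
    - exists (1 - Cmod z). split; [lra|]. intros y Hy. symmetry. apply G1.
      unfold Cd in Hy. assert (T := Cmod_triangle (y - z) z).
      replace (y - z + z)%C with y in T by ring. lra.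
    - apply cdif_mult.
      + apply (cdif_comp (bprod pts n) phi); auto. apply bprod_cdif; auto.
        apply symbol_cdisk; auto. lra.
      + apply (cdif_csum (fun k y => g k * phi y ^ k)%C). intros k.
        apply cdif_mult; [apply cdif_const|apply cdif_pow; auto]. }
  exists (fun t => G (polar r t)). split; [apply ccont_circle; auto|]. split.
  - intros t Ht. assert (Hz : Cmod (polar r t) < 1) by (rewrite Cmod_polar; lra).
    rewrite Eh, G1 by lra. set (w := phi (polar r t)).
    assert (Hw : Cmod w <= rho) by (apply Htm; auto).
    replace (bprod pts n w * ps_value g w - bprod pts n w * ps g w N)%C
      with (bprod pts n w * (ps_value g w - ps g w N))%C by ring.
    rewrite Cmod_mult. assert (B := bprod_le_1 pts n w Hp ltac:(lra)).
    assert (T : Cmod (ps_value g w - ps g w N) <= 1 * rho ^ N / (1 - rho)).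
    { apply psum_tail with 1; try lra.
      - intros k. rewrite pow1, Rmult_1_r. assert (Q := l2b_coef_bound g 1 k Hg).
        assert (Q0 := Cmod_ge_0 (g k)). nra.
      - apply ps_value_correct; [apply (l2b_bdd _ _ Hg)|lra]. }
    assert (B0 := Cmod_ge_0 (bprod pts n w)). assert (T0 := Cmod_ge_0 (ps_value g w - ps g w N)).
    unfold Rdiv in *. nra.
  - eapply Rle_trans; [apply ravg_sq_boundary; auto|].
    rewrite <- (Rmult_1_r (X ^ 2)).
    eapply Rle_trans; [|apply (Rmult_le_compat_l (X ^ 2) (rsum (fun k => Cmod (g k) ^ 2) N) 1); [apply pow2_ge_0|apply (Hg N)]].
    eapply Rle_trans; [|apply HB]. right. f_equal. apply functional_extensionality. intros t.
    rewrite G1 by (rewrite Cmod_polar; lra). reflexivity.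
Qed.

(** * The finite rank operators *)

Lemma h2norm_le f M : (forall r, 0 <= r < 1 -> mean2 f r <= M) -> Rbar_le (h2norm f) (Finite M).
Proof.
  intros H. apply (Lub_Rbar_correct (fun x => exists r, 0 <= r < 1 /\ x = mean2 f r)).
  intros x [r [Hr ->]]. apply H, Hr.
Qed.

Lemma h2norm_ge f r : 0 <= r < 1 -> Rbar_le (Finite (mean2 f r)) (h2norm f).
Proof.
  intros H. apply (Lub_Rbar_correct (fun x => exists r, 0 <= r < 1 /\ x = mean2 f r)).
  exists r. auto.
Qed.

Lemma h2norm_nonneg f : Rbar_le (Finite 0) (h2norm f).
Proof.
  eapply Rbar_le_trans; [|apply (h2norm_ge f 0); lra]. simpl. apply sqrt_pos.
Qed.

Lemma is_finite_between x M : Rbar_le (Finite 0) x -> Rbar_le x (Finite M) -> is_finite x.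
Proof. destruct x; simpl; intros; try contradiction; reflexivity. Qed.

Lemma h2norm_bounded f M : (forall z, Cmod z < 1 -> cat Cd f z) -> 0 <= M ->
  (forall z, Cmod z < 1 -> Cmod (f z) <= M) -> Rbar_le (h2norm f) (Finite M).
Proof.
  intros Hc HM H. apply h2norm_le. intros r Hr. apply mean2_le; auto.
  rewrite <- (ravg_const (M ^ 2)). apply ravg_le.
  - apply ccont_sq, ccont_circle. intros t. apply Hc. rewrite Cmod_polar; lra.
  - intros. apply continuous_const.
  - intros t _. apply pow_incr. split; [apply Cmod_ge_0|]. apply H. rewrite Cmod_polar; lra.
Qed.

Lemma H2_bounded f M : analytic_disk f -> 0 <= M -> (forall z, Cmod z < 1 -> Cmod (f z) <= M) -> H2 f.
Proof.
  intros Ha HM H. split; auto. apply (is_finite_between _ M); [apply h2norm_nonneg|].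
  apply h2norm_bounded; auto. intros z Hz. apply cdif_cat, analytic_cdif; auto.
Qed.

Lemma H2_cdif f z : H2 f -> Cmod z < 1 -> cdif f z.
Proof. intros [H _]. apply analytic_cdif, H. Qed.

Lemma H2_mean2 f M r : Rbar_le (h2norm f) (Finite M) -> 0 <= r < 1 -> mean2 f r <= M.
Proof. intros H Hr. apply (Rbar_le_trans _ _ _ (h2norm_ge f r Hr) H). Qed.

Lemma H2_coef_l2b f M : H2 f -> Rbar_le (h2norm f) (Finite M) -> l2b (coef f) (M ^ 2).
Proof.
  intros Hf HM. apply coef_l2b; [intros; apply H2_cdif; auto|].
  intros r Hr. apply (H2_mean2 f M r HM Hr).
Qed.

Lemma H2_coef_l2b_ex f : H2 f -> exists M, l2b (coef f) M.
Proof.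
  intros Hf. exists (real (h2norm f) ^ 2). apply H2_coef_l2b; auto.
  destruct Hf as [_ E]. rewrite E. apply Rbar_le_refl.
Qed.

Lemma ps_value_coef f M z : (forall z, Cmod z < 1 -> cdif f z) -> l2b (coef f) M -> Cmod z < 1 ->
  ps_value (coef f) z = f z.
Proof.
  intros Hf Hb Hz. apply (psum_unique (coef f) z).
  - apply ps_value_correct; auto. apply (l2b_bdd _ _ Hb).
  - intros eps He. apply taylor_series; auto.
Qed.

Lemma coef_ext f g : eq_disk f g -> coef f = coef g.
Proof.
  intros E. apply functional_extensionality. intros k. apply avg_ext. intros t.
  rewrite E; auto. unfold in_disk. rewrite Cmod_polar; lra.
Qed.

Lemma coef_lin f g c : (forall z, Cmod z < 1 -> cdif f z) -> (forall z, Cmod z < 1 -> cdif g z) ->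
  coef (fun z => c * f z + g z)%C = (fun k => coef g k + c * coef f k)%C.
Proof.
  intros Hf Hg. apply functional_extensionality. intros k. unfold coef, acoef.
  assert (ci : ccont (fun t => / polar (1 / 2) t ^ k)%C).
  { intros t. apply cat_inv; [apply cat_pow, polar_cat_t|]. apply Cpow_nz, polar_neq_0. lra. }
  assert (cc : forall f, (forall z, Cmod z < 1 -> cdif f z) ->
    ccont (fun t => f (polar (1 / 2) t) * / polar (1 / 2) t ^ k)%C).
  { intros u Hu t. apply cat_mult; [|apply ci]. apply (ccont_circle u). intros s.
    apply cdif_cat, Hu. rewrite Cmod_polar; lra. }
  rewrite <- avg_scal, <- avg_plus; auto.
  - apply avg_ext. intros. ring.
  - intros t. apply cat_mult; [apply cat_const|apply cc; auto].
Qed.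

(** The composition operator applied to the orthogonal projection of [f] on the span of the
    first [n] Takenaka-Malmquist functions. *)
Definition tmop (phi : C -> C) (pts : nat -> C) (n : nat) : op :=
  fun f z => csum (fun i => tmcoef pts i (coef f) * tmf pts i (phi z))%C n.

Lemma tmf_phi_analytic phi pts i : symbol phi -> disk_algebra phi ->
  (forall i, Cmod (pts i) < 1) -> analytic_disk (fun z => tmf pts i (phi z)).
Proof.
  intros Hs Hd Hp. apply cdif_analytic. intros z Hz. apply (cdif_comp (tmf pts i) phi).
  - apply analytic_cdif; auto. apply Hs.
  - apply tmf_cdif; auto. apply symbol_cdisk; auto. lra.
Qed.

Lemma tmop_analytic phi pts n f : symbol phi -> disk_algebra phi ->
  (forall i, Cmod (pts i) < 1) -> analytic_disk (tmop phi pts n f).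
Proof.
  intros Hs Hd Hp. apply cdif_analytic. intros z Hz.
  apply (cdif_csum (fun i z => tmcoef pts i (coef f) * tmf pts i (phi z))%C). intros i.
  apply cdif_mult; [apply cdif_const|].
  apply (analytic_cdif (fun z => tmf pts i (phi z))); auto using tmf_phi_analytic.
Qed.

Lemma tmop_bound phi pts n f M z : symbol phi -> disk_algebra phi ->
  (forall i, Cmod (pts i) < 1) -> l2b (coef f) M -> Cmod z < 1 ->
  Cmod (tmop phi pts n f z) <= rsum (fun i => sqrt (M / (1 - Cmod (pts i) ^ 2)) * 2) n.
Proof.
  intros Hs Hd Hp Hf Hz. unfold tmop. eapply Rle_trans; [apply Cmod_csum|].
  apply rsum_le. intros i _. rewrite Cmod_mult.
  apply Rmult_le_compat; try apply Cmod_ge_0; [apply tmcoef_bound; auto|].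
  apply tmf_bound; auto. apply symbol_cdisk; auto. lra.
Qed.

Lemma tmop_bound_nonneg pts n M : 0 <= rsum (fun i => sqrt (M / (1 - Cmod (pts i) ^ 2)) * 2) n.
Proof. apply rsum_nonneg. intros i. assert (P := sqrt_pos (M / (1 - Cmod (pts i) ^ 2))). lra. Qed.

Lemma tmop_bounded_op phi pts n : symbol phi -> disk_algebra phi ->
  (forall i, Cmod (pts i) < 1) -> bounded_op (tmop phi pts n).
Proof.
  intros Hs Hd Hp. constructor.
  - intros f Hf. destruct (H2_coef_l2b_ex f Hf) as [M HM].
    apply (H2_bounded _ (rsum (fun i => sqrt (M / (1 - Cmod (pts i) ^ 2)) * 2) n)).
    + apply tmop_analytic; auto.
    + apply tmop_bound_nonneg.
    + intros z Hz. apply tmop_bound; auto.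
  - intros f g _ _ E z _. unfold tmop. rewrite (coef_ext f g E). reflexivity.
  - intros a f g Hf Hg z _. unfold tmop.
    destruct (H2_coef_l2b_ex f Hf) as [M HM]. destruct (H2_coef_l2b_ex g Hg) as [M' HM'].
    rewrite coef_lin by (intros; apply H2_cdif; auto).
    rewrite <- csum_scal, <- csum_plus. apply csum_ext. intros i _.
    rewrite (tmcoef_lin pts (coef g) (coef f) a M' M); auto. ring.
  - set (K := rsum (fun i => sqrt (1 ^ 2 / (1 - Cmod (pts i) ^ 2)) * 2) n).
    unfold opnorm, Rbar_lub. destruct (Rbar_ex_lub _) as [l [L1 L2]]. simpl.
    apply (is_finite_between _ K).
    + eapply Rbar_le_trans; [apply (h2norm_nonneg (tmop phi pts n (fun _ => RtoC 0)))|].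
      apply L1. exists (fun _ => RtoC 0).
      assert (B : forall z, Cmod z < 1 -> Cmod (RtoC 0) <= 0) by (intros; rewrite Cmod_0; lra).
      split; [|split; [|reflexivity]].
      * apply (H2_bounded _ 0); auto; [|lra]. apply cdif_analytic. intros; apply cdif_const.
      * eapply Rbar_le_trans; [apply (h2norm_bounded _ 0); auto; [|lra]|simpl; lra].
        intros; apply cat_const.
    + apply L2. intros x [f [Hf [Hf1 ->]]].
      apply h2norm_bounded.
      * intros z Hz. apply cdif_cat, analytic_cdif; auto. apply tmop_analytic; auto.
      * apply tmop_bound_nonneg.
      * intros z Hz. apply tmop_bound; auto. apply H2_coef_l2b; auto.
Qed.

Lemma sum_n_m_csum (F : nat -> C) n :
  sum_n_m (G := C_AbelianMonoid) (fun i => F (i - 1)%nat) 1 n = csum F n.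
Proof.
  induction n as [|n IH].
  - apply (sum_n_m_zero (G := C_AbelianMonoid)). lia.
  - rewrite (sum_n_Sm (G := C_AbelianMonoid)), IH by lia. simpl. rewrite Nat.sub_0_r. reflexivity.
Qed.

Lemma tmop_rank phi pts n q : symbol phi -> disk_algebra phi ->
  (forall i, Cmod (pts i) < 1) -> (n < q)%nat -> rank_lt (tmop phi pts n) q.
Proof.
  intros Hs Hd Hp Hn. exists n, (fun i z => tmf pts (i - 1) (phi z)). split; auto. split.
  - intros i _. apply (H2_bounded _ 2); [apply tmf_phi_analytic; auto|lra|].
    intros z Hz. apply tmf_bound; auto. apply symbol_cdisk; auto. lra.
  - intros f Hf. exists (fun i => tmcoef pts (i - 1) (coef f)). intros z _.
    rewrite (sum_n_m_csum (fun i => tmcoef pts i (coef f) * tmf pts i (phi z))%C n). reflexivity.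
Qed.

(** The remainder of the expansion is the Blaschke product times a function of norm at most
    that of [f]. *)
Lemma approx_number_le phi pts n q X :
  symbol phi -> disk_algebra phi -> (forall i, Cmod (pts i) < 1) -> 0 <= X -> (n < q)%nat ->
  (forall g m, ravg (fun t => Cmod (bprod pts n (bdry phi t) * ps g (bdry phi t) m) ^ 2) <=
     X ^ 2 * rsum (fun k => Cmod (g k) ^ 2) m) ->
  Rbar_le (approx_number q (comp_op phi)) (Finite X).
Proof.
  intros Hs Hd Hp HX Hn HB.
  apply Rbar_le_trans with (opnorm (op_minus (comp_op phi) (tmop phi pts n))).
  - unfold approx_number, Rbar_glb. destruct (Rbar_ex_glb _) as [l [L1 L2]]. simpl. apply L1.
    exists (tmop phi pts n). split; [apply tmop_bounded_op; auto|]. split; [apply tmop_rank; auto|].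
    reflexivity.
  - unfold opnorm, Rbar_lub. destruct (Rbar_ex_lub _) as [l [L1 L2]]. simpl. apply L2.
    intros x [f [Hf [Hf1 ->]]]. apply h2norm_le. intros r Hr.
    assert (Hl : l2b (coef f) 1).
    { replace 1 with (1 ^ 2) by ring. apply H2_coef_l2b; auto. }
    apply (mean2_from_boundary phi pts n X (divide_all pts (coef f) n)); auto.
    + apply divide_all_l2b; auto.
    + intros z Hz. apply cat_minus.
      * apply (cat_comp Cd f phi).
        -- apply cdif_cat, analytic_cdif; auto. apply Hs.
        -- apply cdif_cat, H2_cdif; auto. apply Hs, Hz.
      * apply cdif_cat, analytic_cdif; auto. apply tmop_analytic; auto.
    + intros z Hz. assert (Hw : Cmod (phi z) < 1) by (apply Hs, Hz).
      unfold op_minus, comp_op, tmop.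
      rewrite <- (ps_value_coef f 1 (phi z)) by (auto; intros; apply H2_cdif; auto).
      rewrite (tm_expansion pts (coef f) 1 (phi z) n) by auto. ring.
Qed.

(** * Choice of the parameters *)

Lemma max_exists (P : nat -> Prop) b : (exists n, P n) -> (forall n, P n -> (n <= b)%nat) ->
  exists n, P n /\ forall m, P m -> (m <= n)%nat.
Proof.
  intros [n0 H0] Hb.
  assert (K : forall k, (exists n, P n /\ (b <= n + k)%nat) ->
    exists n, P n /\ forall m, P m -> (m <= n)%nat).
  { intros k. induction k as [|k IH]; intros [n [Hn Hk]].
    - exists n. split; auto. intros m Hm. specialize (Hb m Hm). lia.
    - destruct (classic (exists m, P m /\ (n < m)%nat)) as [[m [Hm Hnm]]|no].
      + apply IH. exists m. split; auto. lia.
      + exists n. split; auto. intros m Hm. destruct (Nat.le_gt_cases m n); auto.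
        exfalso. apply no. exists m. auto. }
  apply (K b). exists n0. split; auto. lia.
Qed.

Lemma is_Nq_exists p d q : (1 <= p)%nat -> (forall N, (1 <= N)%nat -> (1 <= d N)%Z) ->
  exists N, is_Nq p d q N.
Proof.
  intros Hp Hd. unfold is_Nq. set (ok := fun M => (1 <= M)%nat /\ (Z.of_nat p * Z.of_nat M * d M < Z.of_nat q)%Z).
  destruct (classic (exists M, ok M)) as [H|H].
  - destruct (max_exists ok q H) as [N HN].
    + intros M [M1 M2]. specialize (Hd M M1).
      assert (Q1 : (Z.of_nat M <= Z.of_nat p * Z.of_nat M)%Z) by nia.
      assert (Q2 : (Z.of_nat p * Z.of_nat M <= Z.of_nat p * Z.of_nat M * d M)%Z) by nia.
      lia.
    + exists N. left. exact HN.
  - exists 1%nat. right. split; auto. intros M HM. apply H. exists M. exact HM.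
Qed.

Theorem theorem2p3 :
  forall (phi : C -> C) (p : nat) (xi : nat -> C)
    (w : R -> R) (A : R) (winv : R -> R) (r : nat -> R) (C0 c0 : R),
  symbol phi ->
  disk_algebra phi ->
  (1 <= p)%nat ->
  contact_set phi p xi ->
  modulus w A ->
  concave_upto w A ->
  filterlim (fun h => w h / h) (at_right 0) (Rbar_locally p_infty) ->
  inverse_upto w A winv ->
  globally_regular phi p xi w A r C0 c0 ->
  exists kappa sigma K : R,
    0 < kappa /\ 0 < sigma /\ 0 < K /\
    (forall N : nat, (1 <= N)%nat -> kappa / 2 ^ N <= w A) /\
    forall q : nat, (1 <= q)%nat ->
      exists Nq : nat,
        is_Nq p (d_of winv sigma kappa) q Nq /\
        Rbar_le (approx_number q (comp_op phi))
          (Finite (K * sqrt (winv (kappa / 2 ^ Nq) / (kappa / 2 ^ Nq)))).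
Proof.
  intros phi p xi w A winv r C0 c0 Hs Hd Hp Hct Hm Hcc Hlim Hinv Hg.
  destruct (gr_consts _ _ _ _ _ _ _ _ Hg) as [HC Hc].
  assert (HA := mod_pos _ _ Hm).
  assert (wA : 0 < w A).
  { assert (W := mod_incr _ _ Hm 0 A (Rle_refl _) HA (Rle_refl _)). rewrite (mod_zero _ _ Hm) in W. auto. }
  destruct (finite_cover phi p xi w A r C0 c0 Hct Hm Hg) as [M [tau Hcov]].
  assert (Hxi : forall j, (1 <= j <= p)%nat -> Cmod (xi j) = 1)
    by (intros; apply (contact_norm phi p); auto).
  set (c1 := c0 / C0). assert (Hc1 : 0 < c1) by (apply Rdiv_lt_0_compat; auto).
  (* [c1 * kappa <= 1/2] keeps the linear bounds above $1/2$, and [c0 * kappa <= 1] keeps the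
     zeros in the disk *)
  destruct (small_scale w A winv (Rmin (/ (2 * c1)) (/ c0)) Hm Hlim Hinv) as [kappa [Hk1 [Hk2 Hk3]]].
  { apply Rmin_pos; apply Rinv_0_lt_compat; lra. }
  assert (Hk4 : c1 * kappa <= / 2).
  { apply Rle_trans with (c1 * / (2 * c1)).
    - apply Rmult_le_compat_l; [lra|]. eapply Rle_trans; [apply Hk1|apply Rmin_l].
    - right. field. lra. }
  assert (Hlam : 0 < c0 * kappa <= 1).
  { split; [apply Rmult_lt_0_compat; lra|]. apply Rle_trans with (c0 * / c0).
    - apply Rmult_le_compat_l; [lra|]. eapply Rle_trans; [apply Hk1|apply Rmin_r].
    - right. field. lra. }
  set (lam := c0 * kappa) in *.
  set (sigma := / (lam / (16 * C0))).
  assert (Hdl : 0 < lam / (16 * C0)) by (apply Rdiv_lt_0_compat; lra).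
  assert (Hsig : 0 < sigma) by (apply Rinv_0_lt_compat; auto).
  set (b2 := Rmin (c1 * w A / A) (/ (2 * A))).
  assert (Hb2 : 0 < b2).
  { apply Rmin_pos; [apply Rdiv_lt_0_compat; auto; apply Rmult_lt_0_compat; auto|].
    apply Rinv_0_lt_compat. lra. }
  assert (Hb2A : b2 * A <= / 2).
  { apply Rle_trans with (/ (2 * A) * A); [apply Rmult_le_compat_r; [lra|apply Rmin_r]|].
    right. field. lra. }
  assert (HyN : forall N, 0 < kappa / 2 ^ N <= kappa).
  { intros N. assert (P : 1 <= 2 ^ N) by (apply pow_R1_Rle; lra).
    split; [apply Rdiv_lt_0_compat; lra|]. unfold Rdiv. rewrite <- (Rmult_1_r kappa) at 2.
    apply Rmult_le_compat_l; [lra|]. rewrite <- Rinv_1. apply Rinv_le_contravar; lra. }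
  set (y := fun N => kappa / 2 ^ N). set (s := fun N => winv (y N)).
  assert (Hy : forall N, 0 < y N <= kappa) by exact HyN.
  assert (Hs1 : forall N, 0 < s N <= A /\ w (s N) = y N /\ s N <= y N) by (intros; apply Hk3, Hy).
  assert (He1 : forall N, 0 < s N / y N <= 1).
  { intros N. specialize (Hs1 N). specialize (Hy N). split; [apply Rdiv_lt_0_compat; lra|].
    apply Rmult_le_reg_r with (y N); [lra|]. unfold Rdiv. rewrite Rmult_assoc, Rinv_l; lra. }
  set (K0 := 32 * INR M * (/ c1 + / b2)).
  assert (HK0 : 0 <= K0).
  { unfold K0. assert (Mp := pos_INR M). assert (0 < / c1) by (apply Rinv_0_lt_compat; auto).
    assert (0 < / b2) by (apply Rinv_0_lt_compat; auto). apply Rmult_le_pos; lra. }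
  (* used with $p N d_N$ zeros and [beta = s N / y N], or with no zero and [beta = 1] *)
  assert (Main : forall N n pts beta, (forall i, Cmod (pts i) < 1) -> 0 <= beta ->
    (forall t j, (1 <= j <= p)%nat -> Cmod (bdry phi t - xi j) <= C0 * (1 - Cmod (bdry phi t)) ->
      lam / 2 ^ N <= Cmod (bdry phi t - xi j) -> Cmod (bprod pts n (bdry phi t)) ^ 2 <= beta) ->
    forall g m, ravg (fun t => Cmod (bprod pts n (bdry phi t) * ps g (bdry phi t) m) ^ 2) <=
      K0 * (s N / y N + beta) * rsum (fun k => Cmod (g k) ^ 2) m).
  { intros N n pts beta Hpts Hbeta HB g m. destruct (Hs1 N) as [S1 [S2 S3]].
    assert (Bc : ccont (fun t => bprod pts n (bdry phi t))).
    { intros t. apply (cat_comp Rd (bprod pts n) (bdry phi)); [apply bdry_ccont; auto|].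
      apply cdif_cat, bprod_cdif; auto. apply bdry_le_1; auto. }
    rewrite <- S2. unfold K0.
    apply (boundary_estimate (bdry phi) (fun t => bprod pts n (bdry phi t)) M tau w c1 b2 A (s N) beta);
      auto; try lra.
    - apply bdry_ccont; auto.
    - intros t. apply bprod_le_1; auto. apply bdry_le_1; auto.
    - rewrite S2. destruct (Hy N). nra.
    - intros u Hu. apply (concave_chord w A); auto.
    - intros t Ht. destruct (Hcov t Ht) as [k [j [Hk [Hj [Etau [Ed Hr]]]]]].
      exists k. split; auto. destruct (gr_radius _ _ _ _ _ _ _ _ Hg j Hj) as [Rj RA].
      set (u := Rabs (t - tau k)) in *. assert (u0 : 0 <= u) by apply Rabs_pos.
      assert (Nt := gr_nontangential _ _ _ _ _ _ _ _ Hg j (tau k) t Hj Etau ltac:(lra)).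
      assert (Lo := gr_lower _ _ _ _ _ _ _ _ Hg j (tau k) t Hj Etau ltac:(lra)).
      rewrite Ed in Lo. rewrite Etau in Nt, Lo.
      assert (G1 : Cmod (bdry phi t) <= 1 - c1 * w u).
      { assert (c1 * w u <= 1 - Cmod (bdry phi t)); [|lra].
        apply Rmult_le_reg_r with C0; auto. unfold c1.
        replace (c0 / C0 * w u * C0) with (c0 * w u) by (field; lra). lra. }
      split; [lra|]. split; [exact G1|]. split.
      + assert (Ch := concave_chord w A u A Hm Hcc ltac:(lra) ltac:(lra)).
        assert (B : b2 * u <= c1 * w A / A * u) by (apply Rmult_le_compat_r; [lra|apply Rmin_l]).
        assert (E : c1 * w A / A * u = c1 * (u / A * w A)) by (field; lra).
        assert (c1 * (u / A * w A) <= c1 * w u) by (apply Rmult_le_compat_l; lra). lra.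
      + intros Hu. apply (HB t j Hj Nt).
        assert (W : w (s N) <= w u).
        { destruct Hu as [l|e]; [left; apply (mod_incr _ _ Hm); lra|rewrite e; lra]. }
        rewrite S2 in W. eapply Rle_trans; [|exact Lo]. unfold lam.
        replace (c0 * kappa / 2 ^ N) with (c0 * y N) by (unfold y; field; apply pow_nonzero; lra).
        apply Rmult_le_compat_l; lra. }
  (* the term $3$ serves [beta = s N / y N]; the other one serves [N = 1] and [beta = 1] *)
  set (K1 := K0 * (3 + / (s 1%nat / y 1%nat))).
  assert (ie : 0 < / (s 1%nat / y 1%nat)) by (apply Rinv_0_lt_compat, He1).
  assert (HK1 : 0 <= K1) by (apply Rmult_le_pos; lra).
  exists kappa, sigma, (sqrt K1 + 1). assert (sK := sqrt_pos K1).
  split; [lra|]. split; [auto|]. split; [lra|]. split.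
  { intros N _. destruct (HyN N). lra. }
  intros q Hq.
  assert (lnp : forall N, 0 <= ln (y N / s N)).
  { intros N. rewrite <- ln_1. destruct (Hs1 N) as [S1 [_ S3]].
    assert (L : 1 <= y N / s N).
    { apply Rmult_le_reg_r with (s N); [lra|]. unfold Rdiv. rewrite Rmult_assoc, Rinv_l; lra. }
    destruct L as [L|<-]; [|lra]. left. apply ln_increasing; lra. }
  assert (Hd1 : forall N, (1 <= N)%nat -> (1 <= d_of winv sigma kappa N)%Z).
  { intros N _. unfold d_of. fold (y N) (s N).
    assert (P : 0 <= sigma * ln (y N / s N)) by (apply Rmult_le_pos; auto; lra).
    destruct (base_Int_part (sigma * ln (y N / s N))) as [I1 I2].
    assert (-1 < Int_part (sigma * ln (y N / s N)))%Z by (apply lt_IZR; lra). lia. }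
  destruct (is_Nq_exists p (d_of winv sigma kappa) q Hp Hd1) as [N HN].
  exists N. split; [exact HN|]. fold (y N) (s N).
  assert (Fin : forall n pts beta, (forall i, Cmod (pts i) < 1) -> (n < q)%nat ->
    (forall g m, ravg (fun t => Cmod (bprod pts n (bdry phi t) * ps g (bdry phi t) m) ^ 2) <=
      K0 * (s N / y N + beta) * rsum (fun k => Cmod (g k) ^ 2) m) ->
    s N / y N + beta <= (3 + / (s 1%nat / y 1%nat)) * (s N / y N) ->
    Rbar_le (approx_number q (comp_op phi)) (Finite ((sqrt K1 + 1) * sqrt (s N / y N)))).
  { intros n pts beta Hpts Hn HB Hbeta.
    assert (X0 : 0 <= (sqrt K1 + 1) * sqrt (s N / y N))
      by (apply Rmult_le_pos; [lra|apply sqrt_pos]).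
    apply (approx_number_le phi pts n q); auto.
    intros g m. eapply Rle_trans; [apply HB|].
    apply Rmult_le_compat_r; [apply rsum_nonneg; intros; apply pow2_ge_0|].
    destruct (He1 N) as [e0 e1].
    apply Rle_trans with (K1 * (s N / y N)).
    - unfold K1. rewrite Rmult_assoc. apply Rmult_le_compat_l; auto.
    - rewrite Rpow_mult_distr. rewrite <- Rsqr_pow2 with (x := sqrt (s N / y N)), Rsqr_sqrt by lra.
      apply Rmult_le_compat_r; [lra|].
      assert (E : K1 = sqrt K1 * sqrt K1) by (rewrite sqrt_sqrt; auto).
      rewrite E at 1. nra. }
  destruct (He1 N) as [e0 e1].
  destruct HN as [[[HN1 HN2] _]|[_ HN1]].
  - set (D := Z.to_nat (d_of winv sigma kappa N)).
    assert (ED : Z.of_nat D = d_of winv sigma kappa N)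
      by (apply Z2Nat.id; specialize (Hd1 N HN1); lia).
    apply (Fin (D * (p * N))%nat (bzeros p xi lam N) (s N / y N)).
    + intros i. apply zero_at_disk; auto.
    + apply Nat2Z.inj_lt. rewrite !Nat2Z.inj_mul, ED. lia.
    + apply Main; try lra; [intros i; apply zero_at_disk; auto|].
      intros t j Hj H1 H2.
      eapply Rle_trans; [apply (bprod_small p xi lam C0 N D j); auto; apply bdry_le_1; auto|].
      assert (ID : sigma * ln (y N / s N) <= INR D).
      { rewrite INR_IZR_INZ, ED. unfold d_of. fold (y N) (s N). rewrite plus_IZR.
        destruct (base_Int_part (sigma * ln (y N / s N))) as [I1 I2]. lra. }
      destruct (Hs1 N) as [S1 _]. destruct (Hy N) as [Y1 _].
      rewrite <- (exp_ln (s N / y N)) by auto.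
      replace (ln (s N / y N)) with (- ln (y N / s N)).
      2: { rewrite <- ln_Rinv by (apply Rdiv_lt_0_compat; lra). f_equal. field. lra. }
      assert (X : ln (y N / s N) <= lam / (16 * C0) * INR D).
      { apply Rmult_le_reg_l with sigma; auto. rewrite <- Rmult_assoc.
        unfold sigma at 2. rewrite Rinv_l by lra. lra. }
      assert (X' : - (lam / (16 * C0)) * INR D <= - ln (y N / s N)) by lra.
      destruct X' as [l|e]; [left; apply exp_increasing; exact l|rewrite e; lra].
    + assert (0 < / (s 1%nat / y 1%nat) * (s N / y N)) by (apply Rmult_lt_0_compat; auto). lra.
  - subst N. apply (Fin 0%nat (fun _ => RtoC 0) 1); auto.
    + intros _. rewrite Cmod_0. lra.
    + apply Main; try lra; [intros _; rewrite Cmod_0; lra|].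
      intros t j _ _ _. simpl. rewrite Cmod_1. lra.
    + rewrite Rmult_plus_distr_r, Rinv_l by lra. lra.
Qed.
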